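(* A $6$-dimensional nilpotent real Lie algebra $\mathfrak{g}$ has a half-flat structure if and only if both of the following hold: (i) $\mathfrak{g}$ has a coherent splitting; and (ii) for each coherent splitting of $\mathfrak{g}$, $h^{0,3}\neq0$. In particular, up to isomorphism, the $6$-dimensional nilpotent Lie algebras admitting a half-flat structure are exactly: $(0,0,12,13,23,14)$, $(0,0,12,13,23,14+25)$, $(0,0,12,13,23,14-25)$, $(0,0,12,13,14+23,24+15)$, $(0,0,0,12,14,15+23)$, $(0,0,0,12,14-23,15+34)$, $(0,0,0,12,14,15)$, $(0,0,0,12,23,14+35)$, $(0,0,0,12,23,14-35)$, $(0,0,0,12,13,14+35)$, $(0,0,0,12,13,14+23)$, $(0,0,0,12,13,24)$, $(0,0,0,12,13,23)$, $(0,0,0,12,14,15+24)$, $(0,0,0,12,14,15+23+24)$, $(0,0,0,0,12,14+25)$, $(0,0,0,0,12,15+34)$, $(0,0,0,0,13+42,14+23)$, $(0,0,0,0,12,14+23)$, $(0,0,0,0,12,13)$, $(0,0,0,0,12,34)$, $(0,0,0,0,0,12+34)$, $(0,0,0,0,0,12)$, $(0,0,0,0,0,0)$; and those admitting none are exactly: $(0,0,12,13,14+23,34+52)$, $(0,0,12,13,14,34+52)$, $(0,0,12,13,14,15)$, $(0,0,12,13,14,23+15)$, $(0,0,0,12,14,24)$, $(0,0,0,12,13+42,14+23)$, $(0,0,0,12,14,13+42)$, $(0,0,0,12,13+14,24)$, $(0,0,0,12,13,14)$, $(0,0,0,0,12,15)$.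
   Context: Notation: $(0,0,12,13,23,14)$ denotes the Lie algebra having a basis $e^1,\dots,e^6$ of $\mathfrak{g}^*$ with $de^1=0$, $de^2=0$, $de^3=e^{12}$, $de^4=e^{13}$, $de^5=e^{23}$, $de^6=e^{14}$, where $e^{ij}=e^i\wedge e^j$, entries like $14+25$ mean $e^{14}+e^{25}$, $14-25$ means $e^{14}-e^{25}$, $42$ means $e^{42}=e^4\wedge e^2$, and $d$ is the Chevalley–Eilenberg differential ($d\alpha(X,Y)=-\alpha([X,Y])$ on $1$-forms, extended as a derivation). An $\mathrm{SU}(3)$-structure on a $6$-dimensional Lie algebra is a pair $(\omega,\psi^+)\in\Lambda^2\mathfrak{g}^*\times\Lambda^3\mathfrak{g}^*$ such that for some basis $\eta^1,\dots,\eta^6$ of $\mathfrak{g}^*$ and some $3$-form $\psi^-$, $\omega=\eta^{12}+\eta^{34}+\eta^{56}$ and $\psi^++i\psi^-=(\eta^1+i\eta^2)\wedge(\eta^3+i\eta^4)\wedge(\eta^5+i\eta^6)$; it is half-flat if $d\omega\wedge\omega=0$ and $d\psi^+=0$. A coherent splitting is a decomposition $\mathfrak{g}^*=V_1\oplus V_2$ with $\dim V_1=2$ such that, with $\Lambda^{p,q}=\Lambda^pV_1\otimes\Lambda^qV_2$, $d(\Lambda^{p,q})\subset\Lambda^{p+1,q}+\Lambda^{p+2,q-1}$. With $F^k_p=\bigoplus_{p'\ge p}\Lambda^{p',k-p'}$, $Z^k$ the closed $k$-forms, $H^k$ the $k$-th cohomology of $(\Lambda^*\mathfrak{g}^*,d)$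 and $H^k_p\subset H^k$ the image of $Z^k\cap F^k_p$, set $H^{p,q}=H^{p+q}_p/H^{p+q}_{p+1}$ and $h^{p,q}=\dim H^{p,q}$. *)

(* Defs.v *)
From HB Require Import structures.
From mathcomp Require Import all_boot all_order all_algebra.
From mathcomp Require Import reals.
Set Implicit Arguments. Unset Strict Implicit. Unset Printing Implicit Defensive.
Import Order.TTheory GRing.Theory Num.Theory.
Local Open Scope ring_scope.

Section Defs.
Variable R : realType.

Definition vec := 'rV[R]_6.

Definition is_lie (br : vec -> vec -> vec) : Prop :=
  [/\ (forall (a : R) x y z, br (a *: x + y) z = a *: br x z + br y z),
      (forall (a : R) x y z, br z (a *: x + y) = a *: br z x + br z y),
      (forall x, br x x = 0) &
      (forall x y z, br x (br y z) + br y (br z x) + br z (br x y) = 0)].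

(** Nilpotent: some term of the lower central series vanishes, i.e. all
    iterated brackets [x1,[x2,...,[xn,y]...]] of some fixed length n vanish
    (these span the (n+1)-st term of the lower central series). *)
Definition nilpotent (br : vec -> vec -> vec) : Prop :=
  exists n : nat, forall (xs : seq vec) (y : vec),
    size xs = n -> foldr br y xs = 0.

Definition lie_iso (br1 br2 : vec -> vec -> vec) : Prop :=
  exists A : 'M[R]_6, A \in unitmx /\
    forall x y, br2 (x *m A) (y *m A) = (br1 x y) *m A.

(** Differential forms on g: a (multilinear alternating) form is a function
    of a finite list of vectors; a k-form vanishes on lists of length <> k. *)
Definition form := seq vec -> R.
Definition fzero : form := fun _ => 0.
Definition fadd (a b : form) : form := fun xs => a xs + b xs.
Definition fopp (a : form) : form := fun xs => - a xs.

Definition dCE (br : vec -> vec -> vec) (a : form) : form := fun xs =>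
  let n := size xs in
  \sum_(i < n) \sum_(j < n | (i < j)%N)
     (-1) ^+ (i + j)%N *
     a (br (nth 0 xs i) (nth 0 xs j)
          :: [seq nth 0 xs t | t <- iota 0 n & (t != val i) && (t != val j)]).

(** Wedge product of a p-form and a q-form (determinant convention:
    e^1/\e^2 (X,Y) = e^1(X)e^2(Y) - e^2(X)e^1(Y)), as a sum over shuffles. *)
Definition shuffle_sign n (S : {set 'I_n}) : R :=
  (-1) ^+ #|[set st : 'I_n * 'I_n |
              [&& st.1 \in S, st.2 \notin S & (st.2 < st.1)%N]]|.

Definition wedge (p q : nat) (a b : form) : form := fun xs =>
  if size xs == (p + q)%N then
    \sum_(S : {set 'I_(size xs)} | #|S| == p)
       shuffle_sign S
       * a [seq nth 0 xs (val i) | i <- enum S]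
       * b [seq nth 0 xs (val i) | i <- enum (~: S)]
  else 0.

(** A coframe (basis of g^* ) given by an invertible matrix M:
    the i-th basis 1-form is eta_i(X) = (X *m M)_i.  For a set I of indices,
    eta_I = eta_{i_1} /\ ... /\ eta_{i_k} (i_1 < ... < i_k), evaluated by
    the determinant det(eta_{i_a}(X_b)). *)
Definition coform (M : 'M[R]_6) (i : 'I_6) (x : vec) : R := (x *m M) ord0 i.

Definition etaI (M : 'M[R]_6) (I : {set 'I_6}) : form := fun xs =>
  if size xs == #|I| then
    \det (\matrix_(a < #|I|, b < #|I|)
            coform M (nth ord0 (enum I) a) (nth 0 xs b))
  else 0.

Definition eta3 M (i j k : nat) : form :=
  etaI M [set (inord i : 'I_6); inord j; inord k].
Definition eta2 M (i j : nat) : form := etaI M [set (inord i : 'I_6); inord j].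

(** SU(3)-structure (omega, psi+): for some basis eta^1..eta^6 of g^*,
    omega = eta^12 + eta^34 + eta^56 and
    psi+ = Re((eta^1 + i eta^2)/\(eta^3 + i eta^4)/\(eta^5 + i eta^6))
         = eta^135 - eta^146 - eta^236 - eta^245
    (indices below are 0-based; psi- is then the imaginary part). *)
Definition su3_structure (omega psi : form) : Prop :=
  exists M : 'M[R]_6, M \in unitmx /\
    omega = fadd (eta2 M 0 1) (fadd (eta2 M 2 3) (eta2 M 4 5)) /\
    psi = fadd (eta3 M 0 2 4)
            (fadd (fopp (eta3 M 0 3 5))
               (fadd (fopp (eta3 M 1 2 5)) (fopp (eta3 M 1 3 4)))).

Definition half_flat_structure br (omega psi : form) : Prop :=
  [/\ su3_structure omega psi,
      wedge 3 2 (dCE br omega) omega = fzero &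
      dCE br psi = fzero].

Definition has_half_flat br : Prop :=
  exists omega psi, half_flat_structure br omega psi.

(** Splittings g^* = V1 (+) V2 with dim V1 = 2: given by an adapted basis
    (invertible M), V1 = span(eta_0, eta_1), V2 = span(eta_2,...,eta_5). *)
Definition S1 : {set 'I_6} := [set i : 'I_6 | (i < 2)%N].

(** Lambda^{p,q} = Lambda^p V1 (x) Lambda^q V2, as subspace of forms. *)
Definition inLam (M : 'M[R]_6) (p q : nat) (a : form) : Prop :=
  exists c : {set 'I_6} -> R,
    a = fun xs => \sum_(I : {set 'I_6} |
                          (#|I :&: S1| == p) && (#|I :\: S1| == q))
                    c I * etaI M I xs.

(** F^k_p = (+)_{p' >= p} Lambda^{p', k - p'}. *)
Definition inF (M : 'M[R]_6) (k p : nat) (a : form) : Prop :=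
  exists c : {set 'I_6} -> R,
    a = fun xs => \sum_(I : {set 'I_6} | (#|I| == k) && (p <= #|I :&: S1|)%N)
                    c I * etaI M I xs.

(** Coherent: d(Lambda^{p,q}) is contained in
    Lambda^{p+1,q} + Lambda^{p+2,q-1}  (the latter being 0 when q = 0). *)
Definition coherent br (M : 'M[R]_6) : Prop :=
  M \in unitmx /\
  forall (p q : nat) (a : form), inLam M p q a ->
    exists b c : form,
      [/\ inLam M p.+1 q b, inLam M p.+2 q.-1 c, (q = 0%N -> c = fzero) &
          dCE br a = fadd b c].

(** H^{p,q} = H^{p+q}_p / H^{p+q}_{p+1} is nonzero (i.e. h^{p,q} <> 0):
    some closed form in F^{p+q}_p whose class does not lie in H^{p+q}_{p+1},
    i.e. it is not (closed form in F^{p+q}_{p+1}) + (exact form). *)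
Definition hpq_nonzero br (M : 'M[R]_6) (p q : nat) : Prop :=
  exists a : form,
    [/\ inF M (p + q) p a, dCE br a = fzero &
        ~ exists b c : form,
            [/\ inF M (p + q) p.+1 b, dCE br b = fzero,
                inF M (p + q).-1 0 c & a = fadd b (dCE br c)]].

(** Lie algebras given in the notation (0,0,12,13,...): for each k, the list
    of terms (i, j, c) of de^k = sum c e^{ij} (1-based indices, e^{ji} = -e^{ij}).
    With d a (X,Y) = - a([X,Y]), the bracket is
    e^k([X,Y]) = - de^k(X,Y) = - sum c (X_i Y_j - X_j Y_i). *)
Definition lie_data := seq (seq (nat * nat * int)).

Definition bracket_of (D : lie_data) (x y : vec) : vec :=
  \row_(k < 6) - \sum_(t <- nth [::] D k)
      (t.2)%:~R * (x ord0 (inord t.1.1.-1) * y ord0 (inord t.1.2.-1)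
                 - x ord0 (inord t.1.2.-1) * y ord0 (inord t.1.1.-1)).

End Defs.

Definition P (i j : nat) : nat * nat * int := (i, j, 1%Z).
Definition N (i j : nat) : nat * nat * int := (i, j, (-1)%Z).

Definition half_flat_list : seq lie_data := [::
  [:: [::]; [::]; [:: P 1 2]; [:: P 1 3]; [:: P 2 3]; [:: P 1 4]];
  [:: [::]; [::]; [:: P 1 2]; [:: P 1 3]; [:: P 2 3]; [:: P 1 4; P 2 5]];
  [:: [::]; [::]; [:: P 1 2]; [:: P 1 3]; [:: P 2 3]; [:: P 1 4; N 2 5]];
  [:: [::]; [::]; [:: P 1 2]; [:: P 1 3]; [:: P 1 4; P 2 3]; [:: P 2 4; P 1 5]];
  [:: [::]; [::]; [::]; [:: P 1 2]; [:: P 1 4]; [:: P 1 5; P 2 3]];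
  [:: [::]; [::]; [::]; [:: P 1 2]; [:: P 1 4; N 2 3]; [:: P 1 5; P 3 4]];
  [:: [::]; [::]; [::]; [:: P 1 2]; [:: P 1 4]; [:: P 1 5]];
  [:: [::]; [::]; [::]; [:: P 1 2]; [:: P 2 3]; [:: P 1 4; P 3 5]];
  [:: [::]; [::]; [::]; [:: P 1 2]; [:: P 2 3]; [:: P 1 4; N 3 5]];
  [:: [::]; [::]; [::]; [:: P 1 2]; [:: P 1 3]; [:: P 1 4; P 3 5]];
  [:: [::]; [::]; [::]; [:: P 1 2]; [:: P 1 3]; [:: P 1 4; P 2 3]];
  [:: [::]; [::]; [::]; [:: P 1 2]; [:: P 1 3]; [:: P 2 4]];
  [:: [::]; [::]; [::]; [:: P 1 2]; [:: P 1 3]; [:: P 2 3]];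
  [:: [::]; [::]; [::]; [:: P 1 2]; [:: P 1 4]; [:: P 1 5; P 2 4]];
  [:: [::]; [::]; [::]; [:: P 1 2]; [:: P 1 4]; [:: P 1 5; P 2 3; P 2 4]];
  [:: [::]; [::]; [::]; [::]; [:: P 1 2]; [:: P 1 4; P 2 5]];
  [:: [::]; [::]; [::]; [::]; [:: P 1 2]; [:: P 1 5; P 3 4]];
  [:: [::]; [::]; [::]; [::]; [:: P 1 3; P 4 2]; [:: P 1 4; P 2 3]];
  [:: [::]; [::]; [::]; [::]; [:: P 1 2]; [:: P 1 4; P 2 3]];
  [:: [::]; [::]; [::]; [::]; [:: P 1 2]; [:: P 1 3]];
  [:: [::]; [::]; [::]; [::]; [:: P 1 2]; [:: P 3 4]];
  [:: [::]; [::]; [::]; [::]; [::]; [:: P 1 2; P 3 4]];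
  [:: [::]; [::]; [::]; [::]; [::]; [:: P 1 2]];
  [:: [::]; [::]; [::]; [::]; [::]; [::]]
].

Definition non_half_flat_list : seq lie_data := [::
  [:: [::]; [::]; [:: P 1 2]; [:: P 1 3]; [:: P 1 4; P 2 3]; [:: P 3 4; P 5 2]];
  [:: [::]; [::]; [:: P 1 2]; [:: P 1 3]; [:: P 1 4]; [:: P 3 4; P 5 2]];
  [:: [::]; [::]; [:: P 1 2]; [:: P 1 3]; [:: P 1 4]; [:: P 1 5]];
  [:: [::]; [::]; [:: P 1 2]; [:: P 1 3]; [:: P 1 4]; [:: P 2 3; P 1 5]];
  [:: [::]; [::]; [::]; [:: P 1 2]; [:: P 1 4]; [:: P 2 4]];
  [:: [::]; [::]; [::]; [:: P 1 2]; [:: P 1 3; P 4 2]; [:: P 1 4; P 2 3]];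
  [:: [::]; [::]; [::]; [:: P 1 2]; [:: P 1 4]; [:: P 1 3; P 4 2]];
  [:: [::]; [::]; [::]; [:: P 1 2]; [:: P 1 3; P 1 4]; [:: P 2 4]];
  [:: [::]; [::]; [::]; [:: P 1 2]; [:: P 1 3]; [:: P 1 4]];
  [:: [::]; [::]; [::]; [::]; [:: P 1 2]; [:: P 1 5]]
].

(* Main.v *)
From HB Require Import structures.
From mathcomp Require Import all_boot all_order all_algebra fingroup perm ring lra zify.
From mathcomp Require Import boolp reals.
Require Import Defs.
Set Implicit Arguments. Unset Strict Implicit. Unset Printing Implicit Defensive.
Import Order.TTheory GRing.Theory Num.Theory.
Local Open Scope ring_scope.

(** In both directions the theorem is read off the classification of nilpotent Lie algebras of
    dimension six, obtained by central extensions from dimension one: a nilpotent algebra has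
    a central line, so it is an extension of a listed algebra of dimension one less by a closed
    2-form, and the 2-forms are brought to normal form up to automorphisms and exact forms.

    For a nilpotent algebra a splitting is coherent exactly when the annihilator W of V1 is
    an abelian ideal of dimension four containing [g, g], and h^{0,3} is nonzero exactly when
    some closed 3-form does not vanish on W. For a half-flat (omega, psi), d(omega^2) = 0 says
    that the sum of the brackets [v_1, v_2] + [v_3, v_4] + [v_5, v_6] over the dual frame
    vanishes. If psi vanishes on W, then the 2-form spanning Lambda^2 V1 is of type (1,1), so by
    the Pluecker relations its contraction with omega is not zero; hence V1^* can be lifted to
    commuting vectors, and a central element of W yields a closed 3-form not vanishing on W.

    The same contraction argument excludes half-flat structures on the eight algebras on
    which all closed 3-forms vanish on W. On the two remaining ones no splitting is coherent,
    and a half-flat structure is excluded because psi(., e_5, e_6) = 0 makes e_5 and e_6 span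
    a complex line, while the contraction condition forces e_4 into the same line. *)

(** * Brackets on coordinate spaces *)

Section Brackets.
Variable R : realType.

(** What shapes the proof is the amount of coordinate computation. Brackets are therefore given by
    lists of coefficients, and every change of coframe comes with its inverse, so that an
    isomorphism is a family of polynomial identities for [ring] and [field]. Square roots occur only
    where a real quadratic form or a pencil of 2-forms is brought to normal form; signs there
    separate, for instance, 14+25 from 14-25.

    Two steps that the overview only names have these reasons. The adjoint maps of a nilpotent
    algebra have trace zero, which makes d on 4-forms dual to the bracket; this is how d(omega^2) =
    0 becomes an equation between vectors. The contraction argument is a Hodge-Riemann sign: a real
    (1,1)-form alpha whose contraction with omega vanishes has alpha /\ alpha /\ omega of strict
    sign unless alpha = 0, whereas alpha /\ alpha = 0 for a decomposable form. *)

Definition bracket n := 'rV[R]_n -> 'rV[R]_n -> 'rV[R]_n.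

Definition lie n (br : bracket n) : Prop :=
  [/\ (forall (a : R) x y z, br (a *: x + y) z = a *: br x z + br y z),
      (forall (a : R) x y z, br z (a *: x + y) = a *: br z x + br z y),
      (forall x, br x x = 0) &
      (forall x y z, br x (br y z) + br y (br z x) + br z (br x y) = 0)].

Definition altbr n (br : bracket n) : Prop :=
  [/\ (forall (a : R) x y z, br (a *: x + y) z = a *: br x z + br y z),
      (forall (a : R) x y z, br z (a *: x + y) = a *: br z x + br z y) &
      (forall x, br x x = 0)].

Lemma lie_altbr n (br : bracket n) : lie br -> altbr br.
Proof. by case. Qed.

Coercion lie_altbr : lie >-> altbr.

Definition nilp n (br : bracket n) : Prop :=
  exists m : nat, forall (xs : seq 'rV[R]_n) (y : 'rV[R]_n),
    size xs = m -> foldr br y xs = 0.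

Definition iso n (br1 br2 : bracket n) : Prop :=
  exists A : 'M[R]_n, A \in unitmx /\
    forall x y, br2 (x *m A) (y *m A) = (br1 x y) *m A.

Definition conjbr n (br : bracket n) (V : 'M[R]_n) : bracket n :=
  fun x y => br (x *m V) (y *m V) *m invmx V.

Section BracketTheory.
Variables (n : nat) (br : bracket n).
Hypothesis Hbr : altbr br.

Lemma lieDl x y z : br (x + y) z = br x z + br y z.
Proof. by case: Hbr => h _ _; have := h 1 x y z; rewrite !scale1r. Qed.

Lemma lieDr x y z : br z (x + y) = br z x + br z y.
Proof. by case: Hbr => _ h _; have := h 1 x y z; rewrite !scale1r. Qed.

Lemma lie0l z : br 0 z = 0.
Proof. by apply/(addIr (br 0 z)); rewrite -lieDl addr0 add0r. Qed.

Lemma lie0r z : br z 0 = 0.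
Proof. by apply/(addIr (br z 0)); rewrite -lieDr addr0 add0r. Qed.

Lemma lieZl a x z : br (a *: x) z = a *: br x z.
Proof. by case: Hbr => h _ _; have := h a x 0 z; rewrite lie0l !addr0. Qed.

Lemma lieZr a x z : br z (a *: x) = a *: br z x.
Proof. by case: Hbr => _ h _; have := h a x 0 z; rewrite lie0r !addr0. Qed.

Lemma liexx x : br x x = 0.
Proof. by case: Hbr. Qed.

Lemma lieC x y : br x y = - br y x.
Proof.
apply/eqP; rewrite -addr_eq0; apply/eqP.
by have := liexx (x + y); rewrite lieDl !lieDr !liexx addr0 add0r.
Qed.

Lemma lie_suml I r (P : pred I) (F : I -> 'rV[R]_n) z :
  br (\sum_(i <- r | P i) F i) z = \sum_(i <- r | P i) br (F i) z.
Proof. by apply: (big_morph (br^~ z)) => [x y|]; rewrite ?lieDl ?lie0l. Qed.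

Lemma lie_sumr I r (P : pred I) (F : I -> 'rV[R]_n) z :
  br z (\sum_(i <- r | P i) F i) = \sum_(i <- r | P i) br z (F i).
Proof. by apply: (big_morph (br z)) => [x y|]; rewrite ?lieDr ?lie0r. Qed.

End BracketTheory.

Lemma iso_refl n (br : bracket n) : iso br br.
Proof. by exists 1%:M; rewrite unitmx1; split=> // x y; rewrite !mulmx1. Qed.

Lemma iso_sym n (br1 br2 : bracket n) : iso br1 br2 -> iso br2 br1.
Proof.
case=> A [Au h]; exists (invmx A); rewrite unitmx_inv; split=> // x y.
by have := h (x *m invmx A) (y *m invmx A); rewrite !mulmxKV // => ->; rewrite mulmxK.
Qed.

Lemma iso_trans n (br1 br2 br3 : bracket n) :
  iso br1 br2 -> iso br2 br3 -> iso br1 br3.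
Proof.
case=> A [Au hA] [B [Bu hB]]; exists (A *m B); rewrite unitmx_mul Au Bu.
by split=> // x y; rewrite !mulmxA hB hA.
Qed.

Lemma iso_conj n (br : bracket n) V : V \in unitmx -> iso br (conjbr br V).
Proof.
move=> Vu; exists (invmx V); rewrite unitmx_inv; split=> // x y.
by rewrite /conjbr !mulmxKV.
Qed.

Lemma iso_lie n (br1 br2 : bracket n) : iso br1 br2 -> lie br1 -> lie br2.
Proof.
move=> /iso_sym [A [Au h]] hl.
have inj x y : x *m A = y *m A -> x = y.
  by move/(congr1 (mulmxr (invmx A))); rewrite /= !mulmxK.
split=> [a x y z|a x y z|x|x y z]; apply: inj.
- by rewrite mulmxDl -scalemxAl -!h mulmxDl -scalemxAl (lieDl hl) (lieZl hl).
- by rewrite mulmxDl -scalemxAl -!h mulmxDl -scalemxAl (lieDr hl) (lieZr hl).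
- by rewrite -h (liexx hl) mul0mx.
- by rewrite !mulmxDl -!h mul0mx; case: hl.
Qed.

Lemma iso_nilp n (br1 br2 : bracket n) : iso br1 br2 -> nilp br1 -> nilp br2.
Proof.
move=> /iso_sym [A [Au h]] [m hm]; exists m => xs y hs.
have E : foldr br2 y xs *m A = foldr br1 (y *m A) [seq x *m A | x <- xs].
  by elim: xs {hs} => //= x xs IH; rewrite -h IH.
by rewrite -[LHS](mulmxK Au) E hm ?mul0mx // size_map.
Qed.

(* If every bracket of length m on top of y vanishes, the last nonzero one is central. *)
Lemma nilp_central n (br : bracket n) (y : 'rV[R]_n) : nilp br -> y != 0 ->
  exists xs, foldr br y xs != 0 /\ forall x, br x (foldr br y xs) = 0.
Proof.
case=> m; move=> hm0 y0; have {hm0}: forall xs, size xs = m -> foldr br y xs = 0.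
  by move=> xs; apply: hm0.
elim: m => [|m IH] hm; first by have := hm [::] erefl; move/eqP: y0.
have [h|] := pselect (forall xs, size xs = m -> foldr br y xs = 0); first exact: IH.
move/existsNP => [xs /not_implyP [hs /eqP hz]]; exists xs; split=> // x.
by apply: (hm (x :: xs)); rewrite /= hs.
Qed.

(** Indexed by all natural numbers, with value 0 out of range, so that formulas evaluate on numerals
    without bound proofs. *)
Definition crd n (x : 'rV[R]_n) (k : nat) : R :=
  if insub k is Some i then x ord0 i else 0.

Lemma crdE n (x : 'rV[R]_n) (i : 'I_n) : crd x i = x ord0 i.
Proof. by rewrite /crd valK. Qed.

Lemma crd_out n (x : 'rV[R]_n) k : (n <= k)%N -> crd x k = 0.
Proof. by move=> h; rewrite /crd insubF // ltnNge h. Qed.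

Lemma crd_row n (f : nat -> R) k : (k < n)%N -> crd (\row_(i < n) f i) k = f k.
Proof. by move=> h; rewrite /crd (insubT (fun k => k < n)%N h) mxE. Qed.

(* A term [(i, j, c)] of the k-th list stands for c e^{ij} in de^k, with 1-based indices. *)
Definition sdata := seq (seq (nat * nat * R)).

(** A fold rather than a big sum: on a concrete list it reduces to a polynomial that [ring] can
    treat. *)
Definition form2 (l : seq (nat * nat * R)) (u v : nat -> R) : R :=
  foldr (fun t s => t.2 * (u t.1.1.-1 * v t.1.2.-1 - u t.1.2.-1 * v t.1.1.-1) + s)
    0 l.

Definition brD n (D : sdata) : bracket n := fun x y =>
  \row_(k < n) - form2 (nth [::] D k) (crd x) (crd y).

(* A linear change of coframe: the k-th list [(c, i); ...] is the covector
   c e^i + ..., with 1-based indices. *)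
Definition coframe := seq (seq (R * nat)).

Definition lcomb (l : seq (R * nat)) (u : nat -> R) : R :=
  foldr (fun t s => t.1 * u t.2.-1 + s) 0 l.

Definition lin (C : coframe) (u : nat -> R) (k : nat) : R :=
  lcomb (nth [::] C k) u.

Lemma form2E l u v : form2 l u v =
  \sum_(t <- l) t.2 * (u t.1.1.-1 * v t.1.2.-1 - u t.1.2.-1 * v t.1.1.-1).
Proof. by elim: l => [|t l IH] /=; rewrite ?big_nil // big_cons IH. Qed.

Lemma lcombE l u : lcomb l u = \sum_(t <- l) t.1 * u t.2.-1.
Proof. by elim: l => [|t l IH] /=; rewrite ?big_nil // big_cons IH. Qed.

Lemma lcombN l u : lcomb l (fun k => - u k) = - lcomb l u.
Proof. by rewrite !lcombE -sumrN; apply: eq_bigr => t _; rewrite mulrN. Qed.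

Definition mx_of n (C : coframe) : 'M[R]_n :=
  \matrix_(i, k) \sum_(t <- nth [::] C k | t.2.-1 == i) t.1.

Lemma crd_mx_of n C (x : 'rV[R]_n) : size C = n ->
  crd (x *m mx_of n C) = lin C (crd x).
Proof.
move=> sC; apply/funext => k; case: (ltnP k n) => hk; last first.
  by rewrite crd_out // /lin nth_default // sC.
rewrite -[k]/(val (Ordinal hk)) crdE mxE /lin lcombE /=.
under eq_bigr => i _ do rewrite mxE big_mkcond mulr_sumr.
rewrite exchange_big; apply: eq_bigr => t _ /=.
case: (ltnP t.2.-1 n) => ht.
  rewrite (bigD1 (Ordinal ht)) //= eqxx big1 ?addr0; last first.
    by move=> i; rewrite -val_eqE /= eq_sym => /negPf ->; rewrite mulr0.
  by rewrite mulrC -[t.2.-1]/(val (Ordinal ht)) crdE.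
rewrite crd_out // mulr0 big1 // => i _.
by case: eqP => [e|]; rewrite ?mulr0 //; move: ht; rewrite e leqNgt ltn_ord.
Qed.

Lemma row_crd n (x y : 'rV[R]_n) :
  (forall k, (k < n)%N -> crd x k = crd y k) -> x = y.
Proof. by move=> h; apply/rowP => i; have := h i (ltn_ord i); rewrite !crdE. Qed.

Lemma crd_brD n D (x y : 'rV[R]_n) : (size D <= n)%N ->
  crd (brD D x y) = fun k => - form2 (nth [::] D k) (crd x) (crd y).
Proof.
move=> sD; apply/funext => k; case: (ltnP k n) => hk; last first.
  by rewrite crd_out // nth_default ?(leq_trans sD) // oppr0.
exact: (crd_row (fun k => - form2 (nth [::] D k) (crd x) (crd y))).
Qed.

(** The inverse coframe [Ci] is data, so that invertibility becomes a polynomial identity. The last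
    condition says that pullback along [C] commutes with the differentials. *)
Lemma iso_coframe n (D1 D2 : sdata) (C Ci : coframe) :
  [&& size C == n, size Ci == n, (size D1 <= n)%N & (size D2 <= n)%N] ->
  (forall u k, (k < n)%N -> lin Ci (lin C u) k = u k) ->
  (forall u v k, (k < n)%N -> form2 (nth [::] D2 k) (lin C u) (lin C v) =
     lin C (fun k => form2 (nth [::] D1 k) u v) k) ->
  iso (@brD n D1) (@brD n D2).
Proof.
case/and4P => /eqP sC /eqP sCi s1 s2 hinv hbr.
have AB : mx_of n C *m mx_of n Ci = 1%:M.
  have E (x : 'rV[R]_n) : x *m (mx_of n C *m mx_of n Ci) = x.
    by apply: row_crd => k hk; rewrite mulmxA !crd_mx_of // hinv.
  by apply/row_matrixP => i; rewrite rowE E rowE mulmx1.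
exists (mx_of n C); split; first by case/mulmx1_unit: AB.
move=> x y; apply: row_crd => k hk.
by rewrite crd_mx_of // !crd_brD // !crd_mx_of // hbr // /lin lcombN.
Qed.

End Brackets.

Arguments brD {R} n D.

(** * Central extensions *)

Section CentralExtensions.
Variable R : realType.

(** A rank-one perturbation of the identity: 1 + c r has i-th row z, and its inverse is 1 - c r /
    z_i because r c = z_i - 1. A transposition then moves row i to place k. *)
Lemma exists_unitmx_row n (z : 'rV[R]_n) (k : 'I_n) :
  z != 0 -> exists V : 'M[R]_n, V \in unitmx /\ row k V = z.
Proof.
move=> /rV0Pn [i zi].
pose c : 'cV[R]_n := delta_mx i 0; pose r := z - delta_mx 0 i.
have rc : r *m c = (z 0 i - 1)%:M.
  by rewrite -colE [LHS]mx11_scalar !mxE !eqxx.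
have Zu : (1%:M + c *m r) \in unitmx.
  have : (1%:M + c *m r) *m (1%:M + c *m (- (z 0 i)^-1 *: r)) = 1%:M.
    rewrite mulmxDl mul1mx mulmxDr mulmx1 -[c *m r *m _]mulmxA [r *m (c *m _)]mulmxA rc.
    rewrite mul_scalar_mx -addrA addrA -[RHS]addr0 -!addrA; congr (_ + _).
    rewrite -!mulmxDr scalerA -{2}[r]scale1r -!scalerDl.
    rewrite (_ : _ + _ = 0) ?scale0r ?mulmx0 //; by field.
  by case/mulmx1_unit.
exists (perm_mx (tperm i k) *m (1%:M + c *m r)).
rewrite unitmx_mul unitmx_perm Zu; split=> //.
rewrite -row_permE; apply/rowP => j; rewrite !mxE tpermR big_ord1 !mxE !eqxx.
by rewrite mul1r eq_sym addrC subrK.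
Qed.

Lemma row_unit_central n (br : bracket R n.+1) : lie br -> nilp br ->
  exists2 V : 'M[R]_n.+1, V \in unitmx &
    forall x, conjbr br V x (delta_mx 0 ord_max) = 0.
Proof.
move=> hl hn; have [] := @nilp_central R n.+1 br (delta_mx 0 0) hn.
  by apply/rV0Pn; exists 0; rewrite mxE !eqxx oner_neq0.
move=> xs [z0 hz].
have [V [Vu Vz]] := exists_unitmx_row ord_max z0.
exists V => // x; rewrite /conjbr -rowE Vz; set w := foldr _ _ _.
by rewrite hz mul0mx.
Qed.

Definition drop_last n : 'M[R]_(n.+1, n) := pid_mx n.
Definition zero_last n : 'M[R]_(n, n.+1) := pid_mx n.

Lemma zero_dropK n : zero_last n *m drop_last n = 1%:M.
Proof. by rewrite mul_pid_mx minnn (minn_idPr (leqnSn n)) pid_mx_1. Qed.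

Lemma drop_zeroE n (x : 'rV[R]_n.+1) :
  x *m drop_last n *m zero_last n = x - x 0 ord_max *: delta_mx 0 ord_max.
Proof.
rewrite -mulmxA mul_pid_mx !minnn; apply/rowP => j; rewrite !mxE.
rewrite (bigD1 j) //= big1 ?addr0; last first.
  by move=> i ij; rewrite mxE (inj_eq val_inj) (negPf ij) mulr0.
rewrite mxE eqxx /=; case: (ltnP j n) => hj.
  by rewrite -val_eqE /= (ltn_eqF hj) mulr1 mulr0 subr0.
have -> : j = ord_max by apply/val_inj/eqP; rewrite /= eqn_leq hj -ltnS ltn_ord.
by rewrite eqxx mulr1 mulr0 subrr.
Qed.

Section Quotient.
Variables (n : nat) (br : bracket R n.+1).
Hypotheses (hl : lie br) (hz : forall x, br x (delta_mx 0 ord_max) = 0).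

Definition quobr : bracket R n := fun x y =>
  br (x *m zero_last n) (y *m zero_last n) *m drop_last n.

Lemma br_drop x y : br x (y *m drop_last n *m zero_last n) = br x y.
Proof. by rewrite drop_zeroE -scaleNr (lieDr hl) (lieZr hl) hz scaler0 addr0. Qed.

Lemma br_dropl x y : br (x *m drop_last n *m zero_last n) y = br x y.
Proof. by rewrite (lieC hl) br_drop -(lieC hl). Qed.

Lemma quobr_drop x y : quobr (x *m drop_last n) (y *m drop_last n) = br x y *m drop_last n.
Proof. by rewrite /quobr br_drop br_dropl. Qed.

Lemma lie_quobr : lie quobr.
Proof.
split=> [a x y z|a x y z|x|x y z]; rewrite /quobr.
- by rewrite !mulmxDl -!scalemxAl (lieDl hl) (lieZl hl) mulmxDl -scalemxAl.
- by rewrite !mulmxDl -!scalemxAl (lieDr hl) (lieZr hl) mulmxDl -scalemxAl.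
- by rewrite (liexx hl) mul0mx.
- by rewrite !br_drop -!mulmxDl; case: hl => _ _ _ ->; rewrite mul0mx.
Qed.

Lemma nilp_quobr : nilp br -> nilp quobr.
Proof.
case=> m hm; exists m => xs y hs.
have -> : foldr quobr y xs =
    foldr br (y *m zero_last n) [seq x *m zero_last n | x <- xs] *m drop_last n.
  elim: xs {hs} => /= [|x xs ->]; first by rewrite -mulmxA zero_dropK mulmx1.
  by rewrite /quobr br_drop.
by rewrite hm ?mul0mx // size_map.
Qed.

End Quotient.

Definition castD (D : lie_data) : sdata R := [seq [seq (t.1, t.2%:~R) | t <- l] | l <- D].

Definition wf n (D : lie_data) : bool := (size D == n) &&
  all (all (fun t => (t.1.1.-1 < n)%N && (t.1.2.-1 < n)%N)) D.

(** The general 2-form in n coordinates. The coefficients [t] are indexed from 0, while the entries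
    are 1-based like all such data. *)
Definition allforms n (t : nat -> nat -> R) : seq (nat * nat * R) :=
  [seq (p.1.+1, p.2.+1, t p.1 p.2) |
    p <- [seq p <- [seq (i, j) | i <- iota 0 n, j <- iota 0 n] | (p.1 < p.2)%N]].

Lemma form2_allforms n t u v : form2 (allforms n t) u v =
  \sum_(i < n) \sum_(j < n | (i < j)%N) t i j * (u i * v j - u j * v i).
Proof.
rewrite form2E big_map big_filter big_mkcond big_allpairs_dep /=.
rewrite -[in LHS](subn0 n) -/(index_iota 0 n) big_mkord; apply: eq_bigr => i _.
by rewrite big_mkord -big_mkcond.
Qed.

Lemma lie_allforms n (br : bracket R n) (k : 'I_n) x y : lie br ->
  br x y 0 k = - form2 (allforms n (fun i j =>
     - crd (br (\row_l (i == l)%:R) (\row_l (j == l)%:R)) k)) (crd x) (crd y).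
Proof.
move=> hl; rewrite form2_allforms.
pose b (i j : 'I_n) := br (delta_mx 0 i) (delta_mx 0 j) 0 k.
have dE (i : 'I_n) : \row_l ((val i == l :> nat)%:R : R) = delta_mx 0 i.
  by apply/rowP => l; rewrite !mxE eqxx /= eq_sym.
have bC i j : b i j = - b j i by rewrite /b (lieC hl) mxE.
transitivity (\sum_(i < n) \sum_(j < n) x 0 i * y 0 j * b i j).
  rewrite {1}(row_sum_delta x) (lie_suml hl) summxE; apply: eq_bigr => i _.
  rewrite {1}(row_sum_delta y) (lie_sumr hl) summxE; apply: eq_bigr => j _.
  by rewrite (lieZl hl) (lieZr hl) !mxE mulrA.
have bb i : b i i = 0 by rewrite /b (liexx hl) mxE.
transitivity (\sum_(i < n) (\sum_(j < n | (i < j)%N) x 0 i * y 0 j * b i j +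
                           \sum_(j < n | (j < i)%N) x 0 i * y 0 j * b i j)).
  apply: eq_bigr => i _; rewrite (bigID (fun j : 'I_n => (i < j)%N)) /=.
  congr (_ + _); rewrite (bigD1 i) ?ltnn //= bb mulr0 add0r.
  by apply: eq_bigl => j; rewrite -leqNgt ltn_neqAle -val_eqE andbC.
rewrite big_split /= [X in _ + X](exchange_big_dep predT) //= -big_split -sumrN /=.
apply: eq_bigr => i _; rewrite -big_split -sumrN /=; apply: eq_bigr => j _.
by rewrite !dE !crdE -/(b i j) [b j i]bC; ring.
Qed.

Lemma crd_drop n (x : 'rV[R]_n.+1) k : (k < n)%N -> crd (x *m drop_last n) k = crd x k.
Proof.
move=> hk; rewrite -[k in LHS]/(val (Ordinal hk)) crdE mxE.
have hk' : (k < n.+1)%N by rewrite ltnS ltnW.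
rewrite (bigD1 (Ordinal hk')) //= big1 ?addr0; last first.
  by move=> i; rewrite -val_eqE mxE => /negPf /= ->; rewrite mulr0.
by rewrite mxE eqxx hk /= mulr1 -[k]/(val (Ordinal hk')) crdE.
Qed.

Lemma form2_wf (D : lie_data) n k (u v u' v' : nat -> R) : wf n D ->
  (forall i, (i < n)%N -> u i = u' i) -> (forall i, (i < n)%N -> v i = v' i) ->
  form2 (nth [::] (castD D) k) u v = form2 (nth [::] (castD D) k) u' v'.
Proof.
case/andP => sD /allP hD hu hv; case: (ltnP k (size D)) => hk; last first.
  by rewrite nth_default // size_map.
rewrite (nth_map [::]) // !form2E !big_map big_seq [RHS]big_seq.
apply: eq_bigr => t ht.
have /andP [h1 h2] := allP (hD _ (mem_nth [::] hk)) _ ht.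
by rewrite /= !hu // !hv.
Qed.

Lemma quobr_brD n (D : sdata R) l : size D = n ->
  quobr (brD n.+1 (rcons D l)) = brD n D.
Proof.
move=> sD; have crd_zero (x : 'rV[R]_n) : crd (x *m zero_last n) = crd x.
  apply/funext => k; case: (ltnP k n) => hk; last first.
    rewrite [RHS]crd_out //; case: (ltnP k n.+1) => hk'; last by rewrite crd_out.
    rewrite -[k]/(val (Ordinal hk')) crdE mxE big1 // => i _; rewrite mxE /=.
    by rewrite (ltn_eqF (leq_trans (ltn_ord i) hk)) mulr0.
  by rewrite -crd_drop // -mulmxA zero_dropK mulmx1.
apply/funext => x; apply/funext => y; apply: row_crd => k hk.
by rewrite crd_drop // !crd_brD ?size_rcons ?sD // nth_rcons sD hk !crd_zero.
Qed.

(** The isomorphism [A] of the quotient is extended by the identity on the central line. The last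
    coordinate of the bracket is then a 2-form in the first n coordinates, because the last vector
    is central. Its closedness is kept as the Lie property of the extended bracket, from which the
    later cases extract equations on [t]. *)
Lemma quotient_extension (n : nat) (b1 : bracket R n.+1) (D : lie_data) : lie b1 ->
  (forall x, b1 x (delta_mx 0 ord_max) = 0) -> wf n D ->
  iso (quobr b1) (brD n (castD D)) ->
  exists t, iso b1 (brD n.+1 (rcons (castD D) (allforms n t))) /\
            lie (brD n.+1 (rcons (castD D) (allforms n t))).
Proof.
move=> hl1 hz wD [A [Au hA]].
have sD : size (castD D) = n by rewrite size_map; case/andP: wD => /eqP.
pose e : 'rV[R]_n.+1 := delta_mx 0 ord_max.
pose p := drop_last n; pose q := zero_last n.
pose B := p *m A *m q + e^T *m e.
pose Bi := p *m invmx A *m q + e^T *m e.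
have qe : q *m e^T = 0.
  apply/colP => i; rewrite !mxE big1 // => j _; rewrite !mxE /= .
  case: (ltnP i n) (ltn_ord i) => // hi _; case: (j =P ord_max) => [->|]; rewrite ?mulr0 //.
  by rewrite /= (ltn_eqF hi) mul0r.
have ep : e *m p = 0.
  apply/rowP => i; rewrite !mxE big1 // => j _; rewrite !mxE /=.
  case: (j =P ord_max) => [->|]; rewrite ?mul0r //.
  by rewrite /= eq_sym (ltn_eqF (ltn_ord i)) mulr0.
have ee : e *m e^T = 1%:M.
  by rewrite trmx_delta mul_delta_mx [LHS]mx11_scalar !mxE !eqxx.
have qp : q *m p = 1%:M := zero_dropK n.
have pq : p *m q = 1%:M - e^T *m e.
  apply/row_matrixP => i; rewrite !rowE mulmxA drop_zeroE mulmxBr mulmx1; congr (_ - _).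
  rewrite trmx_delta mul_delta_mx_cond !mxE eqxx /= .
  by rewrite mul_delta_mx_cond; case: (ord_max =P i) => [<-|/eqP h];
     rewrite ?eqxx ?scale1r // ?(negPf h) 1?eq_sym ?(negPf h) ?scale0r ?mul0mx.
have BBi : B *m Bi = 1%:M.
  rewrite mulmxDl !mulmxDr !mulmxA -[_ *m q *m p]mulmxA qp mulmx1 -[_ *m A *m _]mulmxA.
  rewrite mulmxV // mulmx1 -[_ *m q *m e^T]mulmxA qe mulmx0 mul0mx addr0.
  rewrite -[_ *m e *m p]mulmxA ep mulmx0 !mul0mx add0r.
  by rewrite -[_ *m e *m e^T]mulmxA ee mulmx1 pq subrK.
have Bu : B \in unitmx by case/mulmx1_unit: BBi.
have Bp : B *m p = p *m A.
  by rewrite mulmxDl -[_ *m q *m p]mulmxA qp mulmx1 -[_ *m e *m p]mulmxA ep mulmx0 addr0.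
pose b2 := conjbr b1 (invmx B).
have i2 : iso b1 b2 by apply: iso_conj; rewrite unitmx_inv.
have hl2 := iso_lie i2 hl1.
have Bip : invmx B *m p *m A = p.
  by rewrite -mulmxA -Bp mulmxA mulVmx // mul1mx.
have eBi : e *m invmx B = e.
  rewrite -[LHS]mulmx1 -BBi mulmxA mulmxKV // mulmxDr !mulmxA ep !mul0mx add0r.
  by rewrite ee mul1mx.
have hz2 x : b2 x e = 0 by rewrite /b2 /conjbr eBi hz mul0mx.
pose t (i j : nat) : R := - crd (b2 (\row_l (i == l)%:R) (\row_l (j == l)%:R)) n.
exists t.
suff E : b2 = brD n.+1 (rcons (castD D) (allforms n t)).
  by rewrite -E.
apply/funext => x; apply/funext => y; apply/rowP => k; rewrite [RHS]mxE.
rewrite nth_rcons sD; case: (ltngtP k n) (ltn_ord k) => hk kn.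
- have X w : w *m invmx B *m p *m A = w *m p.
    by rewrite -[in RHS]Bip !mulmxA.
  have := hA (x *m invmx B *m p) (y *m invmx B *m p).
  rewrite (quobr_drop hl1 hz) !X => h.
  rewrite -crdE -crd_drop // /b2 /conjbr invmxK -[_ *m B *m _]mulmxA -/p Bp mulmxA -h.
  by rewrite crd_brD ?sD //; congr (- _); apply: (form2_wf _ wD) => i hi; rewrite crd_drop.
- by rewrite leqNgt ltnS hk in kn.
- have -> : k = ord_max by apply/val_inj.
  have E0 : forall x, b2 e x = 0 by move=> w; rewrite (lieC hl2) hz2 oppr0.
  rewrite (lie_allforms _ _ _ hl2) /=; congr (- _).
  rewrite !form2_allforms big_ord_recr /= [X in _ + X]big1 ?addr0; last first.
    by move=> j; rewrite ltnNge -ltnS ltn_ord.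
  apply: eq_bigr => i _; rewrite big_mkcond big_ord_recr -big_mkcond /= ltn_ord.
  rewrite [X in - crd (b2 _ X) n](_ : _ = e) ?hz2; last first.
    by apply/rowP => l; rewrite !mxE eqxx eq_sym.
  by rewrite -[X in crd 0 X]/(val (@ord_max n)) crdE mxE oppr0 mul0r addr0.
Qed.

Lemma central_extension (n : nat) (L : seq lie_data) : all (fun D => wf n D) L ->
  (forall h : bracket R n, lie h -> nilp h ->
     exists2 D, D \in L & iso h (brD n (castD D))) ->
  forall br : bracket R n.+1, lie br -> nilp br ->
    exists2 D, D \in L &
      exists t, iso br (brD n.+1 (rcons (castD D) (allforms n t))) /\
                lie (brD n.+1 (rcons (castD D) (allforms n t))).
Proof.
move=> /allP hwf hL br hl hn.
have [V Vu hz] := row_unit_central hl hn.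
have iV := iso_conj br Vu.
have hl1 := iso_lie iV hl; have hn1 := iso_nilp iV hn.
have [D DL hA] := hL _ (lie_quobr hl1 hz) (nilp_quobr hl1 hz hn1).
exists D => //; have [t [i1 l1]] := quotient_extension hl1 hz (hwf _ DL) hA.
by exists t; split=> //; apply: iso_trans iV i1.
Qed.

Lemma bracket_ofE (D : lie_data) : wf 6 D -> bracket_of (R:=R) D = brD 6 (castD D).
Proof.
case/andP => sD /allP hD; apply/funext => x; apply/funext => y; apply/rowP => k.
rewrite !mxE (nth_map [::]) ?(eqP sD) // form2E big_map big_seq [in RHS]big_seq.
congr (- _); apply: eq_bigr => t ht.
have hk : (k < size D)%N by rewrite (eqP sD).
have /andP [h1 h2] := allP (hD _ (mem_nth [::] hk)) _ ht.
by rewrite -!crdE /= !inordK.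
Qed.

End CentralExtensions.
Arguments castD {R} D.

(** * Nilpotent Lie algebras of dimension at most five *)


Ltac neq0 := repeat (apply/andP; split); repeat split;
  try assumption; try (rewrite ?mulf_neq0 ?invr_neq0 //; fail); done.
Ltac iso_cases := rewrite /lin /lcomb /form2 /castD;
  repeat first [by [] | case=> [_|]; [rewrite /=; first [ring | field; neq0] |]].
(** [C] expresses the coframe of the target through that of the source, [Ci] the converse. *)
Ltac iso_by C Ci := apply: (@iso_coframe _ _ _ _ C Ci);
  [by [] | move=> ?; iso_cases | move=> ? ?; iso_cases].

Section Classification.
Variable R : realType.
Local Notation E c i := (c%R, i%N) (only parsing).
Local Notation X i := (1%R : R, i%N) (only parsing).
Local Notation Y i := [:: (1%R : R, i%N)] (only parsing).
Local Notation T i j c := (i%N, j%N, c%R) (only parsing).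
Implicit Types (L : seq lie_data).

Definition listed n L (D : sdata R) : Prop :=
  exists2 D0, D0 \in L & iso (brD n D) (brD n (@castD R D0)).

Lemma listed_iso n L (D D' : sdata R) : iso (brD n D) (brD n D') -> listed n L D' -> listed n L D.
Proof. by move=> h [D0 h0 i0]; exists D0 => //; apply: iso_trans h i0. Qed.

Lemma listed_nth k n L D : (k < size L)%N ->
  iso (brD n D) (brD n (@castD R (nth [::] L k))) -> listed n L D.
Proof. by move=> hk h; exists (nth [::] L k) => //; apply: mem_nth. Qed.

Lemma row_nth n (s : seq R) : (size s <= n)%N -> crd (\row_(i < n) nth 0 s i) = nth 0 s.
Proof.
move=> hs; apply/funext => k; case: (ltnP k n) => hk; first exact: (crd_row (nth 0 s)).
by rewrite crd_out // nth_default // (leq_trans hs).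
Qed.

(** On basis vectors and in the last coordinate this is the closedness of the new differential. The
    vectors are finite lists so that the identity reduces to a linear equation in the unknown
    coefficients. *)
Lemma jacobi_crd n (D : sdata R) (u v w : seq R) k : (size D <= n)%N -> lie (brD n D) ->
  [&& size u <= n, size v <= n & size w <= n]%N ->
  let B a b l := - form2 (nth [::] D l) a b in
  let u := nth 0 u in let v := nth 0 v in let w := nth 0 w in
  B u (B v w) k + B v (B w u) k + B w (B u v) k = 0.
Proof.
move=> sD [_ _ _ h] /and3P [hu hv hw] B /=.
have := h (\row_(i < n) nth 0 u i) (\row_(i < n) nth 0 v i) (\row_(i < n) nth 0 w i).
move=> /(congr1 (fun x => crd x k)).
have cD (x y : 'rV[R]_n) : crd (x + y) k = crd x k + crd y k.
  by rewrite /crd; case: insub => [i|]; rewrite ?mxE ?addr0.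
rewrite !cD !crd_brD // !row_nth // /crd; case: insub => [i|]; rewrite ?mxE //.
Qed.

Definition nil1 : seq lie_data := [:: [:: [::]]].
Definition nil2 : seq lie_data := [:: [:: [::]; [::]]].
Definition nil3 : seq lie_data := [:: [:: [::]; [::]; [::]]; [:: [::]; [::]; [:: P 1 2]]].
Definition nil4 : seq lie_data := [::
  [:: [::]; [::]; [::]; [::]]; [:: [::]; [::]; [::]; [:: P 1 2]];
  [:: [::]; [::]; [:: P 1 2]; [:: P 1 3]]].
Definition nil5 : seq lie_data := [::
  [:: [::]; [::]; [::]; [::]; [::]];
  [:: [::]; [::]; [::]; [::]; [:: P 1 2]];
  [:: [::]; [::]; [::]; [::]; [:: P 1 2; P 3 4]];
  [:: [::]; [::]; [::]; [:: P 1 2]; [:: P 1 3]];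
  [:: [::]; [::]; [::]; [:: P 1 2]; [:: P 1 4]];
  [:: [::]; [::]; [::]; [:: P 1 2]; [:: P 1 4; P 2 3]];
  [:: [::]; [::]; [:: P 1 2]; [:: P 1 3]; [:: P 1 4]];
  [:: [::]; [::]; [:: P 1 2]; [:: P 1 3]; [:: P 1 4; P 2 3]];
  [:: [::]; [::]; [:: P 1 2]; [:: P 1 3]; [:: P 2 3]]].

Definition classified (n : nat) L := forall br : bracket R n, lie br -> nilp br ->
  exists2 D, D \in L & iso br (brD n (@castD R D)).

Lemma classified_step (n : nat) L L' : all (fun D => wf n D) L -> classified n L ->
  (forall (D : lie_data) t, D \in L -> lie (brD n.+1 (rcons (@castD R D) (allforms n t))) ->
     listed n.+1 L' (rcons (castD D) (allforms n t))) ->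
  classified n.+1 L'.
Proof.
move=> w cL h br hl hn; have [D DL [t [i1 l1]]] := central_extension w cL hl hn.
by have [D0 h0 i0] := h _ _ DL l1; exists D0 => //; apply: iso_trans i1 i0.
Qed.

Lemma classified1 : classified 1 nil1.
Proof.
move=> br hl _; exists [:: [::]] => //.
suff -> : br = brD 1 (castD [:: [::]]) by apply: iso_refl.
apply/funext => x; apply/funext => y; apply/rowP => k.
by rewrite (lie_allforms _ _ _ hl) mxE (ord1 k).
Qed.

Lemma classified2 : classified 2 nil2.
Proof.
apply: (classified_step _ classified1) => // D t; rewrite inE => /eqP -> _.
by apply: (@listed_nth 0) => //; apply: iso_refl.
Qed.

Lemma classified3 : classified 3 nil3.
Proof.
apply: (classified_step _ classified2) => // D t; rewrite inE => /eqP -> _.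
rewrite [rcons _ _](_ : _ = [:: [::]; [::]; [:: T 1 2 (t 0 1)]]) //.
move: (t 0 1) => a; have [->|a0] := eqVneq a 0.
  apply: (@listed_nth 0) => //.
  iso_by [:: Y 1; Y 2; Y 3] [:: Y 1; Y 2; Y 3].
apply: (@listed_nth 1) => //.
iso_by [:: Y 1; Y 2; [:: E a^-1 3]] [:: Y 1; Y 2; [:: E a 3]].
Qed.

(** A 2-form in three variables is decomposable, which settles the extensions of the abelian
    algebra. Over (0,0,12) the exact part in 12 is absorbed into e^4, and the rest is (b e^1 + c
    e^2) /\ e^3. *)
Lemma classified4 : classified 4 nil4.
Proof.
apply: (classified_step _ classified3) => // D t; rewrite !inE => /orP[] /eqP -> _.
  rewrite [rcons _ _](_ : _ = [:: [::]; [::]; [::];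
    [:: T 1 2 (t 0 1); T 1 3 (t 0 2); T 2 3 (t 1 2)]]) //.
  move: (t 0 1) (t 0 2) (t 1 2) => a b c.
  have [->|a0] := eqVneq a 0; last first.
    apply: (@listed_nth 1) => //.
    iso_by [:: [:: E a 1; E (-c) 3]; [:: X 2; E (b / a) 3]; Y 3; Y 4]
      [:: [:: E a^-1 1; E (c / a) 3]; [:: X 2; E (- (b / a)) 3]; Y 3; Y 4].
  have [->|b0] := eqVneq b 0; last first.
    apply: (@listed_nth 1) => //.
    iso_by [:: [:: E b 1; E c 2]; Y 3; Y 2; Y 4]
      [:: [:: E b^-1 1; E (- (c / b)) 3]; Y 3; Y 2; Y 4].
  have [->|c0] := eqVneq c 0; last first.
    apply: (@listed_nth 1) => //.
    iso_by [:: [:: E c 2]; Y 3; Y 1; Y 4] [:: Y 3; [:: E c^-1 1]; Y 2; Y 4].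
  apply: (@listed_nth 0) => //.
  iso_by [:: Y 1; Y 2; Y 3; Y 4] [:: Y 1; Y 2; Y 3; Y 4].
rewrite [rcons _ _](_ : _ = [:: [::]; [::]; [:: T 1 2 1];
  [:: T 1 2 (t 0 1); T 1 3 (t 0 2); T 2 3 (t 1 2)]]) //.
move: (t 0 1) (t 0 2) (t 1 2) => a b c.
have [->|b0] := eqVneq b 0; last first.
  apply: (@listed_nth 2) => //.
  iso_by [:: [:: E b 1; E c 2]; [:: E b^-1 2]; Y 3; [:: X 4; E (- a) 3]]
    [:: [:: E b^-1 1; E (- c) 2]; [:: E b 2]; Y 3; [:: X 4; E a 3]].
have [->|c0] := eqVneq c 0; last first.
  apply: (@listed_nth 2) => //.
  iso_by [:: [:: E c 2]; [:: E (- c^-1) 1]; Y 3; [:: X 4; E (- a) 3]]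
    [:: [:: E (- c) 2]; [:: E c^-1 1]; Y 3; [:: X 4; E a 3]].
apply: (@listed_nth 1) => //.
iso_by [:: Y 1; Y 2; [:: X 4; E (- a) 3]; Y 3] [:: Y 1; Y 2; Y 4; [:: X 3; E a 4]].
Qed.

(* Over R^4, the Pfaffian of the new differential decides between 12 and 12 + 34. *)
Lemma ext_R4_pivot (a b c d e f : R) : a != 0 ->
  iso (brD 5 [:: [::]; [::]; [::]; [::];
        [:: T 1 2 a; T 1 3 b; T 1 4 c; T 2 3 d; T 2 4 e; T 3 4 f]])
    (brD 5 [:: [::]; [::]; [::]; [::]; [:: T 1 2 1; T 3 4 ((a * f - b * e + c * d) / a)]]).
Proof.
move=> a0.
iso_by [:: [:: E a 1; E (- d) 3; E (- e) 4]; [:: X 2; E (b / a) 3; E (c / a) 4]; Y 3; Y 4; Y 5]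
  [:: [:: E a^-1 1; E (d / a) 3; E (e / a) 4]; [:: X 2; E (- (b / a)) 3; E (- (c / a)) 4]; Y 3;
    Y 4; Y 5].
Qed.

(** A permutation of the coordinates brings a nonzero coefficient to the first place and changes the
    Pfaffian at most by a sign. The implication is recorded for the degenerate member of a pencil in
    dimension six. *)
Lemma ext_R4 (a b c d e f : R) :
  exists m, [/\ iso (brD 5 [:: [::]; [::]; [::]; [::];
      [:: T 1 2 a; T 1 3 b; T 1 4 c; T 2 3 d; T 2 4 e; T 3 4 f]])
      (brD 5 [:: [::]; [::]; [::]; [::]; m]) &
    m = [::] \/ exists2 k, m = [:: T 1 2 1; T 3 4 k] &
                 (a * f - b * e + c * d = 0 -> k = 0)].
Proof.
pose ok (l : seq (nat * nat * R)) := exists m, [/\ iso (brD 5 [:: [::]; [::]; [::]; [::]; l])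
      (brD 5 [:: [::]; [::]; [::]; [::]; m]) &
    m = [::] \/ exists2 k, m = [:: T 1 2 1; T 3 4 k] &
                 (a * f - b * e + c * d = 0 -> k = 0)].
have pivot (a' b' c' d' e' f' : R) : a' != 0 ->
    (a' * f' - b' * e' + c' * d' = a * f - b * e + c * d) \/
    (a' * f' - b' * e' + c' * d' = - (a * f - b * e + c * d)) ->
    ok [:: T 1 2 a'; T 1 3 b'; T 1 4 c'; T 2 3 d'; T 2 4 e'; T 3 4 f'].
  move=> h hp; exists [:: T 1 2 1; T 3 4 ((a' * f' - b' * e' + c' * d') / a')].
  split; first exact: ext_R4_pivot.
  right; exists ((a' * f' - b' * e' + c' * d') / a') => // p0.
  by case: hp => ->; rewrite p0 ?oppr0 mul0r.
have trans l l' : iso (brD 5 [:: [::]; [::]; [::]; [::]; l])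
      (brD 5 [:: [::]; [::]; [::]; [::]; l']) -> ok l' -> ok l.
  by move=> h [m [h1 h2]]; exists m; split=> //; apply: iso_trans h h1.
rewrite -/(ok _).
have [a0|a0] := eqVneq a 0; last by apply: pivot; [exact: a0|left].
have [b0|b0] := eqVneq b 0; last first.
  apply: (trans _ [:: T 1 2 b; T 1 3 a; T 1 4 c; T 2 3 (- d); T 2 4 f; T 3 4 e]).
    iso_by [:: Y 1; Y 3; Y 2; Y 4; Y 5] [:: Y 1; Y 3; Y 2; Y 4; Y 5].
  by apply: pivot => //; right; ring.
have [c0|c0] := eqVneq c 0; last first.
  apply: (trans _ [:: T 1 2 c; T 1 3 b; T 1 4 a; T 2 3 (- f); T 2 4 (- e); T 3 4 (- d)]).
    iso_by [:: Y 1; Y 4; Y 3; Y 2; Y 5] [:: Y 1; Y 4; Y 3; Y 2; Y 5].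
  by apply: pivot => //; right; ring.
have [d0|d0] := eqVneq d 0; last first.
  apply: (trans _ [:: T 1 2 d; T 1 3 (- a); T 1 4 e; T 2 3 (- b); T 2 4 f; T 3 4 c]).
    iso_by [:: Y 2; Y 3; Y 1; Y 4; Y 5] [:: Y 3; Y 1; Y 2; Y 4; Y 5].
  by apply: pivot => //; left; ring.
have [e0|e0] := eqVneq e 0; last first.
  apply: (trans _ [:: T 1 2 e; T 1 3 d; T 1 4 (- a); T 2 3 (- f); T 2 4 (- c); T 3 4 (- b)]).
    iso_by [:: Y 2; Y 4; Y 3; Y 1; Y 5] [:: Y 4; Y 1; Y 3; Y 2; Y 5].
  by apply: pivot => //; left; ring.
have [f0|f0] := eqVneq f 0; last first.
  apply: (trans _ [:: T 1 2 f; T 1 3 (- b); T 1 4 (- d); T 2 3 (- c); T 2 4 (- e); T 3 4 a]).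
    iso_by [:: Y 3; Y 4; Y 1; Y 2; Y 5] [:: Y 3; Y 4; Y 1; Y 2; Y 5].
  by apply: pivot => //; left; ring.
exists [::]; split; last by left.
rewrite a0 b0 c0 d0 e0 f0.
iso_by [:: Y 1; Y 2; Y 3; Y 4; Y 5] [:: Y 1; Y 2; Y 3; Y 4; Y 5].
Qed.

Lemma ext5_R4 (a b c d e f : R) :
  listed 5 nil5 [:: [::]; [::]; [::]; [::];
      [:: T 1 2 a; T 1 3 b; T 1 4 c; T 2 3 d; T 2 4 e; T 3 4 f]].
Proof.
have [m [h]] := ext_R4 a b c d e f; case=> [m0|[k mk _]]; apply: (listed_iso h).
  by rewrite m0; apply: (@listed_nth 0) => //; apply: iso_refl.
rewrite mk; have [->|k0] := eqVneq k 0.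
  apply: (@listed_nth 1) => //.
  iso_by [:: Y 1; Y 2; Y 3; Y 4; Y 5] [:: Y 1; Y 2; Y 3; Y 4; Y 5].
apply: (@listed_nth 2) => //.
iso_by [:: Y 1; Y 2; [:: E k 3]; Y 4; Y 5] [:: Y 1; Y 2; [:: E k^-1 3]; Y 4; Y 5].
Qed.

(** As d(34) is not zero, [f] vanishes; [a] is absorbed into e^5. If 14 or 24 occurs, they combine
    to (c e^1 + e e^2) /\ e^4, and [c * d - b * e] decides whether a 23-term remains. *)
Lemma ext5_00012 (a b c d e f : R) :
  let D := [:: [::]; [::]; [::]; [:: T 1 2 1];
      [:: T 1 2 a; T 1 3 b; T 1 4 c; T 2 3 d; T 2 4 e; T 3 4 f]] in
  lie (brD 5 D) -> listed 5 nil5 D.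
Proof.
move=> D hl.
have f0 : f = 0.
  by have := @jacobi_crd 5 D [:: 1] [:: 0; 1] [:: 0; 0; 1] 4 erefl hl erefl;
     rewrite /form2 /=; lra.
rewrite /D f0 {D f0 hl}.
have [->|c0] := eqVneq c 0; last first.
  have [m0|m0] := eqVneq (c * d - b * e) 0.
    have -> : d = b * e / c by apply/(mulfI c0); rewrite mulrCA divff // mulr1; lra.
    apply: (@listed_nth 4) => //.
    iso_by [:: [:: E c 1; E e 2]; [:: E c^-1 2]; Y 3; [:: X 4; E (b / c) 3]; [:: X 5;
        E (- a) 4]]
      [:: [:: E c^-1 1; E (- e) 2]; [:: E c 2]; Y 3; [:: X 4; E (- (b / c)) 3]; [:: X 5; E a 4;
        E (- (a * b / c)) 3]].
  apply: (@listed_nth 5) => //.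
  iso_by [:: [:: E c 1; E e 2]; [:: E c^-1 2]; [:: E (c * d - b * e) 3]; [:: X 4; E (b / c) 3];
      [:: X 5; E (- a) 4]]
    [:: [:: E c^-1 1; E (- e) 2]; [:: E c 2]; [:: E (c * d - b * e)^-1 3]; [:: X 4;
      E (- (b / c) / (c * d - b * e)) 3]; [:: X 5; E a 4;
      E (- (a * b / c) / (c * d - b * e)) 3]].
have [->|e0] := eqVneq e 0; last first.
  have [->|b0] := eqVneq b 0.
    apply: (@listed_nth 4) => //.
    iso_by [:: [:: E e 2]; [:: E (- e^-1) 1]; Y 3; [:: X 4; E (d / e) 3]; [:: X 5; E (- a) 4]]
      [:: [:: E (- e) 2]; [:: E e^-1 1]; Y 3; [:: X 4; E (- (d / e)) 3]; [:: X 5; E a 4;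
        E (- (a * d / e)) 3]].
  apply: (@listed_nth 5) => //.
  iso_by [:: [:: E e 2]; [:: E (- e^-1) 1]; [:: E (- b * e) 3]; [:: X 4; E (d / e) 3]; [:: X 5;
      E (- a) 4]]
    [:: [:: E (- e) 2]; [:: E e^-1 1]; [:: E (- (b * e)^-1) 3]; [:: X 4; E (d / e / (b * e)) 3];
      [:: X 5; E a 4; E (a * d / e / (b * e)) 3]].
have [->|b0] := eqVneq b 0; last first.
  apply: (@listed_nth 3) => //.
  iso_by [:: [:: E b 1; E d 2]; [:: E b^-1 2]; Y 3; Y 4; [:: X 5; E (- a) 4]]
    [:: [:: E b^-1 1; E (- d) 2]; [:: E b 2]; Y 3; Y 4; [:: X 5; E a 4]].
have [->|d0] := eqVneq d 0; last first.
  apply: (@listed_nth 3) => //.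
  iso_by [:: [:: E d 2]; [:: E (- d^-1) 1]; Y 3; Y 4; [:: X 5; E (- a) 4]]
    [:: [:: E (- d) 2]; [:: E d^-1 1]; Y 3; Y 4; [:: X 5; E a 4]].
apply: (@listed_nth 1) => //.
iso_by [:: Y 1; Y 2; Y 3; [:: X 5; E (- a) 4]; Y 4] [:: Y 1; Y 2; Y 3; Y 5; [:: X 4; E a 5]].
Qed.

(** Modulo the exact forms 12 and 13, the closed 2-forms are spanned by 14 and 23. *)
Lemma ext5_001213 (a b c d e f : R) :
  let D := [:: [::]; [::]; [:: T 1 2 1]; [:: T 1 3 1];
      [:: T 1 2 a; T 1 3 b; T 1 4 c; T 2 3 d; T 2 4 e; T 3 4 f]] in
  lie (brD 5 D) -> listed 5 nil5 D.
Proof.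
move=> D hl.
have e0 : e = 0.
  by have := @jacobi_crd 5 D [:: 1] [:: 0; 1] [:: 0; 0; 1] 4 erefl hl erefl;
     rewrite /form2 /=; lra.
have f0 : f = 0.
  by have := @jacobi_crd 5 D [:: 1] [:: 0; 1] [:: 0; 0; 0; 1] 4 erefl hl erefl;
     rewrite /form2 /=; lra.
rewrite /D e0 f0 {D e0 f0 hl}.
have [->|c0] := eqVneq c 0; last first.
  have [->|d0] := eqVneq d 0.
    apply: (@listed_nth 6) => //.
    iso_by [:: Y 1; Y 2; Y 3; Y 4; [:: E c^-1 5; E (- (a / c)) 3; E (- (b / c)) 4]]
      [:: Y 1; Y 2; Y 3; Y 4; [:: E c 5; E a 3; E b 4]].
  apply: (@listed_nth 7) => //.
  iso_by [:: Y 1; [:: E (d / c) 2]; [:: E (d / c) 3]; [:: E (d / c) 4]; [:: E (d / c / c) 5;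
      E (- (a * d / c / c)) 3; E (- (b * d / c / c)) 4]]
    [:: Y 1; [:: E (c / d) 2]; [:: E (c / d) 3]; [:: E (c / d) 4]; [:: E (c * c / d) 5;
      E (a * c / d) 3; E (b * c / d) 4]].
have [->|d0] := eqVneq d 0; last first.
  apply: (@listed_nth 8) => //.
  iso_by [:: Y 1; Y 2; Y 3; Y 4; [:: E d^-1 5; E (- (a / d)) 3; E (- (b / d)) 4]]
    [:: Y 1; Y 2; Y 3; Y 4; [:: E d 5; E a 3; E b 4]].
apply: (@listed_nth 4) => //.
iso_by [:: Y 1; Y 2; [:: X 5; E (- a) 3; E (- b) 4]; Y 3; Y 4]
  [:: Y 1; Y 2; Y 4; Y 5; [:: X 3; E a 4; E b 5]].
Qed.

Lemma classified5 : classified 5 nil5.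
Proof.
apply: (classified_step _ classified4) => // D t.
have E4 : allforms 4 t = [:: T 1 2 (t 0 1); T 1 3 (t 0 2); T 1 4 (t 0 3);
    T 2 3 (t 1 2); T 2 4 (t 1 3); T 3 4 (t 2 3)] by [].
rewrite E4 !inE => /or3P[] /eqP -> hl.
- exact: ext5_R4.
- exact: ext5_00012.
- exact: ext5_001213.
Qed.

End Classification.

(** * Nilpotent Lie algebras of dimension six *)

Section Classification6.
Variable R : realType.
Local Notation E c i := (c%R, i%N) (only parsing).
Local Notation X i := (1%R : R, i%N) (only parsing).
Local Notation Y i := [:: (1%R : R, i%N)] (only parsing).
Local Notation T i j c := (i%N, j%N, c%R) (only parsing).

Definition nil6 : seq lie_data := half_flat_list ++ non_half_flat_list.

Definition unit_seq (i : nat) : seq R := rcons (nseq i.-1 0) 1.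

Ltac jacobi hl i j k := lazymatch type of hl with lie (brD _ ?D) =>
  let J := fresh "J" in have J := @jacobi_crd _ 6 D (unit_seq i) (unit_seq j) (unit_seq k)
    5 erefl hl erefl;
  rewrite /form2 /= in J end.
Ltac subst_coef hl t c := let e := fresh "e" in
  have e : t = c; [by lra | move: hl; rewrite {}e => hl].

(** Splitting off one hyperbolic pair leaves a 2-form in the three variables 3, 4, 5, which is zero
    or decomposable; so only the ranks two and four occur. *)
Lemma ext6_R5_pivot (t12 t13 t14 t15 t23 t24 t25 t34 t35 t45 : R) : t12 != 0 ->
  listed 6 nil6 [:: [::]; [::]; [::]; [::]; [::];
    [:: T 1 2 t12; T 1 3 t13; T 1 4 t14; T 1 5 t15; T 2 3 t23; T 2 4 t24; T 2 5 t25;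
    T 3 4 t34; T 3 5 t35; T 4 5 t45]].
Proof.
move=> h.
pose p := t34 - t13 * t24 / t12 + t14 * t23 / t12.
pose q := t35 - t13 * t25 / t12 + t15 * t23 / t12.
pose r := t45 - t14 * t25 / t12 + t15 * t24 / t12.
apply: (@listed_iso _ _ _ _ [:: [::]; [::]; [::]; [::]; [::];
    [:: T 1 2 1; T 3 4 p; T 3 5 q; T 4 5 r]]).
  rewrite /p /q /r.
  iso_by [:: [:: E t12 1; E (-t23) 3; E (-t24) 4; E (-t25) 5]; [:: X 2; E (t13/t12) 3;
      E (t14/t12) 4; E (t15/t12) 5]; Y 3; Y 4; Y 5; Y 6]
    [:: [:: E (t12^-1) 1; E (t23/t12) 3; E (t24/t12) 4; E (t25/t12) 5]; [:: X 2;
      E (-(t13/t12)) 3; E (-(t14/t12)) 4; E (-(t15/t12)) 5]; Y 3; Y 4; Y 5; [:: X 6]].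
move: p q r => p q r {h}.
have [->|p0] := eqVneq p 0; last first.
  apply: (@listed_nth _ 21) => //.
  iso_by [:: Y 1; Y 2; [:: E p 3; E (-r) 5]; [:: X 4; E (q/p) 5]; Y 5; Y 6]
    [:: Y 1; Y 2; [:: E (p^-1) 3; E (r/p) 5]; [:: X 4; E (-(q/p)) 5]; Y 5; [:: X 6]].
have [->|q0] := eqVneq q 0; last first.
  apply: (@listed_nth _ 21) => //.
  iso_by [:: Y 1; Y 2; [:: E q 3; E r 4]; Y 5; Y 4; Y 6]
    [:: Y 1; Y 2; [:: E (q^-1) 3; E (-(r/q)) 5]; Y 5; Y 4; Y 6].
have [->|r0] := eqVneq r 0; last first.
  apply: (@listed_nth _ 21) => //.
  iso_by [:: Y 1; Y 2; [:: E r 4]; Y 5; Y 3; Y 6] [:: Y 1; Y 2; Y 5; [:: E (r^-1) 3]; Y 4; Y 6].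
apply: (@listed_nth _ 22) => //.
iso_by [:: Y 1; Y 2; Y 3; Y 4; Y 5; Y 6] [:: Y 1; Y 2; Y 3; Y 4; Y 5; Y 6].
Qed.

Lemma ext6_R5 (t12 t13 t14 t15 t23 t24 t25 t34 t35 t45 : R) :
  listed 6 nil6 [:: [::]; [::]; [::]; [::]; [::];
    [:: T 1 2 t12; T 1 3 t13; T 1 4 t14; T 1 5 t15; T 2 3 t23; T 2 4 t24; T 2 5 t25;
    T 3 4 t34; T 3 5 t35; T 4 5 t45]].
Proof.
have [->|t120] := eqVneq t12 0; last by apply: ext6_R5_pivot.
have [->|t130] := eqVneq t13 0; last first.
  apply: (@listed_iso _ _ _ _ [:: [::]; [::]; [::]; [::]; [::];
    [:: T 1 2 t13; T 1 3 0; T 1 4 t14; T 1 5 t15; T 2 3 (- t23); T 2 4 t34; T 2 5 t35;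
    T 3 4 t24; T 3 5 t25; T 4 5 t45]]);
    last by apply: ext6_R5_pivot.
  iso_by [:: Y 1; Y 3; Y 2; Y 4; Y 5; Y 6] [:: Y 1; Y 3; Y 2; Y 4; Y 5; Y 6].
have [->|t140] := eqVneq t14 0; last first.
  apply: (@listed_iso _ _ _ _ [:: [::]; [::]; [::]; [::]; [::];
    [:: T 1 2 t14; T 1 3 0; T 1 4 0; T 1 5 t15; T 2 3 (- t24); T 2 4 (- t34); T 2 5 t45;
    T 3 4 t23; T 3 5 t25; T 4 5 t35]]);
    last by apply: ext6_R5_pivot.
  iso_by [:: Y 1; Y 4; Y 2; Y 3; Y 5; Y 6] [:: Y 1; Y 3; Y 4; Y 2; Y 5; Y 6].
have [->|t150] := eqVneq t15 0; last first.
  apply: (@listed_iso _ _ _ _ [:: [::]; [::]; [::]; [::]; [::];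
    [:: T 1 2 t15; T 1 3 0; T 1 4 0; T 1 5 0; T 2 3 (- t25); T 2 4 (- t35); T 2 5 (- t45);
    T 3 4 t23; T 3 5 t24; T 4 5 t34]]);
    last by apply: ext6_R5_pivot.
  iso_by [:: Y 1; Y 5; Y 2; Y 3; Y 4; Y 6] [:: Y 1; Y 3; Y 4; Y 5; Y 2; Y 6].
have [->|t230] := eqVneq t23 0; last first.
  apply: (@listed_iso _ _ _ _ [:: [::]; [::]; [::]; [::]; [::];
    [:: T 1 2 t23; T 1 3 0; T 1 4 t24; T 1 5 t25; T 2 3 0; T 2 4 t34; T 2 5 t35; T 3 4 0;
    T 3 5 0; T 4 5 t45]]);
    last by apply: ext6_R5_pivot.
  iso_by [:: Y 2; Y 3; Y 1; Y 4; Y 5; Y 6] [:: Y 3; Y 1; Y 2; Y 4; Y 5; Y 6].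
have [->|t240] := eqVneq t24 0; last first.
  apply: (@listed_iso _ _ _ _ [:: [::]; [::]; [::]; [::]; [::];
    [:: T 1 2 t24; T 1 3 0; T 1 4 0; T 1 5 t25; T 2 3 0; T 2 4 (- t34); T 2 5 t45; T 3 4 0;
    T 3 5 0; T 4 5 t35]]);
    last by apply: ext6_R5_pivot.
  iso_by [:: Y 2; Y 4; Y 1; Y 3; Y 5; Y 6] [:: Y 3; Y 1; Y 4; Y 2; Y 5; Y 6].
have [->|t250] := eqVneq t25 0; last first.
  apply: (@listed_iso _ _ _ _ [:: [::]; [::]; [::]; [::]; [::];
    [:: T 1 2 t25; T 1 3 0; T 1 4 0; T 1 5 0; T 2 3 0; T 2 4 (- t35); T 2 5 (- t45); T 3 4 0;
    T 3 5 0; T 4 5 t34]]);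
    last by apply: ext6_R5_pivot.
  iso_by [:: Y 2; Y 5; Y 1; Y 3; Y 4; Y 6] [:: Y 3; Y 1; Y 4; Y 5; Y 2; Y 6].
have [->|t340] := eqVneq t34 0; last first.
  apply: (@listed_iso _ _ _ _ [:: [::]; [::]; [::]; [::]; [::];
    [:: T 1 2 t34; T 1 3 0; T 1 4 0; T 1 5 t35; T 2 3 0; T 2 4 0; T 2 5 t45; T 3 4 0; T 3 5 0;
    T 4 5 0]]);
    last by apply: ext6_R5_pivot.
  iso_by [:: Y 3; Y 4; Y 1; Y 2; Y 5; Y 6] [:: Y 3; Y 4; Y 1; Y 2; Y 5; Y 6].
have [->|t350] := eqVneq t35 0; last first.
  apply: (@listed_iso _ _ _ _ [:: [::]; [::]; [::]; [::]; [::];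
    [:: T 1 2 t35; T 1 3 0; T 1 4 0; T 1 5 0; T 2 3 0; T 2 4 0; T 2 5 (- t45); T 3 4 0;
    T 3 5 0; T 4 5 0]]);
    last by apply: ext6_R5_pivot.
  iso_by [:: Y 3; Y 5; Y 1; Y 2; Y 4; Y 6] [:: Y 3; Y 4; Y 1; Y 5; Y 2; Y 6].
have [->|t450] := eqVneq t45 0; last first.
  apply: (@listed_iso _ _ _ _ [:: [::]; [::]; [::]; [::]; [::];
    [:: T 1 2 t45; T 1 3 0; T 1 4 0; T 1 5 0; T 2 3 0; T 2 4 0; T 2 5 0; T 3 4 0; T 3 5 0;
    T 4 5 0]]);
    last by apply: ext6_R5_pivot.
  iso_by [:: Y 4; Y 5; Y 1; Y 2; Y 3; Y 6] [:: Y 3; Y 4; Y 5; Y 1; Y 2; Y 6].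
apply: (@listed_nth _ 23) => //.
iso_by [:: Y 1; Y 2; Y 3; Y 4; Y 5; Y 6] [:: Y 1; Y 2; Y 3; Y 4; Y 5; Y 6].
Qed.

Lemma ext6_000012_reduced (r s m : R) :
  listed 6 nil6 [:: [::]; [::]; [::]; [::]; [:: T 1 2 1]; [:: T 1 5 1; T 2 3 r; T 2 4 s;
    T 3 4 m]].
Proof.
have [->|m0] := eqVneq m 0; last first.
  apply: (@listed_nth _ 16) => //.
  iso_by [:: Y 1; Y 2; [:: E m 3; E s 2]; [:: X 4; E (-(r/m)) 2]; Y 5; Y 6]
    [:: Y 1; Y 2; [:: E (m^-1) 3; E (-(s/m)) 2]; [:: X 4; E (r/m) 2]; Y 5; [:: X 6]].
have [->|r0] := eqVneq r 0; last first.
  apply: (@listed_nth _ 15) => //.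
  iso_by [:: Y 2; Y 1; Y 4; [:: E (-r) 3; E (-s) 4]; [:: E (-1) 5]; [:: E (-1) 6]]
    [:: Y 2; Y 1; [:: E (-r^-1) 4; E (-(s/r)) 3]; Y 3; [:: E (-1) 5]; [:: E (-1) 6]].
have [->|s0] := eqVneq s 0; last first.
  apply: (@listed_nth _ 15) => //.
  iso_by [:: Y 2; Y 1; Y 3; [:: E (-s) 4]; [:: E (-1) 5]; [:: E (-1) 6]]
    [:: Y 2; Y 1; Y 3; [:: E (-s^-1) 4]; [:: E (-1) 5]; [:: E (-1) 6]].
apply: (@listed_nth _ 33) => //.
iso_by [:: Y 1; Y 2; Y 3; Y 4; Y 5; Y 6] [:: Y 1; Y 2; Y 3; Y 4; Y 5; Y 6].
Qed.

(** If 15 or 25 occurs, the reduced form is reached. Otherwise everything lives on R^4 modulo 12: a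
    nonzero [t34] splits off a second plane, and for [t34] zero the rank of the 2 x 2 matrix with
    rows (t13, t14) and (t23, t24) decides. *)
Lemma ext6_000012 (t12 t13 t14 t15 t23 t24 t25 t34 t35 t45 : R) :
  let D := [:: [::]; [::]; [::]; [::]; [:: T 1 2 1];
    [:: T 1 2 t12; T 1 3 t13; T 1 4 t14; T 1 5 t15; T 2 3 t23; T 2 4 t24; T 2 5 t25;
    T 3 4 t34; T 3 5 t35; T 4 5 t45]] in
  lie (brD 6 D) -> listed 6 nil6 D.
Proof.
move=> D hl; jacobi hl 1%N 2%N 3%N. jacobi hl 1%N 2%N 4%N.
rewrite /D in hl *; clear D.
subst_coef hl t35 (0 : R).
subst_coef hl t45 (0 : R).
clear hl J J0.
have [->|t150] := eqVneq t15 0; last first.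
  apply: (@listed_iso _ _ _ _ [:: [::]; [::]; [::]; [::]; [:: T 1 2 1]; [:: T 1 5 1;
    T 2 3 (t15 * t23 - t25 * t13); T 2 4 (t15 * t24 - t25 * t14); T 3 4 t34]]).
    iso_by [:: [:: E t15 1; E t25 2]; [:: E (t15^-1) 2]; Y 3; Y 4; [:: X 5; E (t13/t15) 3;
        E (t14/t15) 4]; [:: X 6; E (-t12) 5]]
      [:: [:: E (t15^-1) 1; E (-t25) 2]; [:: E t15 2]; Y 3; Y 4; [:: X 5; E (-(t13/t15)) 3;
        E (-(t14/t15)) 4]; [:: X 6; E t12 5; E (-(t12*t13/t15)) 3; E (-(t12*t14/t15)) 4]].
  exact: ext6_000012_reduced.
have [->|t250] := eqVneq t25 0; last first.
  apply: (@listed_iso _ _ _ _ [:: [::]; [::]; [::]; [::]; [:: T 1 2 1]; [:: T 1 5 1;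
    T 2 3 (- t25 * t13); T 2 4 (- t25 * t14); T 3 4 t34]]).
    iso_by [:: [:: E t25 2]; [:: E (-t25^-1) 1]; Y 3; Y 4; [:: X 5; E (t23/t25) 3;
        E (t24/t25) 4]; [:: X 6; E (-t12) 5]]
      [:: [:: E (-t25) 2]; [:: E (t25^-1) 1]; Y 3; Y 4; [:: X 5; E (-(t23/t25)) 3;
        E (-(t24/t25)) 4]; [:: X 6; E t12 5; E (-(t12*t23/t25)) 3; E (-(t12*t24/t25)) 4]].
  exact: ext6_000012_reduced.
have [->|t340] := eqVneq t34 0; last first.
  apply: (@listed_nth _ 20) => //.
  iso_by [:: Y 1; Y 2; [:: E t34 3; E t14 1; E t24 2]; [:: X 4; E (-(t13/t34)) 1;
      E (-(t23/t34)) 2]; Y 5; [:: X 6; E (-t12+(t24*t13-t14*t23)/t34) 5]]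
    [:: Y 1; Y 2; [:: E (t34^-1) 3; E (-(t14/t34)) 1; E (-(t24/t34)) 2]; [:: X 4; E (t13/t34) 1;
      E (t23/t34) 2]; Y 5; [:: X 6; E (t12-(t24*t13-t14*t23)/t34) 5]].
have [d0|d0] := eqVneq (t13 * t24 - t14 * t23) 0; last first.
  apply: (@listed_nth _ 18) => //.
  iso_by [:: Y 1; Y 2; [:: E t23 3; E t24 4]; [:: E t13 3; E t14 4]; Y 5; [:: X 6; E (-t12) 5]]
    [:: Y 1; Y 2; [:: E (t24/(t13*t24-t14*t23)) 4; E (-(t14/(t13*t24-t14*t23))) 3];
      [:: E (t13/(t13*t24-t14*t23)) 3; E (-(t23/(t13*t24-t14*t23))) 4]; Y 5; [:: X 6;
      E t12 5]].
have [t13z|t130] := eqVneq t13 0; last first.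
  have -> : t24 = t14 * t23 / t13 by apply/(mulfI t130); rewrite mulrCA divff // mulr1; lra.
  apply: (@listed_nth _ 19) => //.
  iso_by [:: [:: X 1; E (t23/t13) 2]; Y 2; [:: E t13 3; E t14 4]; Y 4; Y 5; [:: X 6;
      E (-t12) 5]]
    [:: [:: X 1; E (-(t23/t13)) 2]; Y 2; [:: E (t13^-1) 3; E (-(t14/t13)) 4]; Y 4; Y 5; [:: X 6;
      E t12 5]].
rewrite t13z in d0 *.
have [->|t140] := eqVneq t14 0; last first.
  have -> : t23 = 0 by apply/(mulfI t140); lra.
  apply: (@listed_nth _ 19) => //.
  iso_by [:: [:: X 1; E (t24/t14) 2]; Y 2; [:: E t14 4]; Y 3; Y 5; [:: X 6; E (-t12) 5]]
    [:: [:: X 1; E (-(t24/t14)) 2]; Y 2; Y 4; [:: E (t14^-1) 3]; Y 5; [:: X 6; E t12 5]].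
have [->|t230] := eqVneq t23 0; last first.
  apply: (@listed_nth _ 19) => //.
  iso_by [:: Y 2; [:: E (-1) 1]; [:: E t23 3; E t24 4]; Y 4; Y 5; [:: X 6; E (-t12) 5]]
    [:: [:: E (-1) 2]; Y 1; [:: E (t23^-1) 3; E (-(t24/t23)) 4]; Y 4; Y 5; [:: X 6; E t12 5]].
have [->|t240] := eqVneq t24 0; last first.
  apply: (@listed_nth _ 19) => //.
  iso_by [:: Y 2; [:: E (-1) 1]; [:: E t24 4]; Y 3; Y 5; [:: X 6; E (-t12) 5]]
    [:: [:: E (-1) 2]; Y 1; Y 4; [:: E (t24^-1) 3]; Y 5; [:: X 6; E t12 5]].
apply: (@listed_nth _ 22) => //.
iso_by [:: Y 1; Y 2; Y 3; Y 4; [:: X 6; E (-t12) 5]; Y 5]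
  [:: Y 1; Y 2; Y 3; Y 4; Y 6; [:: X 5; E t12 6]].
Qed.

(* The pencil spanned by the two differentials contains no decomposable real form, so it
   is spanned by the real and imaginary parts of a decomposable complex one. *)
Lemma ext6_elliptic_pivot (k p q r v : R) : p != 0 -> v != 0 ->
  listed 6 nil6 [:: [::]; [::]; [::]; [::]; [:: T 1 2 1; T 3 4 1]; [:: T 1 2 k; T 1 3 p;
    T 1 4 q; T 2 3 r; T 2 4 ((q * r - v ^+ 2 - k ^+ 2 / 4) / p)]].
Proof.
move=> p0 v0.
apply: (@listed_nth _ 17) => //.
iso_by [:: [:: X 1; E (r/p) 2; E (k/2/p) 4]; [:: E (-(v/p)) 4]; [:: E p 3; E (k/2) 2; E q 4];
    [:: E v 2]; [:: X 6; E (-(k/2)) 5]; [:: E v 5]]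
  [:: [:: X 1; E (-(r/p/v)) 4; E (k/2/v) 2]; [:: E (v^-1) 4]; [:: E (p^-1) 3; E (-(k/2/v/p)) 4;
    E (q/v) 2]; [:: E (-(p/v)) 2]; [:: E (v^-1) 6]; [:: X 5; E (k/2/v) 6]].
Qed.

(** The hypothesis says that the Pfaffian x^2 + kx + (qr - ps) of d e^6 + x d e^5 has no real root;
    [v] is the imaginary part of its complex roots. *)
Lemma ext6_elliptic (k p q r s : R) : k ^+ 2 < 4 * (q * r - p * s) ->
  listed 6 nil6 [:: [::]; [::]; [::]; [::]; [:: T 1 2 1; T 3 4 1]; [:: T 1 2 k; T 1 3 p;
    T 1 4 q; T 2 3 r; T 2 4 s]].
Proof.
move=> h; pose v := Num.sqrt (q * r - p * s - k ^+ 2 / 4).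
have hv : v ^+ 2 = q * r - p * s - k ^+ 2 / 4 by rewrite sqr_sqrtr //; lra.
have v0 : v != 0 by rewrite -sqrf_eq0 hv; apply/eqP; lra.
have [p0|p0] := eqVneq p 0; last first.
  have -> : s = (q * r - v ^+ 2 - k ^+ 2 / 4) / p by rewrite hv; field.
  exact: ext6_elliptic_pivot.
have q0 : q != 0.
  apply/eqP => q0; move: h; rewrite p0 q0 !mul0r subrr mulr0 ltNge sqr_ge0 //.
apply: (@listed_iso _ _ _ _ [:: [::]; [::]; [::]; [::]; [:: T 1 2 1; T 3 4 1]; [:: T 1 2 k;
    T 1 3 q; T 1 4 (- p); T 2 3 s; T 2 4 (((- p) * s - v ^+ 2 - k ^+ 2 / 4) / q)]]);
  last exact: ext6_elliptic_pivot.
rewrite hv p0.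
iso_by [:: Y 1; Y 2; Y 4; [:: E (-1) 3]; Y 5; Y 6] [:: Y 1; Y 2; [:: E (-1) 4]; Y 3; Y 5; Y 6].
Qed.

(** By Jacobi no term contains 5, so the two differentials span a pencil of 2-forms on R^4. If its
    Pfaffian has a real root, a degenerate member is taken as the new d e^5 and 12 + 34 as the last
    differential; the quotient by the last vector is then abelian or (0,0,0,0,12), and both
    extensions are already treated. *)
Lemma ext6_00001234 (t12 t13 t14 t15 t23 t24 t25 t34 t35 t45 : R) :
  let D := [:: [::]; [::]; [::]; [::]; [:: T 1 2 1; T 3 4 1];
    [:: T 1 2 t12; T 1 3 t13; T 1 4 t14; T 1 5 t15; T 2 3 t23; T 2 4 t24; T 2 5 t25;
    T 3 4 t34; T 3 5 t35; T 4 5 t45]] in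
  lie (brD 6 D) -> listed 6 nil6 D.
Proof.
move=> D hl; jacobi hl 1%N 2%N 3%N. jacobi hl 1%N 2%N 4%N. jacobi hl 1%N 3%N 4%N. jacobi hl 2%N 3%N 4%N.
rewrite /D in hl *; clear D.
subst_coef hl t35 (0 : R).
subst_coef hl t45 (0 : R).
subst_coef hl t15 (0 : R).
subst_coef hl t25 (0 : R).
move: hl => hl'; clear J J0 J1 J2.
pose k := t12 - t34.
have [h|h] := ltP (k ^+ 2) (4 * (t14 * t23 - t13 * t24)).
  apply: (@listed_iso _ _ _ _ [:: [::]; [::]; [::]; [::]; [:: T 1 2 1; T 3 4 1]; [:: T 1 2 k;
    T 1 3 t13; T 1 4 t14;
    T 2 3 t23; T 2 4 t24]]);
    last exact: ext6_elliptic.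
  rewrite /k.
  iso_by [:: Y 1; Y 2; Y 3; Y 4; Y 5; [:: X 6; E (-t34) 5]]
    [:: Y 1; Y 2; Y 3; Y 4; Y 5; [:: X 6; E t34 5]].
pose s := Num.sqrt (k ^+ 2 - 4 * (t14 * t23 - t13 * t24)).
have hs : s ^+ 2 = k ^+ 2 - 4 * (t14 * t23 - t13 * t24) by rewrite sqr_sqrtr ?subr_ge0.
(* A root of x^2 + kx + (t14 t23 - t13 t24), the Pfaffian of [th]. *)
pose x := (s - k) / 2.
pose th := [:: T 1 2 (k + x); T 1 3 t13; T 1 4 t14; T 2 3 t23; T 2 4 t24; T 3 4 x].
pose D' := rcons [:: [::]; [::]; [::]; [::]; th] [:: T 1 2 1; T 3 4 1].
pose D0 := [:: [::]; [::]; [::]; [::]; [:: T 1 2 1; T 3 4 1];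
    [:: T 1 2 t12; T 1 3 t13; T 1 4 t14; T 1 5 0; T 2 3 t23; T 2 4 t24; T 2 5 0; T 3 4 t34;
        T 3 5 0; T 4 5 0]].
have i1 : iso (brD 6 D0) (brD 6 D').
  rewrite /D' /D0 /th /k.
  iso_by [:: Y 1; Y 2; Y 3; Y 4; [:: X 6; E (x-t34) 5]; Y 5]
    [:: Y 1; Y 2; Y 3; Y 4; Y 6; [:: X 5; E (-x+t34) 6]].
have l0 : lie (brD 6 D0).
  by move: hl'.
have l1 : lie (brD 6 D') := iso_lie i1 l0.
have hz y : brD 6 D' y (delta_mx 0 ord_max) = 0.
  apply: row_crd => i hi; rewrite crd_brD //.
  have e0 j : (j < 5)%N -> crd (delta_mx 0 ord_max : 'rV[R]_6) j = 0.
    move=> hj; have hj6 : (j < 6)%N by rewrite (leq_trans hj).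
    have /negPf h5 : Ordinal hj6 != ord_max by rewrite -val_eqE /= (ltn_eqF hj).
    by rewrite -[j]/(val (Ordinal hj6)) crdE mxE h5 andbF.
  have -> : crd (0 : 'rV[R]_6) i = 0 by rewrite /crd; case: insub => [j|]; rewrite ?mxE.
  by case: i hi => [|[|[|[|[|[|i]]]]]] // _; rewrite /form2 /D' /= ?e0 //; ring.
apply: (listed_iso i1).
have [m [im hm]] := ext_R4 (k + x) t13 t14 t23 t24 x.
have qE : quobr (brD 6 D') = brD 5 [:: [::]; [::]; [::]; [::]; th] by rewrite quobr_brD.
have [m0|[c mc hc]] := hm.
  have [] := @quotient_extension R 5 _ (nth [::] nil5 0) l1 hz erefl.
    by rewrite qE; apply: (iso_trans im); rewrite m0; apply: iso_refl.
  by move=> t [it lt]; apply: (listed_iso it); apply: ext6_R5.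
have [] := @quotient_extension R 5 _ (nth [::] nil5 1) l1 hz erefl.
  rewrite qE; apply: (iso_trans im); rewrite mc hc; last first.
    have -> : k = s - 2 * x by rewrite /x; field.
    have : s ^+ 2 = (s - 2 * x) ^+ 2 - 4 * (t14 * t23 - t13 * t24).
      by rewrite hs /x; congr (_ ^+ 2 - _); field.
    by nra.
  iso_by [:: Y 1; Y 2; Y 3; Y 4; Y 5] [:: Y 1; Y 2; Y 3; Y 4; Y 5].
by move=> t [it lt]; apply: (listed_iso it); apply: ext6_000012.
Qed.

(** The terms in [a] and [c] are absorbed by means of [A], the term in [b] by means of [d] when it
    is nonzero; the sign of d/A then separates 14+35 from 14-35 over (0,0,0,12,23). *)
Lemma ext6_0001213_diag (a b c A d : R) : A != 0 ->
  listed 6 nil6 [:: [::]; [::]; [::]; [:: T 1 2 1]; [:: T 1 3 1]; [:: T 1 4 a; T 1 5 b; T 2 3 c;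
    T 2 4 (A); T 2 5 0; T 3 4 0; T 3 5 d]].
Proof.
move=> A0.
apply: (@listed_iso _ _ _ _ [:: [::]; [::]; [::]; [:: T 1 2 1]; [:: T 1 3 1]; [:: T 1 4 0;
    T 1 5 b; T 2 3 0; T 2 4 (A); T 2 5 0; T 3 4 0; T 3 5 d]]).
  iso_by [:: Y 1; [:: X 2; E (a/A) 1]; Y 3; [:: X 4; E (c/A) 3]; Y 5; [:: X 6; E (a*c/A) 5]]
    [:: Y 1; [:: X 2; E (-(a/A)) 1]; Y 3; [:: X 4; E (-(c/A)) 3]; Y 5; [:: X 6;
      E (-(a*c/A)) 5]].
have [->|d0] := eqVneq d 0.
  have [->|b0] := eqVneq b 0.
    apply: (@listed_nth _ 11) => //.
    iso_by [:: Y 1; Y 2; Y 3; Y 4; Y 5; [:: E (A^-1) 6]]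
      [:: Y 1; Y 2; Y 3; Y 4; Y 5; [:: E (A) 6]].
  apply: (@listed_nth _ 9) => //.
  iso_by [:: Y 1; [:: E (b/A) 3]; Y 2; [:: E (b/A) 5]; Y 4; [:: E (A^-1) 6]]
    [:: Y 1; Y 3; [:: E (A/b) 2]; Y 5; [:: E (A/b) 4]; [:: E (A) 6]].
apply: (@listed_iso _ _ _ _ [:: [::]; [::]; [::]; [:: T 1 2 1]; [:: T 1 3 1]; [:: T 1 4 0;
    T 1 5 0; T 2 3 0; T 2 4 (A); T 2 5 0; T 3 4 0; T 3 5 d]]).
  iso_by [:: Y 1; Y 2; [:: X 3; E (b/d) 1]; Y 4; Y 5; Y 6]
    [:: Y 1; Y 2; [:: X 3; E (-(b/d)) 1]; Y 4; Y 5; Y 6].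
pose s := Num.sqrt `|d / A|.
have hs : s ^+ 2 = `|d / A| by rewrite sqr_sqrtr.
have s0 : s != 0 by rewrite -sqrf_eq0 hs normr_eq0 mulf_neq0 // invr_neq0.
have [p|p] := leP 0 (d / A).
  have -> : d = A * s ^+ 2 by rewrite hs ger0_norm //; field.
  apply: (@listed_nth _ 8) => //.
  iso_by [:: Y 2; Y 1; [:: E s 3]; [:: E (-1) 4]; [:: E s 5]; [:: E (-A^-1) 6]]
    [:: Y 2; Y 1; [:: E (s^-1) 3]; [:: E (-1) 4]; [:: E (s^-1) 5]; [:: E (-A) 6]].
have -> : d = - (A * s ^+ 2) by rewrite hs ltr0_norm //; field.
apply: (@listed_nth _ 7) => //.
iso_by [:: Y 2; Y 1; [:: E s 3]; [:: E (-1) 4]; [:: E s 5]; [:: E (-A^-1) 6]]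
  [:: Y 2; Y 1; [:: E (s^-1) 3]; [:: E (-1) 4]; [:: E (s^-1) 5]; [:: E (-A) 6]].
Qed.

(** Completing the square in A y^2 + 2B yz + d z^2. *)
Lemma ext6_0001213_pivot (a b c A B d : R) : A != 0 ->
  listed 6 nil6 [:: [::]; [::]; [::]; [:: T 1 2 1]; [:: T 1 3 1]; [:: T 1 4 a; T 1 5 b; T 2 3 c;
    T 2 4 (A); T 2 5 (B); T 3 4 (B); T 3 5 d]].
Proof.
move=> A0.
apply: (@listed_iso _ _ _ _ [:: [::]; [::]; [::]; [:: T 1 2 1]; [:: T 1 3 1]; [:: T 1 4 a;
    T 1 5 (b - a * B / A); T 2 3 c; T 2 4 (A); T 2 5 0; T 3 4 0; T 3 5 (d - B ^+ 2 / A)]]);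
  last exact: ext6_0001213_diag.
iso_by [:: Y 1; [:: X 2; E (B/A) 3]; Y 3; [:: X 4; E (B/A) 5]; Y 5; Y 6]
  [:: Y 1; [:: X 2; E (-(B/A)) 3]; Y 3; [:: X 4; E (-(B/A)) 5]; Y 5; Y 6].
Qed.

Lemma ext6_0001213_linear (a b c : R) : a != 0 ->
  listed 6 nil6 [:: [::]; [::]; [::]; [:: T 1 2 1]; [:: T 1 3 1]; [:: T 1 4 a; T 1 5 b; T 2 3 c;
    T 2 4 0; T 2 5 0; T 3 4 0; T 3 5 0]].
Proof.
move=> a0; have [->|c0] := eqVneq c 0.
  apply: (@listed_nth _ 32) => //.
  iso_by [:: Y 1; [:: E a 2; E b 3]; Y 3; [:: E a 4; E b 5]; Y 5; Y 6]
    [:: Y 1; [:: E (a^-1) 2; E (-(b/a)) 3]; Y 3; [:: E (a^-1) 4; E (-(b/a)) 5]; [:: X 5]; Y 6].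
apply: (@listed_nth _ 10) => //.
iso_by [:: Y 1; [:: E a 2; E b 3]; [:: E (c/a) 3]; [:: E a 4; E b 5]; [:: E (c/a) 5]; Y 6]
  [:: Y 1; [:: E (a^-1) 2; E (-(b/c)) 3]; [:: E (a/c) 3]; [:: E (a^-1) 4; E (-(b/c)) 5];
    [:: E (a/c) 5]; Y 6].
Qed.

(** Jacobi makes the coefficients of 25 and 34 equal, so those of 24, 25, 35 form a symmetric
    matrix: a quadratic form on which GL(2) acts through (e^2, e^3) and (e^4, e^5) at once. Its
    rank, its signature up to sign and the surviving linear terms determine the algebra. *)
Lemma ext6_0001213 (t12 t13 t14 t15 t23 t24 t25 t34 t35 t45 : R) :
  let D := [:: [::]; [::]; [::]; [:: T 1 2 1]; [:: T 1 3 1];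
    [:: T 1 2 t12; T 1 3 t13; T 1 4 t14; T 1 5 t15; T 2 3 t23; T 2 4 t24; T 2 5 t25;
    T 3 4 t34; T 3 5 t35; T 4 5 t45]] in
  lie (brD 6 D) -> listed 6 nil6 D.
Proof.
move=> D hl; jacobi hl 1%N 2%N 3%N. jacobi hl 1%N 2%N 5%N.
rewrite /D in hl *; clear D.
subst_coef hl t45 (0 : R).
subst_coef hl t25 (t34).
clear hl J J0.
apply: (@listed_iso _ _ _ _ [:: [::]; [::]; [::]; [:: T 1 2 1]; [:: T 1 3 1]; [:: T 1 4 t14;
    T 1 5 t15; T 2 3 t23;
    T 2 4 t24; T 2 5 t34; T 3 4 t34; T 3 5 t35]]).
  iso_by [:: Y 1; Y 2; Y 3; Y 4; Y 5; [:: X 6; E (-t12) 4; E (-t13) 5]]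
    [:: Y 1; Y 2; Y 3; Y 4; Y 5; [:: X 6; E t12 4; E t13 5]].
have [->|t240] := eqVneq t24 0; last exact: ext6_0001213_pivot.
have [->|t350] := eqVneq t35 0; last first.
  apply: (@listed_iso _ _ _ _ [:: [::]; [::]; [::]; [:: T 1 2 1]; [:: T 1 3 1]; [:: T 1 4 t15;
    T 1 5 t14; T 2 3 (- t23); T 2 4 t35; T 2 5 t34; T 3 4 t34; T 3 5 0]]);
    last exact: ext6_0001213_pivot.
  iso_by [:: Y 1; Y 3; Y 2; Y 5; Y 4; Y 6] [:: Y 1; Y 3; Y 2; Y 5; Y 4; Y 6].
have [->|t340] := eqVneq t34 0; last first.
  (* The quadratic form is hyperbolic with zero diagonal; the shear e^3 - e^2 creates the diagonal
     entry 2 t34. *)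
  apply: (@listed_iso _ _ _ _ [:: [::]; [::]; [::]; [:: T 1 2 1]; [:: T 1 3 1];
    [:: T 1 4 (t14 + t15); T 1 5 t15; T 2 3 t23; T 2 4 (2 * t34); T 2 5 t34; T 3 4 t34;
    T 3 5 0]]);
    last by apply: ext6_0001213_pivot; rewrite mulf_neq0 // pnatr_eq0.
  iso_by [:: Y 1; Y 2; [:: X 3; E (-1) 2]; Y 4; [:: X 5; E (-1) 4]; Y 6]
    [:: Y 1; Y 2; [:: X 3; X 2]; Y 4; [:: X 5; X 4]; Y 6].
have [->|t140] := eqVneq t14 0; last exact: ext6_0001213_linear.
have [->|t150] := eqVneq t15 0; last first.
  apply: (@listed_iso _ _ _ _ [:: [::]; [::]; [::]; [:: T 1 2 1]; [:: T 1 3 1]; [:: T 1 4 t15;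
    T 1 5 0; T 2 3 (- t23);
    T 2 4 0; T 2 5 0; T 3 4 0; T 3 5 0]]);
    last exact: ext6_0001213_linear.
  iso_by [:: Y 1; Y 3; Y 2; Y 5; Y 4; Y 6] [:: Y 1; Y 3; Y 2; Y 5; Y 4; Y 6].
have [->|t230] := eqVneq t23 0; last first.
  apply: (@listed_nth _ 12) => //.
  iso_by [:: Y 1; Y 2; Y 3; Y 4; Y 5; [:: E (t23^-1) 6]]
    [:: Y 1; Y 2; Y 3; Y 4; Y 5; [:: E t23 6]].
apply: (@listed_nth _ 19) => //.
iso_by [:: Y 1; Y 2; Y 3; Y 6; Y 4; Y 5] [:: Y 1; Y 2; Y 3; Y 5; Y 6; Y 4].
Qed.

(** Modulo exact forms the closed 2-forms are spanned by 13, 15, 23 and 24. A nonzero 15-term gives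
    nilpotency step four, absorbs 13 into e^5 and leaves 23 and 24 to be scaled; without it the step
    stays three. *)
Lemma ext6_0001214 (t12 t13 t14 t15 t23 t24 t25 t34 t35 t45 : R) :
  let D := [:: [::]; [::]; [::]; [:: T 1 2 1]; [:: T 1 4 1];
    [:: T 1 2 t12; T 1 3 t13; T 1 4 t14; T 1 5 t15; T 2 3 t23; T 2 4 t24; T 2 5 t25;
    T 3 4 t34; T 3 5 t35; T 4 5 t45]] in
  lie (brD 6 D) -> listed 6 nil6 D.
Proof.
move=> D hl; jacobi hl 1%N 2%N 3%N. jacobi hl 1%N 2%N 4%N. jacobi hl 1%N 3%N 4%N. jacobi hl 1%N 2%N 5%N.
rewrite /D in hl *; clear D.
subst_coef hl t34 (0 : R).
subst_coef hl t25 (0 : R).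
subst_coef hl t35 (0 : R).
subst_coef hl t45 (0 : R).
clear hl J J0 J1 J2.
apply: (@listed_iso _ _ _ _ [:: [::]; [::]; [::]; [:: T 1 2 1]; [:: T 1 4 1]; [:: T 1 3 t13;
    T 1 5 t15; T 2 3 t23;
    T 2 4 t24]]).
  iso_by [:: Y 1; Y 2; Y 3; Y 4; Y 5; [:: X 6; E (-t12) 4; E (-t14) 5]]
    [:: Y 1; Y 2; Y 3; Y 4; Y 5; [:: X 6; E t12 4; E t14 5]].
move: t13 t15 t23 t24 => c a d b {t12 t14 t25 t34 t35 t45}.
have [->|a0] := eqVneq a 0; last first.
  apply: (@listed_iso _ _ _ _ [:: [::]; [::]; [::]; [:: T 1 2 1]; [:: T 1 4 1]; [:: T 1 3 0;
    T 1 5 a; T 2 3 d; T 2 4 b]]).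
    iso_by [:: Y 1; Y 2; Y 3; Y 4; [:: X 5; E (c/a) 3]; Y 6]
      [:: Y 1; Y 2; Y 3; Y 4; [:: X 5; E (-(c/a)) 3]; Y 6].
  have [->|b0] := eqVneq b 0.
    have [->|d0] := eqVneq d 0.
      apply: (@listed_nth _ 6) => //.
      iso_by [:: Y 1; Y 2; Y 3; Y 4; Y 5; [:: E (a^-1) 6]]
        [:: Y 1; Y 2; Y 3; Y 4; Y 5; [:: E a 6]].
    apply: (@listed_nth _ 4) => //.
    iso_by [:: Y 1; Y 2; [:: E (d/a) 3]; Y 4; Y 5; [:: E (a^-1) 6]]
      [:: Y 1; Y 2; [:: E (a/d) 3]; Y 4; Y 5; [:: E a 6]].
  have [->|d0] := eqVneq d 0.
    apply: (@listed_nth _ 13) => //.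
    iso_by [:: Y 1; [:: E (b/a) 2]; Y 3; [:: E (b/a) 4]; [:: E (b/a) 5]; [:: E (b/a/a) 6]]
      [:: Y 1; [:: E (a/b) 2]; Y 3; [:: E (a/b) 4]; [:: E (a/b) 5]; [:: E (a*a/b) 6]].
  apply: (@listed_nth _ 14) => //.
  iso_by [:: Y 1; [:: E (b/a) 2]; [:: E (d/a) 3]; [:: E (b/a) 4]; [:: E (b/a) 5];
      [:: E (b/a/a) 6]]
    [:: Y 1; [:: E (a/b) 2]; [:: E (a/d) 3]; [:: E (a/b) 4]; [:: E (a/b) 5]; [:: E (a*a/b) 6]].
have [->|b0] := eqVneq b 0; last first.
  have [->|d0] := eqVneq d 0; last first.
    apply: (@listed_nth _ 31) => //.
    iso_by [:: Y 1; [:: E (d/b) 2; E (c/b) 1]; [:: E (-(d/b)^+2) 3]; [:: E (d/b) 4;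
        E ((d/b)^+2) 3]; [:: E (d/b) 5]; [:: E (d*d/b/b/b) 6; E (c*d/b/b) 5]]
      [:: Y 1; [:: E (b/d) 2; E (-(c/d)) 1]; [:: E (-(b/d)^+2) 3]; [:: E (b/d) 4; E (b/d) 3];
        [:: E (b/d) 5]; [:: E (b*b*b/d/d) 6; E (-(c*b*b/d/d)) 5]].
  have [->|c0] := eqVneq c 0; last first.
    apply: (@listed_nth _ 30) => //.
    iso_by [:: Y 1; Y 2; [:: E (-(c/b)) 3]; Y 4; Y 5; [:: E (-b^-1) 6]]
      [:: Y 1; Y 2; [:: E (-(b/c)) 3]; Y 4; Y 5; [:: E (-b) 6]].
  apply: (@listed_nth _ 28) => //.
  iso_by [:: Y 1; Y 2; Y 3; Y 4; Y 5; [:: E (b^-1) 6]] [:: Y 1; Y 2; Y 3; Y 4; Y 5; [:: E b 6]].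
have [->|d0] := eqVneq d 0; last first.
  apply: (@listed_nth _ 11) => //.
  iso_by [:: [:: X 2; E (c/d) 1]; Y 1; [:: E d 3]; [:: E (-1) 4]; Y 6; [:: E (-1) 5]]
    [:: Y 2; [:: X 1; E (-(c/d)) 2]; [:: E (d^-1) 3]; [:: E (-1) 4]; [:: E (-1) 6]; [:: X 5]].
have [->|c0] := eqVneq c 0; last first.
  apply: (@listed_nth _ 32) => //.
  iso_by [:: Y 1; Y 2; Y 3; Y 4; [:: E (c^-1) 6]; Y 5] [:: Y 1; Y 2; Y 3; Y 4; Y 6; [:: E c 5]].
apply: (@listed_nth _ 33) => //.
iso_by [:: Y 1; Y 2; Y 3; Y 6; Y 4; Y 5] [:: Y 1; Y 2; Y 3; Y 5; Y 6; Y 4].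
Qed.

(** The sign of [d] counts the decomposable members of the pencil: for d = s^2 the forms d(e^6 + s
    e^5) and d(e^6 - s e^5) are (e^2 + s e^1) /\ (e^4 + s e^3) and (e^2 - s e^1) /\ (e^4 - s e^3),
    which coincide for s = 0; for d < 0 there is no real one. *)
Lemma ext6_0001214_23_reduced (d : R) :
  listed 6 nil6 [:: [::]; [::]; [::]; [:: T 1 2 1]; [:: T 1 4 1; T 2 3 1]; [:: T 1 3 d;
    T 2 4 1]].
Proof.
have [->|d0] := eqVneq d 0.
  apply: (@listed_nth _ 30) => //.
  iso_by [:: Y 2; [:: E (-1) 1]; Y 3; Y 4; Y 6; Y 5]
    [:: [:: E (-1) 2]; Y 1; Y 3; Y 4; Y 6; Y 5].
pose s := Num.sqrt `|d|; have hs : s ^+ 2 = `|d| by rewrite sqr_sqrtr.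
have s0 : s != 0 by rewrite -sqrf_eq0 hs normr_eq0.
have [p|p] := leP 0 d.
  have -> : d = s ^+ 2 by rewrite hs ger0_norm.
  apply: (@listed_nth _ 31) => //.
  iso_by [:: [:: X 2; E s 1]; [:: E ((2*s)^-1) 2; E (-(2^-1)) 1]; [:: E (2*s) 3]; [:: X 4;
      E (-s) 3]; [:: X 6; E s 5]; [:: E ((2*s)^-1) 6; E (-(2^-1)) 5]]
    [:: [:: E ((2*s)^-1) 1; E (-1) 2]; [:: E (2^-1) 1; E s 2]; [:: E ((2*s)^-1) 3]; [:: X 4;
      E (2^-1) 3]; [:: E ((2*s)^-1) 5; E (-1) 6]; [:: E (2^-1) 5; E s 6]].
have -> : d = - s ^+ 2 by rewrite hs ltr0_norm // opprK.
apply: (@listed_nth _ 29) => //.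
iso_by [:: Y 1; [:: E (s^-1) 2]; Y 3; [:: E (s^-1) 4]; [:: E (-(s^-1)^+2) 6]; [:: E (s^-1) 5]]
  [:: Y 1; [:: E s 2]; Y 3; [:: E s 4]; [:: E s 6]; [:: E (-s^+2) 5]].
Qed.

Lemma ext6_0001214_23 (t12 t13 t14 t15 t23 t24 t25 t34 t35 t45 : R) :
  let D := [:: [::]; [::]; [::]; [:: T 1 2 1]; [:: T 1 4 1; T 2 3 1];
    [:: T 1 2 t12; T 1 3 t13; T 1 4 t14; T 1 5 t15; T 2 3 t23; T 2 4 t24; T 2 5 t25;
    T 3 4 t34; T 3 5 t35; T 4 5 t45]] in
  lie (brD 6 D) -> listed 6 nil6 D.
Proof.
move=> D hl; jacobi hl 1%N 2%N 3%N. jacobi hl 1%N 2%N 4%N. jacobi hl 1%N 3%N 4%N. jacobi hl 1%N 2%N 5%N.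
rewrite /D in hl *; clear D.
subst_coef hl t34 (- t15).
subst_coef hl t25 (0 : R).
subst_coef hl t35 (0 : R).
subst_coef hl t45 (0 : R).
(* The form 14 + 23 is exact, so only the difference of the two coefficients matters. *)
clear hl J J0 J1 J2; pose c := t23 - t14.
apply: (@listed_iso _ _ _ _ [:: [::]; [::]; [::]; [:: T 1 2 1]; [:: T 1 4 1; T 2 3 1];
    [:: T 1 3 t13; T 1 5 t15; T 2 3 c; T 2 4 t24; T 3 4 (- t15)]]).
  rewrite /c.
  iso_by [:: Y 1; Y 2; Y 3; Y 4; Y 5; [:: X 6; E (-t12) 4; E (-t14) 5]]
    [:: Y 1; Y 2; Y 3; Y 4; Y 5; [:: X 6; E t12 4; E t14 5]].
move: c t13 t15 t24 => c b a d {t12 t14 t23 t25 t34 t35 t45}.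
have [->|a0] := eqVneq a 0; last first.
  apply: (@listed_nth _ 5) => //.
  iso_by [:: Y 1; Y 2; [:: E (-1) 3; E (-(c/2/a)) 1; E (d/a) 2]; Y 4; [:: X 5; E (-(c/2/a)) 4;
      E (b/a) 3]; [:: E (a^-1) 6; E (-(c/a)) 5]]
    [:: Y 1; Y 2; [:: E (-1) 3; E (-(c/2/a)) 1; E (d/a) 2]; Y 4; [:: X 5; E (c/2/a) 4;
      E (b/a) 3; E (b*c/2/a/a) 1; E (-(b*d/a/a)) 2]; [:: E a 6; E c 5; E (c*c/2/a) 4;
      E (c*b/a) 3; E (c*b*c/2/a/a) 1; E (-(c*b*d/a/a)) 2]].
rewrite oppr0.
have [->|d0] := eqVneq d 0; last first.
  (* The shears remove [c]; the coefficient left at 13 is a quarter of the discriminant of x^2 +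
     (c/d) x - b/d, whose roots are the decomposable members of the pencil. *)
  apply: (@listed_iso _ _ _ _ [:: [::]; [::]; [::]; [:: T 1 2 1]; [:: T 1 4 1; T 2 3 1];
    [:: T 1 3 (b / d + (c / d) ^+ 2 / 4); T 2 4 1]]);
    last exact: ext6_0001214_23_reduced.
  iso_by [:: Y 1; [:: X 2; E (-(c/d/2)) 1]; Y 3; [:: X 4; E (c/d/2) 3]; Y 5; [:: E (d^-1) 6;
      E (-(c/d/2)) 5]]
    [:: Y 1; [:: X 2; E (c/d/2) 1]; Y 3; [:: X 4; E (-(c/d/2)) 3]; Y 5; [:: E d 6;
      E (c/2) 5]].
have [->|c0] := eqVneq c 0; last first.
  apply: (@listed_nth _ 11) => //.
  iso_by [:: [:: X 2; E (b/c) 1]; Y 1; Y 3; [:: E (-1) 4; E (b/c) 3]; [:: E (c^-1) 6];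
      [:: E (c^-1) 6; E (-1) 5]]
    [:: Y 2; [:: X 1; E (-(b/c)) 2]; Y 3; [:: E (-1) 4; E (b/c) 3]; [:: X 5; E (-1) 6];
      [:: E c 5]].
have [->|b0] := eqVneq b 0; last first.
  apply: (@listed_nth _ 10) => //.
  iso_by [:: Y 1; Y 2; Y 3; Y 4; [:: E (b^-1) 6]; Y 5] [:: Y 1; Y 2; Y 3; Y 4; Y 6; [:: E b 5]].
apply: (@listed_nth _ 15) => //.
iso_by [:: Y 2; Y 1; Y 6; [:: E (-1) 3]; [:: E (-1) 4]; [:: E (-1) 5]]
  [:: Y 2; Y 1; [:: E (-1) 4]; [:: E (-1) 5]; [:: E (-1) 6]; Y 3].
Qed.

(** Modulo exact forms the closed 2-forms are spanned by 15, 23 and 25 - 34; a nonzero coefficient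
    of the last absorbs the other two. *)
Lemma ext6_00121314 (t12 t13 t14 t15 t23 t24 t25 t34 t35 t45 : R) :
  let D := [:: [::]; [::]; [:: T 1 2 1]; [:: T 1 3 1]; [:: T 1 4 1];
    [:: T 1 2 t12; T 1 3 t13; T 1 4 t14; T 1 5 t15; T 2 3 t23; T 2 4 t24; T 2 5 t25;
    T 3 4 t34; T 3 5 t35; T 4 5 t45]] in
  lie (brD 6 D) -> listed 6 nil6 D.
Proof.
move=> D hl; jacobi hl 1%N 2%N 3%N. jacobi hl 1%N 2%N 4%N. jacobi hl 1%N 2%N 5%N. jacobi hl 1%N 3%N 5%N.
rewrite /D in hl *; clear D.
subst_coef hl t24 (0 : R).
subst_coef hl t34 (- t25).
subst_coef hl t35 (0 : R).
subst_coef hl t45 (0 : R).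
clear hl J J0 J1 J2.
apply: (@listed_iso _ _ _ _ [:: [::]; [::]; [:: T 1 2 1]; [:: T 1 3 1]; [:: T 1 4 1];
    [:: T 1 5 t15; T 2 3 t23; T 2 4 0; T 2 5 t25; T 3 4 (- t25)]]).
  iso_by [:: Y 1; Y 2; Y 3; Y 4; Y 5; [:: X 6; E (-t12) 3; E (-t13) 4; E (-t14) 5]]
    [:: Y 1; Y 2; Y 3; Y 4; Y 5; [:: X 6; E t12 3; E t13 4; E t14 5]].
move: t15 t23 t25 => a b c {t12 t13 t14 t24 t34 t35 t45}.
have [->|c0] := eqVneq c 0; last first.
  apply: (@listed_nth _ 25) => //.
  iso_by [:: Y 1; [:: X 2; E (a/c) 1]; Y 3; [:: X 4; E (b/2/c) 2]; [:: X 5; E (b/2/c) 3];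
      [:: E (-c^-1) 6; E (-(b*a/2/c/c)) 4]]
    [:: Y 1; [:: X 2; E (-(a/c)) 1]; Y 3; [:: X 4; E (-(b/2/c)) 2; E (b*a/2/c/c) 1]; [:: X 5;
      E (-(b/2/c)) 3]; [:: E (-c) 6; E (-(b*a/2/c)) 4; E (b*a/2/c*b/2/c) 2;
      E (-(b*a/2/c*b/2/c*a/c)) 1]].
rewrite oppr0.
have [->|a0] := eqVneq a 0; last first.
  have [->|b0] := eqVneq b 0.
    apply: (@listed_nth _ 26) => //.
    iso_by [:: Y 1; Y 2; Y 3; Y 4; Y 5; [:: E (a^-1) 6]]
      [:: Y 1; Y 2; Y 3; Y 4; Y 5; [:: E a 6]].
  apply: (@listed_nth _ 27) => //.
  iso_by [:: Y 1; [:: E (b/a) 2]; [:: E (b/a) 3]; [:: E (b/a) 4]; [:: E (b/a) 5];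
      [:: E (b/a/a) 6]]
    [:: Y 1; [:: E (a/b) 2]; [:: E (a/b) 3]; [:: E (a/b) 4]; [:: E (a/b) 5]; [:: E (a*a/b) 6]].
have [->|b0] := eqVneq b 0; last first.
  apply: (@listed_nth _ 0) => //.
  iso_by [:: Y 1; Y 2; Y 3; Y 4; [:: E (b^-1) 6]; Y 5] [:: Y 1; Y 2; Y 3; Y 4; Y 6; [:: E b 5]].
apply: (@listed_nth _ 6) => //.
iso_by [:: Y 1; Y 2; Y 6; Y 3; Y 4; Y 5] [:: Y 1; Y 2; Y 4; Y 5; Y 6; Y 3].
Qed.

Lemma ext6_00121314_23 (t12 t13 t14 t15 t23 t24 t25 t34 t35 t45 : R) :
  let D := [:: [::]; [::]; [:: T 1 2 1]; [:: T 1 3 1]; [:: T 1 4 1; T 2 3 1];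
    [:: T 1 2 t12; T 1 3 t13; T 1 4 t14; T 1 5 t15; T 2 3 t23; T 2 4 t24; T 2 5 t25;
    T 3 4 t34; T 3 5 t35; T 4 5 t45]] in
  lie (brD 6 D) -> listed 6 nil6 D.
Proof.
move=> D hl; jacobi hl 1%N 2%N 3%N. jacobi hl 1%N 2%N 4%N. jacobi hl 1%N 2%N 5%N. jacobi hl 1%N 3%N 5%N.
rewrite /D in hl *; clear D.
subst_coef hl t24 (t15).
subst_coef hl t34 (- t25).
subst_coef hl t35 (0 : R).
subst_coef hl t45 (0 : R).
clear hl J J0 J1 J2; pose b := t23 - t14.
apply: (@listed_iso _ _ _ _ [:: [::]; [::]; [:: T 1 2 1]; [:: T 1 3 1]; [:: T 1 4 1; T 2 3 1];
    [:: T 1 5 t15; T 2 3 b; T 2 4 t15; T 2 5 t25; T 3 4 (- t25)]]).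
  rewrite /b.
  iso_by [:: Y 1; Y 2; Y 3; Y 4; Y 5; [:: X 6; E (-t12) 3; E (-t13) 4; E (-t14) 5]]
    [:: Y 1; Y 2; Y 3; Y 4; Y 5; [:: X 6; E t12 3; E t13 4; E t14 5]].
move: b t15 t25 => b a c {t12 t13 t14 t23 t24 t34 t35 t45}.
have [->|c0] := eqVneq c 0; last first.
  (* The shear e^2 + x e^1 removes 15 and 24, and e^4 + y e^2 removes 23. The term x^2 in [y] arises
     because x^2 14 is removed through d e^5 = 14 + 23. *)
  pose x := a / c; pose y := (b / c + x ^+ 2) / 2.
  have -> : a = x * c by rewrite /x; field.
  have -> : b = (2 * y - x ^+ 2) * c by rewrite /y; field.
  apply: (@listed_nth _ 24) => //.
  iso_by [:: Y 1; [:: X 2; E x 1]; Y 3; [:: X 4; E y 2]; [:: X 5; E y 3; E x 4];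
      [:: E (-c^-1) 6; E (-(x*y)) 4; E (-x^+2) 5]]
    [:: Y 1; [:: X 2; E (-x) 1]; Y 3; [:: X 4; E (-y) 2; E (x*y) 1]; [:: X 5; E (-y) 3;
      E (-x) 4; E (x*y) 2; E (-(x*x*y)) 1]; [:: E (-c) 6; E (-(c*x*y)) 4; E (c*x*y*y) 2;
      E (-(c*x*y*x*y)) 1; E (-(c*x^+2)) 5; E (c*x^+2*y) 3; E (c*x^+3) 4; E (-(c*x^+3*y)) 2;
      E (c*x^+4*y) 1]].
rewrite oppr0.
have [->|a0] := eqVneq a 0; last first.
  apply: (@listed_nth _ 3) => //.
  iso_by [:: Y 1; [:: X 2; E (-(b/a/2)) 1]; Y 3; Y 4; [:: X 5; E (-(b/a/2)) 4]; [:: E (a^-1) 6;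
      E (-(b/a)) 5]]
    [:: Y 1; [:: X 2; E (b/a/2) 1]; Y 3; Y 4; [:: X 5; E (b/a/2) 4]; [:: E a 6; E b 5;
      E (b*b/a/2) 4]].
have [->|b0] := eqVneq b 0; last first.
  apply: (@listed_nth _ 0) => //.
  iso_by [:: Y 1; Y 2; Y 3; Y 4; [:: E (b^-1) 6]; [:: X 5; E (-b^-1) 6]]
    [:: Y 1; Y 2; Y 3; Y 4; [:: X 6; X 5]; [:: E b 5]].
apply: (@listed_nth _ 13) => //.
iso_by [:: Y 1; Y 2; Y 6; Y 3; Y 4; Y 5] [:: Y 1; Y 2; Y 4; Y 5; Y 6; Y 3].
Qed.

(** Again a quadratic form, with matrix (a, B; B, d): a change of (e^1, e^2) is matched by one of
    (e^4, e^5), whose differentials are 13 and 23. The sign of the second diagonal entry relative to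
    [a] separates 14+25 from 14-25. *)
Lemma ext6_00121323_pivot (a B d : R) : a != 0 ->
  listed 6 nil6 [:: [::]; [::]; [:: T 1 2 1]; [:: T 1 3 1]; [:: T 2 3 1]; [:: T 1 4 a;
    T 1 5 (B); T 2 4 (B); T 2 5 d]].
Proof.
move=> a0.
apply: (@listed_iso _ _ _ _ [:: [::]; [::]; [:: T 1 2 1]; [:: T 1 3 1]; [:: T 2 3 1];
    [:: T 1 4 a; T 1 5 0; T 2 4 0; T 2 5 (d - B ^+ 2 / a)]]).
  iso_by [:: [:: X 1; E (B/a) 2]; Y 2; Y 3; [:: X 4; E (B/a) 5]; Y 5; Y 6]
    [:: [:: X 1; E (-(B/a)) 2]; Y 2; Y 3; [:: X 4; E (-(B/a)) 5]; Y 5; [:: X 6]].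
move: (d - _) => {}d.
have [->|d0] := eqVneq d 0.
  apply: (@listed_nth _ 0) => //.
  iso_by [:: Y 1; Y 2; Y 3; Y 4; Y 5; [:: E (a^-1) 6]] [:: Y 1; Y 2; Y 3; Y 4; Y 5; [:: E a 6]].
pose s := Num.sqrt `|d / a|; have hs : s ^+ 2 = `|d / a| by rewrite sqr_sqrtr.
have s0 : s != 0 by rewrite -sqrf_eq0 hs normr_eq0 mulf_neq0 // invr_neq0.
have [p|p] := leP 0 (d / a).
  have -> : d = a * s ^+ 2 by rewrite hs ger0_norm //; field.
  apply: (@listed_nth _ 1) => //.
  iso_by [:: Y 1; [:: E s 2]; [:: E s 3]; [:: E s 4]; [:: E (s^+2) 5]; [:: E (s/a) 6]]
    [:: Y 1; [:: E (s^-1) 2]; [:: E (s^-1) 3]; [:: E (s^-1) 4]; [:: E ((s^-1)^+2) 5];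
      [:: E (a/s) 6]].
have -> : d = - (a * s ^+ 2) by rewrite hs ltr0_norm //; field.
apply: (@listed_nth _ 2) => //.
iso_by [:: Y 1; [:: E s 2]; [:: E s 3]; [:: E s 4]; [:: E (s^+2) 5]; [:: E (s/a) 6]]
  [:: Y 1; [:: E (s^-1) 2]; [:: E (s^-1) 3]; [:: E (s^-1) 4]; [:: E ((s^-1)^+2) 5];
    [:: E (a/s) 6]].
Qed.

Lemma ext6_00121323 (t12 t13 t14 t15 t23 t24 t25 t34 t35 t45 : R) :
  let D := [:: [::]; [::]; [:: T 1 2 1]; [:: T 1 3 1]; [:: T 2 3 1];
    [:: T 1 2 t12; T 1 3 t13; T 1 4 t14; T 1 5 t15; T 2 3 t23; T 2 4 t24; T 2 5 t25;
    T 3 4 t34; T 3 5 t35; T 4 5 t45]] in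
  lie (brD 6 D) -> listed 6 nil6 D.
Proof.
move=> D hl; jacobi hl 1%N 2%N 3%N. jacobi hl 1%N 2%N 4%N. jacobi hl 1%N 2%N 5%N. jacobi hl 1%N 3%N 5%N.
rewrite /D in hl *; clear D.
subst_coef hl t24 (t15).
subst_coef hl t34 (0 : R).
subst_coef hl t35 (0 : R).
subst_coef hl t45 (0 : R).
clear hl J J0 J1 J2.
apply: (@listed_iso _ _ _ _ [:: [::]; [::]; [:: T 1 2 1]; [:: T 1 3 1]; [:: T 2 3 1];
    [:: T 1 4 t14; T 1 5 t15; T 2 4 t15; T 2 5 t25]]).
  iso_by [:: Y 1; Y 2; Y 3; Y 4; Y 5; [:: X 6; E (-t12) 3; E (-t13) 4; E (-t23) 5]]
    [:: Y 1; Y 2; Y 3; Y 4; Y 5; [:: X 6; E t12 3; E t13 4; E t23 5]].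
have [->|t140] := eqVneq t14 0; last exact: ext6_00121323_pivot.
have [->|t250] := eqVneq t25 0; last first.
  apply: (@listed_iso _ _ _ _ [:: [::]; [::]; [:: T 1 2 1]; [:: T 1 3 1]; [:: T 2 3 1];
    [:: T 1 4 (- t25); T 1 5 (- t15);
    T 2 4 (- t15); T 2 5 0]]);
    last by apply: ext6_00121323_pivot; rewrite oppr_eq0.
  iso_by [:: Y 2; Y 1; [:: E (-1) 3]; [:: E (-1) 5]; [:: E (-1) 4]; Y 6]
    [:: Y 2; Y 1; [:: E (-1) 3]; [:: E (-1) 5]; [:: E (-1) 4]; Y 6].
have [->|t150] := eqVneq t15 0; last first.
  apply: (@listed_iso _ _ _ _ [:: [::]; [::]; [:: T 1 2 1]; [:: T 1 3 1]; [:: T 2 3 1];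
    [:: T 1 4 (2 * t15); T 1 5 t15;
    T 2 4 t15; T 2 5 0]]);
    last by apply: ext6_00121323_pivot; rewrite mulf_neq0 // pnatr_eq0.
  iso_by [:: Y 1; [:: X 2; E (-1) 1]; Y 3; Y 4; [:: X 5; E (-1) 4]; Y 6]
    [:: Y 1; [:: X 2; X 1]; Y 3; Y 4; [:: X 5; X 4]; Y 6].
apply: (@listed_nth _ 28) => //.
iso_by [:: Y 1; Y 2; Y 6; Y 3; Y 4; Y 5] [:: Y 1; Y 2; Y 4; Y 5; Y 6; Y 3].
Qed.

Lemma classified6 : classified R 6 nil6.
Proof.
apply: (classified_step _ (@classified5 R)) => // D t.
have E5 : allforms 5 t = [:: T 1 2 (t 0 1); T 1 3 (t 0 2); T 1 4 (t 0 3); T 1 5 (t 0 4);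
    T 2 3 (t 1 2); T 2 4 (t 1 3); T 2 5 (t 1 4); T 3 4 (t 2 3); T 3 5 (t 2 4); T 4 5 (t 3 4)].
  by [].
rewrite E5 !inE; do ![case/orP]; move/eqP => -> hl.
- exact: ext6_R5.
- exact: ext6_000012.
- exact: ext6_00001234.
- exact: ext6_0001213.
- exact: ext6_0001214.
- exact: ext6_0001214_23.
- exact: ext6_00121314.
- exact: ext6_00121314_23.
- exact: ext6_00121323.
Qed.

End Classification6.

(** * Alternating forms *)

Section AltForms.
Variable R : realType.
Local Notation vec := 'rV[R]_6.
Implicit Types (a b : form R) (M : 'M[R]_6).

(** Alternation is required for adjacent equal arguments only, which is what the formulas for
    determinants, d and wedge products verify directly; the general case follows by
    transpositions. *)
Definition altform k a : Prop :=
  [/\ (forall xs, size xs <> k -> a xs = 0),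
      (forall c l r x y, a (l ++ (c *: x + y) :: r) =
                         c * a (l ++ x :: r) + a (l ++ y :: r)) &
      (forall l r x, a (l ++ x :: x :: r) = 0)].

Section AltTheory.
Variables (k : nat) (a : form R).
Hypothesis ha : altform k a.

Lemma altD l r x y : a (l ++ (x + y) :: r) = a (l ++ x :: r) + a (l ++ y :: r).
Proof. by case: ha => _ h _; rewrite -{1}[x]scale1r h mul1r. Qed.

Lemma alt0 l r : a (l ++ 0 :: r) = 0.
Proof. by apply: (addIr (a (l ++ 0 :: r))); rewrite -altD addr0 add0r. Qed.

Lemma altZ c l r x : a (l ++ (c *: x) :: r) = c * a (l ++ x :: r).
Proof. by case: ha => _ h _; rewrite -[c *: x]addr0 h alt0 addr0. Qed.

Lemma alt_sum I s (F : I -> vec) l r :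
  a (l ++ (\sum_(i <- s) F i) :: r) = \sum_(i <- s) a (l ++ F i :: r).
Proof.
by elim: s => [|i s IH]; rewrite ?big_nil ?alt0 // !big_cons altD IH.
Qed.

Lemma alt_swap l r x y : a (l ++ x :: y :: r) = - a (l ++ y :: x :: r).
Proof.
case: ha => _ _ h; apply/eqP; rewrite -addr_eq0; apply/eqP.
have h2 z : a (l ++ z :: (x + y) :: r) = a (l ++ z :: x :: r) + a (l ++ z :: y :: r).
  by rewrite -![l ++ z :: _ :: r]cat_rcons altD.
by have := h l r (x + y); rewrite altD !h2 !h add0r addr0.
Qed.

(** Only vanishing is carried through permutations, so that no sign has to be tracked. *)
Lemma alt_perm0 (v : 'I_6 -> vec) s t :
  perm_eq s t -> a [seq v i | i <- s] = 0 -> a [seq v i | i <- t] = 0.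
Proof.
have move1 l i s1 r : a [seq v j | j <- l ++ i :: s1 ++ r] = 0 ->
    a [seq v j | j <- l ++ s1 ++ i :: r] = 0.
  elim: s1 l => [|j s1 IH] l //=; rewrite -cat_rcons => h.
  rewrite -cat_rcons; apply: IH.
  move: h; rewrite !map_cat !map_rcons /= !cat_rcons alt_swap => /eqP.
  by rewrite oppr_eq0 => /eqP.
apply: (catCA_perm_ind (P := fun s => a [seq v i | i <- s] = 0)).
elim=> [|i s1 IH] s2 s3 //= h; apply: (move1 [::]) => /=.
have gen l : a [seq v j | j <- l ++ s1 ++ s2 ++ s3] = 0 ->
    a [seq v j | j <- l ++ s2 ++ s1 ++ s3] = 0.
  elim: s1 l {h IH} => [|j s1 IH] l //= h.
  have := move1 (l ++ [::]) j (s2) (s1 ++ s3).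
  rewrite cats0 => h'; apply: h'.
  by have := IH (rcons l j); rewrite !cat_rcons; apply.
by have := gen [:: i] h.
Qed.

Lemma alt_dup (v : 'I_6 -> vec) s : ~~ uniq s -> a [seq v i | i <- s] = 0.
Proof.
have dup : forall s, ~~ uniq s -> exists x s', perm_eq (T := 'I_6) (x :: x :: s') s.
  elim=> [|y {}s IH] //=; rewrite negb_and negbK; case: (boolP (y \in s)) => [ys _|_ /= u].
    by exists y, (rem y s); rewrite perm_cons perm_sym perm_to_rem.
  have [x [s' h]] := IH u; exists x, (y :: s').
  apply: (@perm_trans _ (y :: x :: x :: s')); last by rewrite perm_cons.
  by rewrite (perm_catCA [:: x; x] [:: y] s').
move=> /dup [x [s' h]]; apply: (alt_perm0 h).
by case: ha => _ _ h0; apply: (h0 [::]).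
Qed.

Lemma alt_eq0 (V : 'M[R]_6) : V \in unitmx ->
  (forall I : {set 'I_6}, #|I| = k -> a [seq row i V | i <- enum I] = 0) ->
  a = @fzero R.
Proof.
move=> Vu h0; have basis s : a [seq row i V | i <- s] = 0.
  have [us|] := boolP (uniq s); last exact: alt_dup.
  have [sk|sk] := eqVneq (size s) k; last first.
    by case: ha => h _ _; apply: h; rewrite size_map; apply/eqP.
  apply: (@alt_perm0 _ (enum [set i in s])).
    apply: uniq_perm => //; first exact: enum_uniq.
    by move=> i; rewrite mem_enum inE.
  by apply: h0; rewrite cardsE -sk; apply/card_uniqP.
(* The arguments are expanded one after the other; [l] records the basis indices already chosen. *)
suff gen : forall xs l, a ([seq row i V | i <- l] ++ xs) = 0.
  by apply/funext => xs; rewrite -[xs]/([seq row i V | i <- [::]] ++ xs) gen.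
elim=> [|x xs IH] l; first by rewrite cats0.
have -> : x = \sum_i (x *m invmx V) 0 i *: row i V.
  by rewrite -[LHS](mulmxKV Vu) {1}[x *m invmx V]row_sum_delta mulmx_suml;
     apply: eq_bigr => i _; rewrite -scalemxAl rowE.
rewrite alt_sum big1 // => i _; rewrite altZ.
by have := IH (rcons l i); rewrite map_rcons cat_rcons => ->; rewrite mulr0.
Qed.

End AltTheory.

Lemma altform_sum k (I : finType) (P : pred I) (c : I -> R) (f : I -> form R) :
  (forall i, P i -> altform k (f i)) ->
  altform k (fun xs => \sum_(i | P i) c i * f i xs).
Proof.
move=> h; split=> [xs hs|d l r x y|l r x].
- by rewrite big1 // => i /h [-> //]; rewrite mulr0.
- rewrite mulr_sumr -big_split; apply: eq_bigr => i /h [_ -> _] /=; ring.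
- by rewrite big1 // => i /h [_ _ ->]; rewrite mulr0.
Qed.

Lemma altformD k a b : altform k a -> altform k b -> altform k (fadd a b).
Proof.
case=> a1 a2 a3 [b1 b2 b3]; split=> [xs hs|d l r x y|l r x]; rewrite /fadd.
- by rewrite a1 // b1 // addr0.
- by rewrite a2 b2; ring.
- by rewrite a3 b3 addr0.
Qed.

Lemma altformN k a : altform k a -> altform k (fopp a).
Proof.
case=> a1 a2 a3; split=> [xs hs|d l r x y|l r x]; rewrite /fopp.
- by rewrite a1 // oppr0.
- by rewrite a2; ring.
- by rewrite a3 oppr0.
Qed.

Lemma coform_lin M i c x y : coform M i (c *: x + y) = c * coform M i x + coform M i y.
Proof. by rewrite /coform mulmxDl -scalemxAl !mxE. Qed.

Lemma etaI_altform M (I : {set 'I_6}) : altform #|I| (etaI M I).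
Proof.
(* The transpose has one row per argument, so linearity in an argument is row linearity of the
   determinant. *)
pose Y xs := (\matrix_(b < #|I|, a < #|I|) coform M (nth ord0 (enum I) a) (nth 0 xs b)).
have E xs : size xs = #|I| -> etaI M I xs = \det (Y xs).
  move=> h; rewrite /etaI h eqxx -det_tr; congr (\det _).
  by apply/matrixP => i j; rewrite !mxE.
split=> [xs /eqP/negPf h|c l r x y|l r x]; first by rewrite /etaI h.
  have [h|h] := eqVneq (size l + size r).+1 #|I|; last first.
    by rewrite /etaI !size_cat /= !addnS (negPf h) mulr0 addr0.
  have p : (size l < #|I|)%N by rewrite -h ltnS leq_addr.
  rewrite !E ?size_cat /= ?addnS //.
  rewrite -[\det (Y (l ++ y :: r))]mul1r.
  have nthE z (b : 'I_#|I|) : b != Ordinal p ->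
      nth 0 (l ++ z :: r) b = nth 0 (l ++ 0 :: r) b.
    rewrite -val_eqE /= => hb; rewrite !nth_cat; case: ltnP => // hb'.
    by move: hb'; rewrite leq_eqVlt eq_sym (negPf hb) /= -subn_gt0; case: (b - size l)%N.
  have nthp z : nth 0 (l ++ z :: r) (size l) = z by rewrite nth_cat ltnn subnn.
  apply: (determinant_multilinear (i0 := Ordinal p)).
  - by apply/rowP => j; rewrite !mxE /= !nthp coform_lin mul1r.
  - by apply/matrixP => i j; rewrite !mxE !nthE // eq_sym neq_lift.
  - by apply/matrixP => i j; rewrite !mxE !nthE // eq_sym neq_lift.
have [h|h] := eqVneq (size l + size r).+2 #|I|; last first.
  by rewrite /etaI size_cat /= !addnS (negPf h).
have p : (size l < #|I|)%N by rewrite -h; lia.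
have p1 : ((size l).+1 < #|I|)%N by rewrite -h; lia.
rewrite E ?size_cat /= ?addnS //.
apply: (determinant_alternate (i1 := Ordinal p) (i2 := Ordinal p1)).
  by rewrite -val_eqE /=; lia.
move=> j; rewrite !mxE /= !nth_cat ltnn subnn ltnNge leqnSn /=.
by rewrite subSnn.
Qed.

Lemma etaI_dual M (I J : {set 'I_6}) : M \in unitmx -> #|J| = #|I| ->
  etaI M I [seq row i (invmx M) | i <- enum J] = (I == J)%:R.
Proof.
move=> Mu hJ; rewrite /etaI size_map -cardE hJ eqxx.
have cE i j : coform M i (row j (invmx M)) = (i == j)%:R.
  by rewrite /coform -row_mul mulVmx // rowE mulmx1 !mxE eqxx /=.
have [<-|IJ] := eqVneq I J.
  rewrite (_ : \matrix_(_, _) _ = 1%:M) ?det1 //; apply/matrixP => i j; rewrite !mxE.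
  rewrite (nth_map ord0) -?cardE // cE nth_uniq -?cardE //; exact: enum_uniq.
have /subsetPn [i iI iJ] : ~~ (I \subset J).
  by apply/negP => sIJ; case/eqP: IJ; apply/eqP; rewrite eqEcard sIJ hJ /=.
have hi : (index i (enum I) < #|I|)%N by rewrite cardE index_mem mem_enum.
rewrite (expand_det_row _ (Ordinal hi)) big1 // => j _; rewrite !mxE.
rewrite (nth_map ord0) -?cardE ?hJ // cE /= nth_index ?mem_enum //.
case: eqP => [e|]; last by rewrite mul0r.
by case/negP: iJ; rewrite e -mem_enum mem_nth // -cardE hJ.
Qed.

Lemma alt_expand M k a : M \in unitmx -> altform k a ->
  a = fun xs => \sum_(I : {set 'I_6} | #|I| == k)
        a [seq row i (invmx M) | i <- enum I] * etaI M I xs.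
Proof.
move=> Mu ha; set b := (X in _ = X).
have hb : altform k b.
  by apply: altform_sum => I /eqP <-; apply: etaI_altform.
have h0 : fadd a (fopp b) = @fzero R.
  apply: (@alt_eq0 k _ _ (invmx M)); rewrite ?unitmx_inv //.
    by apply: altformD => //; apply: altformN.
  move=> J hJ; rewrite /fadd /fopp /b (bigD1 J) ?hJ //=.
  rewrite etaI_dual // eqxx mulr1 big1 ?addr0 ?subrr // => I /andP [/eqP hI IJ].
  by rewrite etaI_dual ?hI // (negPf IJ) mulr0.
apply/funext => xs; apply/eqP; rewrite -subr_eq0; apply/eqP.
exact: (congr1 (fun f => f xs) h0).
Qed.

End AltForms.

(** * The Chevalley-Eilenberg differential and the wedge product *)

Section Differential.
Variable R : realType.
Local Notation vec := 'rV[R]_6.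
Implicit Types (a b : form R) (M : 'M[R]_6) (br : vec -> vec -> vec).

Definition rest (xs : seq vec) (i j : nat) : seq vec :=
  [seq nth 0 xs t | t <- iota 0 (size xs) & (t != i) && (t != j)].

Definition dterm br a (xs : seq vec) (i j : nat) : R :=
  (-1) ^+ (i + j) * a (br (nth 0 xs i) (nth 0 xs j) :: rest xs i j).

Lemma dCE_nat br a xs : dCE br a xs =
  \sum_(0 <= i < size xs) \sum_(0 <= j < size xs | (i < j)%N) dterm br a xs i j.
Proof. by rewrite big_mkord; apply: eq_bigr => i _; rewrite big_mkord. Qed.

Lemma size_rest xs i j : (i < j)%N -> (j < size xs)%N -> (size (rest xs i j)).+2 = size xs.
Proof.
move=> ij jn; rewrite size_map size_filter.
have := count_predUI (pred1 i) (pred1 j) (iota 0 (size xs)).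
rewrite !count_uniq_mem ?iota_uniq // !mem_iota !add0n jn (ltn_trans ij jn) /=.
rewrite [X in (_ + X)%N](_ : _ = 0%N); last first.
  rewrite (eq_count (a2 := pred0)) ?count_pred0 // => t /=.
  by apply/negbTE/negP => /andP [/eqP -> /eqP e]; rewrite e ltnn in ij.
have -> : count (fun t => (t != i) && (t != j)) (iota 0 (size xs)) =
    count (predC (predU (pred1 i) (pred1 j))) (iota 0 (size xs)).
  by apply: eq_count => t /=; rewrite negb_or.
have := count_predC (predU (pred1 i) (pred1 j)) (iota 0 (size xs)).
by rewrite size_iota addn0 => h1 h2; rewrite -[RHS]h1 h2.
Qed.

Lemma rest_sym xs i j : rest xs i j = rest xs j i.
Proof. by congr map; apply: eq_filter => t; rewrite andbC. Qed.

(** An adjacent transposition reverses the order of one pair only; this is the reindexing used for d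
    on two equal adjacent arguments. *)
Lemma swap_order (p i j : nat) :
  let s (m : nat) := if m == p then p.+1 else if m == p.+1 then p else m in
  (s i < s j)%N && ~~ ((s i == p) && (s j == p.+1)) = (i < j)%N && ~~ ((i == p) && (j == p.+1)).
Proof.
by move=> /=; case: (i =P p); case: (j =P p); case: (i =P p.+1); case: (j =P p.+1); lia.
Qed.

Section Adjacent.
Variables (br : vec -> vec -> vec) (a : form R) (k : nat).
Hypotheses (hl : altbr br) (ha : altform k a).
Variables (l r : seq vec) (x : vec).
Let xs := l ++ x :: x :: r.
Let p := size l.

Let iotaE : iota 0 (size xs) = iota 0 p ++ p :: p.+1 :: iota p.+2 (size r).
Proof. by rewrite size_cat iotaD add0n. Qed.

Let nthp : nth 0 xs p = x.
Proof. by rewrite nth_cat ltnn subnn. Qed.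

Let nthp1 : nth 0 xs p.+1 = x.
Proof. by rewrite nth_cat ltnNge leqnSn /= subSnn. Qed.

Lemma rest_swap q : q != p -> q != p.+1 -> rest xs p q = rest xs p.+1 q.
Proof.
move=> qp qp1; rewrite /rest iotaE !filter_cat !map_cat /= !eqxx /=.
have -> : (p.+1 == p) = false by lia.
have -> : (p == p.+1) = false by lia.
rewrite eq_sym qp1 eq_sym qp /= nthp nthp1; congr (_ ++ _ :: _); congr map;
  apply: eq_in_filter => t; rewrite mem_iota => h; congr (_ && _); lia.
Qed.

Lemma rest_disjoint z i j : i != p -> i != p.+1 -> j != p -> j != p.+1 ->
  a (z :: rest xs i j) = 0.
Proof.
move=> ip ip1 jp jp1; rewrite /rest iotaE !filter_cat !map_cat /=.
rewrite ![p == _]eq_sym ![p.+1 == _]eq_sym ip ip1 jp jp1 /= nthp nthp1.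
by rewrite -cat_cons; case: ha => _ _ ->.
Qed.

(** The term at (p, p+1) contains [x, x] = 0. Exchanging p and p+1 maps every other term to its
    opposite, those avoiding both positions being zero, so the remaining sum equals its own
    negative. *)
Lemma dCE_adjacent : dCE br a xs = 0.
Proof.
rewrite dCE_nat big_mkord.
under eq_bigr => i _ do rewrite big_mkord.
have hp : (p < size xs)%N by rewrite size_cat /= -/p; lia.
have hp1 : (p.+1 < size xs)%N by rewrite size_cat /= -/p; lia.
pose op := Ordinal hp; pose op1 := Ordinal hp1.
have tv (i : 'I_(size xs)) : tperm op op1 i =
    (if nat_of_ord i == p then p.+1 else if nat_of_ord i == p.+1 then p else i) :> nat.
  case: tpermP => [->|->|/eqP + /eqP]; rewrite /= ?eqxx -?val_eqE //=.
    by case: eqP => // e; lia.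
  by move=> /negPf -> /negPf ->.
rewrite pair_big_dep /= (bigD1 (op, op1)) //=.
rewrite /dterm nthp nthp1 (liexx hl) (alt0 ha [::]) mulr0 add0r.
set S := (X in X = 0); suff : S = - S by move/eqP; rewrite -addr_eq0 -mulr2n mulrn_eq0 => /eqP.
rewrite {1}/S (reindex_inj (h := fun q => (tperm op op1 q.1, tperm op op1 q.2))) /=; last first.
  by move=> [i j] [i' j'] /= [/perm_inj -> /perm_inj ->].
rewrite /S -sumrN; apply: eq_big => [[i j]|[i j] /=].
  by rewrite /= !xpair_eqE -!val_eqE /= !tv swap_order.
rewrite !xpair_eqE -!val_eqE /= !tv.
have [ip|ip] := eqVneq (nat_of_ord i) p; have [jp|jp] := eqVneq (nat_of_ord j) p;
have [ip1|ip1] := eqVneq (nat_of_ord i) p.+1; have [jp1|jp1] := eqVneq (nat_of_ord j) p.+1;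
  try lia; move=> _; rewrite ?ip ?jp ?ip1 ?jp1.
- by rewrite nthp nthp1 rest_swap // !addSn exprS; ring.
- rewrite nthp nthp1 [rest _ _ p]rest_sym [rest _ _ p.+1]rest_sym rest_swap // !addnS exprS; ring.
- by rewrite nthp nthp1 rest_swap // !addSn exprS; ring.
- rewrite nthp nthp1 [rest _ _ p]rest_sym [rest _ _ p.+1]rest_sym rest_swap // !addnS exprS; ring.
- by rewrite !rest_disjoint // !mulr0 oppr0.
Qed.

End Adjacent.

Lemma dCE_altform k br a : altbr br -> altform k a -> altform k.+1 (dCE br a).
Proof.
move=> hl ha; split=> [xs hs|c l r x y|l r x]; last exact: dCE_adjacent hl ha _ _ _.
  rewrite dCE_nat big_nat big1 // => i /andP [_ hi].
  rewrite big_nat_cond big1 // => j /andP [/andP [_ hj] ij].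
  rewrite /dterm; case: ha => -> //; first by rewrite mulr0.
  by rewrite /=; move=> e; apply: hs; rewrite -(size_rest ij hj) e.
(* The arguments as a function of the position, with [z] in the slot under study; that slot lies at
   i, at j, or among the remaining arguments. *)
pose g z t := if t == size l then z else nth 0 (l ++ 0 :: r) t.
pose n := (size l + size r).+1.
have E z : dCE br a (l ++ z :: r) =
    \sum_(0 <= i < n) \sum_(0 <= j < n | (i < j)%N) (-1) ^+ (i + j) *
      a (br (g z i) (g z j) :: [seq g z t | t <- iota 0 n & (t != i) && (t != j)]).
  have sE : size (l ++ z :: r) = n by rewrite size_cat /= addnS.
  have gE t : nth 0 (l ++ z :: r) t = g z t.
    rewrite /g !nth_cat; case: eqP => [->|]; first by rewrite ltnn subnn.
    case: ltnP => // h1 /eqP h2.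
    have : (0 < t - size l)%N by rewrite subn_gt0 ltn_neqAle eq_sym h2.
    by case: (t - size l)%N.
  rewrite dCE_nat sE; apply: eq_bigr => i _; apply: eq_bigr => j _.
  by rewrite /dterm /rest sE !gE; congr (_ * a (_ :: _)); apply: eq_map => t; rewrite gE.
rewrite !E mulr_sumr -big_split; apply: eq_bigr => i _ /=.
rewrite mulr_sumr -big_split; apply: eq_bigr => j ij /=.
suff -> : a (br (g (c *: x + y) i) (g (c *: x + y) j) ::
      [seq g (c *: x + y) t | t <- iota 0 n & (t != i) && (t != j)]) =
    c * a (br (g x i) (g x j) :: [seq g x t | t <- iota 0 n & (t != i) && (t != j)]) +
    a (br (g y i) (g y j) :: [seq g y t | t <- iota 0 n & (t != i) && (t != j)]) by ring.
have gN z z' t : t != size l -> g z t = g z' t by rewrite /g => /negPf ->.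
have gp z : g z (size l) = z by rewrite /g eqxx.
have mapN z z' (s : seq nat) : size l \notin s -> [seq g z t | t <- s] = [seq g z' t | t <- s].
  move=> h; apply/eq_in_map => t ts; apply: gN; apply: contraNneq h => <- //.
have [il|il] := eqVneq i (size l).
  rewrite !(mapN x 0) ?(mapN y 0) ?(mapN (c *: x + y) 0); try by rewrite mem_filter il eqxx.
  have jl : j != size l by rewrite -il gtn_eqF.
  rewrite !(gN _ 0 j) // il !gp (lieDl hl) (lieZl hl).
  by rewrite (altD ha [::]) (altZ ha _ [::]).
have [jl|jl] := eqVneq j (size l).
  rewrite !(mapN x 0) ?(mapN y 0) ?(mapN (c *: x + y) 0);
    try by rewrite mem_filter jl eqxx andbF.
  rewrite !(gN _ 0 i) // jl !gp (lieDr hl) (lieZr hl).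
  by rewrite (altD ha [::]) (altZ ha _ [::]).
rewrite !(gN _ 0 i) // !(gN _ 0 j) //.
have iE : iota 0 n = iota 0 (size l) ++ size l :: iota (size l).+1 (size r).
  by rewrite /n -addnS iotaD add0n.
rewrite iE !filter_cat !map_cat /= ![size l == _]eq_sym il jl /= !gp.
rewrite !(mapN x 0) ?(mapN y 0) ?(mapN (c *: x + y) 0);
  try by rewrite mem_filter mem_iota ?add0n ltnn ?andbF.
by rewrite -!cat_cons (altD ha) (altZ ha).
Qed.

Lemma dCE3E br a x y z : dCE br a [:: x; y; z] =
  - a [:: br x y; z] + a [:: br x z; y] - a [:: br y z; x].
Proof.
rewrite dCE_nat /index_iota /= !big_cons !big_nil /= /dterm /rest /=; ring.
Qed.

Lemma dCE4E br a w x y z : dCE br a [:: w; x; y; z] =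
  - a [:: br w x; y; z] + a [:: br w y; x; z] - a [:: br w z; x; y]
  - a [:: br x y; w; z] + a [:: br x z; w; y] - a [:: br y z; w; x].
Proof.
rewrite dCE_nat /index_iota /= !big_cons !big_nil /= /dterm /rest /=; ring.
Qed.

Lemma dCE2E br a x y : dCE br a [:: x; y] = - a [:: br x y].
Proof.
rewrite dCE_nat /index_iota /= !big_cons !big_nil /= /dterm /rest /=; ring.
Qed.

(** Replaces an enumeration of ordinals by a filter of [iota], which reduces on numerals. *)
Lemma enum_set_nat n (P : pred nat) (T : Type) (g : nat -> T) :
  [seq g (val i) | i <- enum [set i : 'I_n | P i]] = [seq g t | t <- iota 0 n & P t].
Proof.
rewrite /enum_mem -enumT -val_enum_ord filter_map -map_comp; congr map.
by apply: eq_filter => i; rewrite /= inE.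
Qed.

Lemma sum_pair (S : nmodType) (A B : finType) (F : A * B -> S) :
  \sum_p F p = \sum_x \sum_y F (x, y).
Proof. by rewrite pair_bigA; apply: eq_bigr => [[]]. Qed.

(** The exponent of the shuffle sign on a mask; [k] counts the unselected positions passed so
    far. *)
Fixpoint inversions (k : nat) (s : seq bool) : nat :=
  match s with
  | [::] => 0%N
  | true :: s' => Nat.add k (inversions k s')
  | false :: s' => inversions k.+1 s'
  end.

(** Subsets of ['I_5] are parametrised by tuples of five booleans, which turns the sum over sets
    into a computation with ten surviving shuffles. *)
Lemma wedge32E a b x0 x1 x2 x3 x4 : wedge 3 2 a b [:: x0; x1; x2; x3; x4] =
  a [:: x0; x1; x2] * b [:: x3; x4] - a [:: x0; x1; x3] * b [:: x2; x4]
  + a [:: x0; x1; x4] * b [:: x2; x3] + a [:: x0; x2; x3] * b [:: x1; x4]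
  - a [:: x0; x2; x4] * b [:: x1; x3] + a [:: x0; x3; x4] * b [:: x1; x2]
  - a [:: x1; x2; x3] * b [:: x0; x4] + a [:: x1; x2; x4] * b [:: x0; x3]
  - a [:: x1; x3; x4] * b [:: x0; x2] + a [:: x2; x3; x4] * b [:: x0; x1].
Proof.
pose bits (c : bool * bool * bool * bool * bool) :=
  [:: c.1.1.1.1; c.1.1.1.2; c.1.1.2; c.1.2; c.2].
pose P (c : bool * bool * bool * bool * bool) (t : nat) : bool :=
  nth false (bits c) t.
pose f c : {set 'I_5} := [set i : 'I_5 | P c i].
pose ix k (h : (k < 5)%N) := Ordinal h : 'I_5.
have fbij : bijective f.
  exists (fun S : {set 'I_5} => (ix 0 isT \in S, ix 1 isT \in S, ix 2 isT \in S,
                                 ix 3 isT \in S, ix 4 isT \in S)%N).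
    by move=> [[[[c0 c1] c2] c3] c4]; rewrite !inE.
  move=> S; apply/setP => i; rewrite !inE /P /=.
  by case: i => [[|[|[|[|[|i]]]]] hi] //=; congr (_ \in S); apply: val_inj.
have cardf c : #|f c| = foldr (fun (b : bool) n => Nat.add b n) 0%N (bits c).
  rewrite /f -sum1dep_card big_mkcond !big_ord_recl big_ord0 /P /=.
  by case: c => [[[[[] []] []] []] []].
have Cf c : ~: f c = [set i : 'I_5 | ~~ P c i] by apply/setP => i; rewrite !inE.
have sgnf c : shuffle_sign R (f c) = (-1) ^+ inversions 0 (bits c).
  rewrite /shuffle_sign; congr (_ ^+ _); rewrite -sum1dep_card big_mkcond.
  transitivity (\sum_(i < 5) \sum_(j < 5) ([&& P c i, ~~ P c j & (j < i)%N] : nat))%N.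
    rewrite pair_bigA; apply: eq_bigr => st _; rewrite !inE.
    by case: [&& _, _ & _].
  rewrite !big_ord_recl !big_ord0 /P /=.
  by case: c => [[[[[] []] []] []] []].
rewrite /wedge /= (reindex f) /=; last exact: onW_bij.
rewrite big_mkcond.
under eq_bigr => c _ do rewrite cardf sgnf Cf
  (enum_set_nat 5 (P c) (nth 0 [:: x0; x1; x2; x3; x4]))
  (enum_set_nat 5 (fun t => ~~ P c t) (nth 0 [:: x0; x1; x2; x3; x4])).
rewrite sum_pair; under eq_bigr => c4 _ do rewrite big_bool /=.
rewrite !sum_pair !big_bool /=.
by rewrite /P /=; ring.
Qed.

End Differential.

(** * Coordinate formulas for SU(3)-structures *)

Section SU3.
Variable R : realType.
Local Notation vec := 'rV[R]_6.
Implicit Types (a b : form R) (M : 'M[R]_6) (br : vec -> vec -> vec).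

Lemma wedge32_altform a b : altform 3 a -> altform 2 b -> altform 5 (wedge 3 2 a b).
Proof.
move=> ha hb.
have out xs : size xs <> 5%N -> wedge 3 2 a b xs = 0.
  by move=> /eqP/negPf h; rewrite /wedge h.
have [_ la na] := ha; have [_ lb nb] := hb.
have a1 c x y u v := la c [::] [:: u; v] x y.
have a2 c x y u v := la c [:: u] [:: v] x y.
have a3 c x y u v := la c [:: u; v] [::] x y.
have b1 c x y u := lb c [::] [:: u] x y.
have b2 c x y u := lb c [:: u] [::] x y.
have n1 x u := na [::] [:: u] x.
have n2 x u := na [:: u] [::] x.
have n3 x := nb [::] [::] x.
rewrite /= in a1 a2 a3 b1 b2 n1 n2 n3.
split=> // [c l r x y|l r x].
  have [h|/eqP h] := eqVneq (size l + size r)%N 4%N; last first.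
    by rewrite !out ?mulr0 ?addr0 // size_cat /= addnS => - [].
  move: l r h => [|l0 [|l1 [|l2 [|l3 [|l4 l]]]]] [|r0 [|r1 [|r2 [|r3 [|r4 r]]]]] //= _;
    rewrite !wedge32E ?a1 ?a2 ?a3 ?b1 ?b2; ring.
have [h|/eqP h] := eqVneq (size l + size r)%N 3%N; last first.
  by rewrite out // size_cat /= !addnS => - [].
move: l r h => [|l0 [|l1 [|l2 [|l3 l]]]] [|r0 [|r1 [|r2 [|r3 r]]]] //= _;
  rewrite wedge32E ?n1 ?n2 ?n3; ring.
Qed.

Definition cf M x (i : nat) : R := coform M (inord i) x.

Lemma etaI_list M (P : pred nat) s xs :
  [seq t <- iota 0 6 | P t] = s ->
  etaI M [set i : 'I_6 | P i] xs =
  if size xs == size s then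
    \det (\matrix_(i < size s, j < size s) cf M (nth 0 xs j) (nth 0%N s i)) else 0.
Proof.
move=> hs; have E : enum [set i : 'I_6 | P i] = [seq inord t | t <- s].
  rewrite -hs -(enum_set_nat 6 P inord) -[LHS]map_id.
  by apply: eq_map => i; rewrite inord_val.
rewrite /etaI cardE E size_map; case: eqP => // h; congr (\det _).
by apply/matrixP => i j; rewrite !mxE /cf (nth_map 0%N).
Qed.

Lemma det_mx22 (A : 'M[R]_2) : \det A = A 0 0 * A 1 1 - A 0 1 * A 1 0.
Proof.
rewrite (expand_det_row _ 0) !big_ord_recl big_ord0 /cofactor !det_mx11 !mxE /=.
have -> : lift 0 0 = 1 :> 'I_2 by apply/val_inj.
have -> : lift 1 0 = 0 :> 'I_2 by apply/val_inj.
by rewrite /=; ring.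
Qed.

Lemma det_mx33 (A : 'M[R]_3) : \det A =
  A 0 0 * (A 1 1 * A 2 2 - A 1 2 * A 2 1) - A 0 1 * (A 1 0 * A 2 2 - A 1 2 * A 2 0)
  + A 0 2 * (A 1 0 * A 2 1 - A 1 1 * A 2 0).
Proof.
rewrite (expand_det_row _ 0) !big_ord_recl big_ord0 /cofactor !det_mx22 !mxE /=.
have e1 : lift 0 0 = 1 :> 'I_3 by apply/val_inj.
have e2 : lift 0 1 = 2 :> 'I_3 by apply/val_inj.
have e2' : lift 0 (lift 0 0) = 2 :> 'I_3 by apply/val_inj.
have e3 : lift 1 0 = 0 :> 'I_3 by apply/val_inj.
have e4 : lift 1 1 = 2 :> 'I_3 by apply/val_inj.
have e5 : lift 2 0 = 0 :> 'I_3 by apply/val_inj.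
have e6 : lift 2 1 = 1 :> 'I_3 by apply/val_inj.
by rewrite ?e1 ?e2 ?e2' ?e1 ?e2 ?e3 ?e4 ?e5 ?e6 /=; ring.
Qed.

Lemma eta2E M i j x y : [seq t <- iota 0 6 | (t == i) || (t == j)] = [:: i; j] ->
  eta2 M i j [:: x; y] = cf M x i * cf M y j - cf M x j * cf M y i.
Proof.
move=> h; have /and3P [i6 j6 _] : all (fun t => t < 6)%N [:: i; j].
  by rewrite -h; apply/allP => t; rewrite mem_filter mem_iota => /andP [_].
have -> : eta2 M i j = etaI M [set t : 'I_6 | (t == i :> nat) || (t == j :> nat)].
  by congr (etaI M _); apply/setP => t; rewrite !inE -!val_eqE /= !inordK.
rewrite (etaI_list (P := fun t => (t == i) || (t == j)) _ _ h) /= det_mx22 !mxE /=; ring.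
Qed.

Lemma eta3E M i j k x y z :
  [seq t <- iota 0 6 | [|| t == i, t == j | t == k]] = [:: i; j; k] ->
  eta3 M i j k [:: x; y; z] =
    cf M x i * (cf M y j * cf M z k - cf M z j * cf M y k)
    - cf M y i * (cf M x j * cf M z k - cf M z j * cf M x k)
    + cf M z i * (cf M x j * cf M y k - cf M y j * cf M x k).
Proof.
move=> h; have /and4P [i6 j6 k6 _] : all (fun t => t < 6)%N [:: i; j; k].
  by rewrite -h; apply/allP => t; rewrite mem_filter mem_iota => /andP [_].
have -> : eta3 M i j k =
    etaI M [set t : 'I_6 | [|| t == i :> nat, t == j :> nat | t == k :> nat]].
  by congr (etaI M _); apply/setP => t; rewrite !inE -!val_eqE /= !inordK // orbA.
rewrite (etaI_list (P := fun t => [|| t == i, t == j | t == k]) _ _ h) /=.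
by rewrite det_mx33 !mxE /=; ring.
Qed.

Definition omegaM M : form R := fadd (eta2 M 0 1) (fadd (eta2 M 2 3) (eta2 M 4 5)).
Definition psiM M : form R := fadd (eta3 M 0 2 4)
  (fadd (fopp (eta3 M 0 3 5)) (fadd (fopp (eta3 M 1 2 5)) (fopp (eta3 M 1 3 4)))).

Definition omega0 (u v : nat -> R) : R :=
  (u 0 * v 1 - u 1 * v 0) + (u 2 * v 3 - u 3 * v 2) + (u 4 * v 5 - u 5 * v 4).
Definition vol3 (i j k : nat) (u v w : nat -> R) : R :=
  u i * (v j * w k - w j * v k) - v i * (u j * w k - w j * u k)
  + w i * (u j * v k - v j * u k).
Definition psi0 (u v w : nat -> R) : R :=
  vol3 0 2 4 u v w - vol3 0 3 5 u v w - vol3 1 2 5 u v w - vol3 1 3 4 u v w.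

Lemma omegaME M x y : omegaM M [:: x; y] = omega0 (cf M x) (cf M y).
Proof. by rewrite /omegaM /fadd !eta2E // /omega0; ring. Qed.

Lemma psiME M x y z : psiM M [:: x; y; z] = psi0 (cf M x) (cf M y) (cf M z).
Proof. by rewrite /psiM /fadd /fopp !eta3E // /psi0 /vol3; ring. Qed.

Lemma card_set3 (i j k : nat) : uniq [:: i; j; k] -> all (fun t => t < 6)%N [:: i; j; k] ->
  #|[set (inord i : 'I_6); inord j; inord k]| = 3%N.
Proof.
rewrite /= !inE andbT => /andP [/norP [ij ik] jk] /and4P [i6 j6 k6 _].
rewrite setUC cardsU1 cards2 !inE -!val_eqE /= !inordK //.
by rewrite eq_sym (negPf ik) eq_sym (negPf jk) (negPf ij).
Qed.

Lemma eta2_altform M (i j : nat) : i != j -> (i < 6)%N -> (j < 6)%N -> altform 2 (eta2 M i j).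
Proof.
move=> ij i6 j6; have <- : #|[set (inord i : 'I_6); inord j]| = 2%N.
  by rewrite cards2 -val_eqE /= !inordK // ij.
exact: etaI_altform.
Qed.

Lemma eta3_altform M (i j k : nat) : uniq [:: i; j; k] ->
  all (fun t => t < 6)%N [:: i; j; k] -> altform 3 (eta3 M i j k).
Proof. by move=> u l; rewrite -(card_set3 u l); apply: etaI_altform. Qed.

Lemma omegaM_altform M : altform 2 (omegaM M).
Proof. by do ![apply: altformD]; apply: eta2_altform. Qed.

Lemma psiM_altform M : altform 3 (psiM M).
Proof. by do ![apply: altformD]; do ?[apply: altformN]; apply: eta3_altform. Qed.

End SU3.

(** * Half-flat structures *)

Section HalfFlat.
Variable R : realType.
Local Notation vec := 'rV[R]_6.
Implicit Types (a b : form R) (M : 'M[R]_6) (br : vec -> vec -> vec).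

(** The frame dual to the coframe [M]. *)
Definition fr M (k : nat) : vec := row (inord k) (invmx M).

(** The sum is the trace of ad x. *)
Definition unimodular br : Prop := forall x, \sum_(i < 6) br x (delta_mx 0 i) 0 i = 0.

(** Index sets are boolean masks of [iota 0 6], so that case analysis on six booleans leaves exactly
    the concrete tuples of frame vectors. *)
Lemma alt_eq0_frame k a M : M \in unitmx -> altform k a ->
  (forall b0 b1 b2 b3 b4 b5 : bool, let s := mask [:: b0; b1; b2; b3; b4; b5] (iota 0 6) in
     size s = k -> a [seq fr M t | t <- s] = 0) ->
  a = @fzero R.
Proof.
move=> Mu ha h; apply: (alt_eq0 ha (V := invmx M)); rewrite ?unitmx_inv // => I hI.
pose P (t : nat) := (inord t : 'I_6) \in I.
have IE : I = [set i : 'I_6 | P i] by apply/setP => i; rewrite inE /P inord_val.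
have E : [seq row i (invmx M) | i <- enum I] = [seq fr M t | t <- iota 0 6 & P t].
  rewrite [in LHS]IE -(enum_set_nat 6 P (fr M)); apply: eq_map => i.
  by rewrite /fr inord_val.
rewrite E filter_mask; apply: (h (P 0%N) (P 1%N) (P 2%N) (P 3%N) (P 4%N) (P 5%N)).
have := congr1 size E; rewrite !size_map -cardE hI => ->.
by rewrite filter_mask.
Qed.

Section Frame.
Variables (br : vec -> vec -> vec) (M : 'M[R]_6).
Hypotheses (hl : altbr br) (Mu : M \in unitmx).
Local Notation v := (fr M).

Lemma cf_fr k j : (k < 6)%N -> (j < 6)%N -> cf M (v k) j = (k == j)%:R.
Proof.
move=> hk hj; rewrite /cf /coform /fr -row_mul mulVmx // rowE mulmx1 mxE eqxx /=.
by rewrite -val_eqE /= !inordK // eq_sym.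
Qed.

Lemma frame_expand x : x = \sum_(i < 6) cf M x i *: v i.
Proof.
rewrite -[LHS](mulmxK Mu) {1}[x *m M]row_sum_delta mulmx_suml; apply: eq_bigr => i _.
by rewrite -scalemxAl -rowE /cf /coform /fr inord_val.
Qed.

Lemma cfD x y k : cf M (x + y) k = cf M x k + cf M y k.
Proof. by rewrite /cf /coform mulmxDl mxE. Qed.

Lemma cfN x k : cf M (- x) k = - cf M x k.
Proof. by rewrite /cf /coform mulNmx mxE. Qed.

Lemma cfZ c x k : cf M (c *: x) k = c * cf M x k.
Proof. by rewrite /cf /coform -scalemxAl mxE. Qed.

Lemma cf0 k : cf M 0 k = 0.
Proof. by rewrite /cf /coform mul0mx mxE. Qed.

Lemma cf_eq0 x : (forall k, (k < 6)%N -> cf M x k = 0) -> x = 0.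
Proof. by move=> h; rewrite (frame_expand x) big1 // => i _; rewrite h ?scale0r. Qed.

Lemma trace_frame x : unimodular br -> \sum_(i < 6) cf M (br x (v i)) i = 0.
Proof.
move=> hu; pose A := \matrix_(i < 6) br x (delta_mx 0 i).
have brA y : br x y = y *m A.
  rewrite {1}[y]row_sum_delta (lie_sumr hl) mulmx_sum_row; apply: eq_bigr => i _.
  by rewrite (lieZr hl) rowK.
transitivity (\tr (invmx M *m A *m M)).
  apply: eq_bigr => i _; rewrite /cf /coform /fr brA inord_val -!row_mul.
  by rewrite mxE.
rewrite -mulmxA mxtrace_mulC -mulmxA mulmxV // mulmx1 -[RHS](hu x).
by apply: eq_bigr => i _; rewrite mxE.
Qed.

Definition sc (i j k : nat) : R := cf M (br (v i) (v j)) k.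

Lemma scC i j k : sc i j k = - sc j i k.
Proof. by rewrite /sc (lieC hl) cfN. Qed.

Lemma sc_diag i k : sc i i k = 0.
Proof. by rewrite /sc (liexx hl) cf0. Qed.

Lemma omega_fr x :
  (omegaM M [:: x; v 0] = - cf M x 1) * (omegaM M [:: x; v 1] = cf M x 0) *
  (omegaM M [:: x; v 2] = - cf M x 3) * (omegaM M [:: x; v 3] = cf M x 2) *
  (omegaM M [:: x; v 4] = - cf M x 5) * (omegaM M [:: x; v 5] = cf M x 4).
Proof. by do !split; rewrite omegaME /omega0 !cf_fr //=; ring. Qed.

(* The coefficients of d(omega) /\ omega = d(omega^2)/2 are those of the contraction of the
   bracket with the bivector dual to omega, up to traces of adjoint maps. *)
Lemma domega_omegaP : unimodular br ->
  wedge 3 2 (dCE br (omegaM M)) (omegaM M) = @fzero R <->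
  br (v 0) (v 1) + br (v 2) (v 3) + br (v 4) (v 5) = 0.
Proof.
move=> hu.
have tr i : sc i 0 0 + sc i 1 1 + sc i 2 2 + sc i 3 3 + sc i 4 4 + sc i 5 5 = 0.
  by have := trace_frame (v i) hu; rewrite !big_ord_recl big_ord0 /= addr0 !addrA.
have := (tr 0, tr 1, tr 2, tr 3, tr 4, tr 5)%N.
rewrite !sc_diag (scC 1 0) (scC 2 0) (scC 2 1) (scC 3 0) (scC 3 1) (scC 3 2)
  (scC 4 0) (scC 4 1) (scC 4 2) (scC 4 3) (scC 5 0) (scC 5 1) (scC 5 2) (scC 5 3) (scC 5 4).
move=> [[[[[t0 t1] t2] t3] t4] t5].
split=> [h|h].
  apply: cf_eq0 => k hk; rewrite !cfD -!/(sc _ _ _).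
  have w xs : wedge 3 2 (dCE br (omegaM M)) (omegaM M) xs = 0 by rewrite h.
  (* The tuple omitting v k yields the k-th component, up to the trace of ad of the partner of v k
     under omega. *)
  have e0 := w [:: v 1; v 2; v 3; v 4; v 5]; have e1 := w [:: v 0; v 2; v 3; v 4; v 5].
  have e2 := w [:: v 0; v 1; v 3; v 4; v 5]; have e3 := w [:: v 0; v 1; v 2; v 4; v 5].
  have e4 := w [:: v 0; v 1; v 2; v 3; v 5]; have e5 := w [:: v 0; v 1; v 2; v 3; v 4].
  move: e0 e1 e2 e3 e4 e5; rewrite !wedge32E !dCE3E !omega_fr !cf_fr //= -!/(sc _ _ _).
  move=> e0 e1 e2 e3 e4 e5.
  case: k hk => [|[|[|[|[|[|k]]]]]] // _.
  - by clear -e0 t1; lra.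
  - by clear -e1 t0; lra.
  - by clear -e2 t3; lra.
  - by clear -e3 t2; lra.
  - by clear -e4 t5; lra.
  - by clear -e5 t4; lra.
have p k : sc 0 1 k + sc 2 3 k + sc 4 5 k = 0 by rewrite /sc -!cfD h cf0.
have := (p 0, p 1, p 2, p 3, p 4, p 5)%N => - [[[[[p0 p1] p2] p3] p4] p5].
apply: (alt_eq0_frame Mu) (wedge32_altform (dCE_altform hl (omegaM_altform M))
  (omegaM_altform M)) _.
do 6 case=> //; rewrite /= => // _;
  rewrite wedge32E !dCE3E !omega_fr !cf_fr //= -!/(sc _ _ _);
  [clear -p5 t4|clear -p4 t5|clear -p3 t2|clear -p2 t3|clear -p1 t0|clear -p0 t1]; lra.
Qed.

End Frame.

End HalfFlat.

(** * Coherent splittings *)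

Section Splittings.
Variable R : realType.
Local Notation vec := 'rV[R]_6.
Implicit Types (a b : form R) (M A : 'M[R]_6) (br : vec -> vec -> vec).

Lemma cf_sum M I (r : seq I) (P : pred I) (F : I -> vec) k :
  cf M (\sum_(i <- r | P i) F i) k = \sum_(i <- r | P i) cf M (F i) k.
Proof. by apply: (big_morph (fun x => cf M x k)) => [x y|]; rewrite ?cfD ?cf0. Qed.

Definition pull A a : form R := fun xs => a [seq x *m A | x <- xs].

Lemma nth_mapmx A (xs : seq vec) i : nth 0 [seq x *m A | x <- xs] i = nth 0 xs i *m A.
Proof.
case: (ltnP i (size xs)) => h; first by rewrite (nth_map 0).
by rewrite !nth_default ?size_map // mul0mx.
Qed.

Lemma dCE_pull br1 br2 A a :
  (forall x y, br2 (x *m A) (y *m A) = br1 x y *m A) ->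
  pull A (dCE br2 a) = dCE br1 (pull A a).
Proof.
move=> h; apply/funext => xs; rewrite /pull !dCE_nat size_map.
apply: eq_bigr => i _; apply: eq_bigr => j _; rewrite /dterm !nth_mapmx h /=.
congr (_ * a (_ :: _)); rewrite /rest size_map -map_comp; apply: eq_map => t.
exact: nth_mapmx.
Qed.

Lemma wedge_pull p q A a b : pull A (wedge p q a b) = wedge p q (pull A a) (pull A b).
Proof.
apply/funext => xs; rewrite /pull /wedge size_map; case: eqP => // _.
apply: eq_bigr => S _; rewrite -!map_comp.
by congr (_ * a _ * b _); apply: eq_map => i /=; rewrite nth_mapmx.
Qed.

Lemma etaI_pull A M I : pull A (etaI M I) = etaI (A *m M) I.
Proof.
apply/funext => xs; rewrite /pull /etaI size_map; case: eqP => // _; congr (\det _).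
by apply/matrixP => i j; rewrite !mxE nth_mapmx /coform mulmxA.
Qed.

Lemma altform_pull k A a : altform k a -> altform k (pull A a).
Proof.
case=> h1 h2 h3; rewrite /pull; split=> [xs hs|c l r x y|l r x].
- by apply: h1; rewrite size_map.
- by rewrite !map_cat /= mulmxDl -scalemxAl h2.
- by rewrite map_cat /= h3.
Qed.

Lemma has_half_flat_iso br1 br2 : iso br1 br2 -> has_half_flat br2 -> has_half_flat br1.
Proof.
case=> A [Au h] [om [ps [[M [Mu [-> ->]]] h1 h2]]].
exists (pull A (omegaM M)), (pull A (psiM M)); split.
- exists (A *m M); rewrite unitmx_mul Au Mu; split=> //.
  by rewrite /omegaM /psiM /eta2 /eta3 -!etaI_pull.
- by rewrite -(dCE_pull _ h) -wedge_pull h1.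
- by rewrite -(dCE_pull _ h) h2.
Qed.

Lemma etaI_row0 M (I : {set 'I_6}) i (xs : seq vec) : i \in I ->
  (forall x, x \in xs -> coform M i x = 0) -> etaI M I xs = 0.
Proof.
move=> iI h; rewrite /etaI; case: eqP => // hs.
have hi : (index i (enum I) < #|I|)%N by rewrite cardE index_mem mem_enum.
rewrite (expand_det_row _ (Ordinal hi)) big1 // => j _; rewrite mxE /=.
by rewrite nth_index ?mem_enum // h ?mul0r // mem_nth // hs.
Qed.

Lemma etaI_col0 M (I : {set 'I_6}) (x : vec) (xs : seq vec) : x \in xs ->
  (forall i, i \in I -> coform M i x = 0) -> etaI M I xs = 0.
Proof.
move=> xx h; rewrite /etaI; case: eqP => // hs.
have hi : (index x xs < #|I|)%N by rewrite -hs index_mem.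
rewrite (expand_det_col _ (Ordinal hi)) big1 // => j _; rewrite mxE /=.
by rewrite nth_index // h ?mul0r // -mem_enum mem_nth // -cardE.
Qed.

(** Membership in W, the common kernel of the first two forms of the coframe, which span V1. *)
Definition inW M (x : vec) : Prop := cf M x 0 = 0 /\ cf M x 1 = 0.

Definition adapted br M : Prop :=
  [/\ M \in unitmx, (forall x y, inW M (br x y)) &
      (forall x y, inW M x -> inW M y -> br x y = 0)].

Lemma inW_S1 M x i : inW M x -> i \in S1 -> coform M i x = 0.
Proof.
move=> [h0 h1]; rewrite inE => hi.
by case: i hi => [[|[|i]] hi] // _; [rewrite -h0|rewrite -h1]; congr (coform M _ x);
   apply/val_inj; rewrite /= inordK.
Qed.

Lemma inF_altform M k p a : inF M k p a -> altform k a.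
Proof.
by case=> c ->; apply: altform_sum => I /andP [/eqP <- _]; apply: etaI_altform.
Qed.

Lemma inLam_altform M p q a : inLam M p q a -> altform (p + q) a.
Proof.
case=> c ->; apply: altform_sum => I /andP [/eqP <- /eqP <-].
by rewrite cardsID; apply: etaI_altform.
Qed.

(** Forms in F^3_1 vanish on W, and so do exact 3-forms, because each term of dc contains a bracket
    of two arguments and W is abelian. *)
Lemma hpq_nonzeroI br M a x y z : altbr br -> adapted br M -> altform 3 a ->
  dCE br a = @fzero R -> inW M x -> inW M y -> inW M z -> a [:: x; y; z] != 0 ->
  hpq_nonzero br M 0 3.
Proof.
move=> hl [Mu _ hW] ha da hx hy hz /eqP a0; exists a; split=> //.
  exists (fun I : {set 'I_6} => a [seq row i (invmx M) | i <- enum I]).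
  by rewrite {1}(alt_expand Mu ha); apply/funext => xs; apply: eq_bigl => I; rewrite andbT.
case=> b [c [[d ->] _ /inF_altform hc e]]; apply: a0; rewrite e /fadd.
rewrite dCE3E (hW _ _ hx hy) (hW _ _ hx hz) (hW _ _ hy hz) !(alt0 hc [::]) oppr0 !addr0.
apply: big1 => I /andP [_]; rewrite card_gt0 => /set0Pn [i]; rewrite inE => /andP [iI iS].
rewrite (etaI_row0 iI) ?mulr0 // => u; rewrite !inE.
by case/or3P => /eqP ->; apply: inW_S1.
Qed.

Lemma fr_inW M k : M \in unitmx -> (1 < k < 6)%N -> inW M (fr M k).
Proof. by move=> Mu /andP [h1 h2]; split; rewrite cf_fr // gtn_eqF // ltnW. Qed.

(** A 3-form vanishing on W already lies in F^3_1, so [a] serves as its own representative, with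
    exact part 0. *)
Lemma hpq_zero br M : M \in unitmx ->
  (forall a, altform 3 a -> dCE br a = @fzero R -> forall x y z,
     inW M x -> inW M y -> inW M z -> a [:: x; y; z] = 0) ->
  ~ hpq_nonzero br M 0 3.
Proof.
move=> Mu h [a [/inF_altform ha da []]]; exists a, (@fzero R); split=> //.
- exists (fun I : {set 'I_6} => a [seq row i (invmx M) | i <- enum I]).
  rewrite {1}(alt_expand Mu ha); apply/funext => xs.
  rewrite (bigID (fun I : {set 'I_6} => (0 < #|I :&: S1|)%N)) /= [X in _ + X]big1 ?addr0 //.
  move=> I /andP [/eqP hI]; rewrite -eqn0Ngt cards_eq0 => /eqP I0.
  have iW i : i \in I -> inW M (row i (invmx M)).
    move=> iI; rewrite -[i]inord_val; apply: fr_inW => //; rewrite ltn_ord andbT ltnNge.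
    apply/negP => i2; have : i \in I :&: S1 by rewrite inE iI inE ltnS.
    by rewrite I0 inE.
  move: hI; rewrite cardE; have := iW; rewrite /= => iW'.
  have mI i : i \in enum I -> inW M (row i (invmx M)) by rewrite mem_enum; apply: iW.
  case: (enum I) mI => [|i0 [|i1 [|i2 [|i3 s]]]] // mI _ /=.
  by rewrite h ?mul0r //; apply: mI; rewrite !inE eqxx ?orbT.
- by exists (fun=> 0); apply/funext => xs; rewrite big1 // => I _; rewrite mul0r.
- apply/funext => xs; rewrite /fadd [dCE _ _ _]big1 ?addr0 // => i _.
  by rewrite big1 // => j _; rewrite mulr0.
Qed.

(** * Weights of forms under the dilation along V1 *)

Section Scaling.
Variable M : 'M[R]_6.
Hypothesis Mu : M \in unitmx.

(* Projection onto V1^* = span(v_0, v_1) along W, and the dilation by 2 of V1^*: a form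
   lies in Lambda^{p,q} exactly when the dilation multiplies it by 2^p. *)
Definition projU : 'M[R]_6 := M *m pid_mx 2 *m invmx M.
Definition dil : 'M[R]_6 := 1%:M + projU.

Lemma cf_projU x k : (k < 6)%N -> cf M (x *m projU) k = if (k < 2)%N then cf M x k else 0.
Proof.
move=> hk; rewrite /cf /coform /projU !mulmxA mulmxKV // mxE (bigD1 (inord k)) //=.
rewrite big1 ?addr0; last first.
  move=> j jk; rewrite [pid_mx _ _ _]mxE (_ : (j == inord k :> nat) = false) ?mulr0 //.
  by apply/eqP => /val_inj e; rewrite e eqxx in jk.
by rewrite [pid_mx _ _ _]mxE eqxx inordK //=; case: ifP => _; rewrite ?mulr1 ?mulr0.
Qed.

Lemma projU_id (x : vec) : x *m projU *m projU = x *m projU.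
Proof.
by rewrite /projU !mulmxA mulmxKV // -[_ *m pid_mx 2 *m pid_mx 2]mulmxA pid_mx_id.
Qed.

Lemma inW_projU x : inW M x <-> x *m projU = 0.
Proof.
split=> [[h0 h1]|h]; last first.
  have e0 := @cf_projU x 0 isT; have e1 := @cf_projU x 1 isT.
  by rewrite h !cf0 /= in e0 e1; split.
apply: (cf_eq0 Mu) => k hk; rewrite cf_projU //.
by case: k hk => [|[|k]].
Qed.

Lemma inW_sub_projU (x : vec) : inW M (x - x *m projU).
Proof. by apply/inW_projU; rewrite mulmxBl projU_id subrr. Qed.

Lemma mul_dil (x : vec) : x *m dil = x + x *m projU.
Proof. by rewrite mulmxDr mulmx1. Qed.

Lemma etaI_dil I xs : etaI M I [seq x *m dil | x <- xs] = 2 ^+ #|I :&: S1| * etaI M I xs.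
Proof.
rewrite /etaI size_map; case: eqP => hs; last by rewrite mulr0.
pose d (i : 'I_6) : R := if i \in S1 then 2 else 1.
have cd i x : coform M i (x *m dil) = d i * coform M i x.
  have := @cf_projU x i (ltn_ord i); rewrite /cf inord_val => e.
  rewrite mul_dil /coform mulmxDl mxE -!/(coform M i _) e /d inE.
  by case: ifP => _; ring.
transitivity (\det (diag_mx (\row_(k < #|I|) d (nth ord0 (enum I) k)) *m
    \matrix_(i < #|I|, j < #|I|) coform M (nth ord0 (enum I) i) (nth 0 xs j))).
  congr (\det _); apply/matrixP => i j; rewrite mul_diag_mx !mxE nth_mapmx.
  exact: cd.
rewrite det_mulmx det_diag; congr (_ * _).
transitivity (\prod_(i in I) d i).
  under eq_bigr => k _ do rewrite mxE.
  by rewrite -[RHS]big_enum /= (big_nth ord0) big_mkord -cardE.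
by rewrite -prodr_const -big_mkcondr; apply: eq_bigl => i; rewrite in_setI.
Qed.

Lemma inLam_dil p q a xs : inLam M p q a -> a [seq x *m dil | x <- xs] = 2 ^+ p * a xs.
Proof.
case=> c ->; rewrite mulr_sumr; apply: eq_bigr => I /andP [/eqP <- _].
by rewrite etaI_dil; ring.
Qed.

Lemma alt_scale k a (d : 'I_6 -> R) (v : 'I_6 -> vec) s : altform k a ->
  a [seq d i *: v i | i <- s] = (\prod_(i <- s) d i) * a [seq v i | i <- s].
Proof.
move=> ha; suff gen l : a (l ++ [seq d i *: v i | i <- s]) =
    (\prod_(i <- s) d i) * a (l ++ [seq v i | i <- s]) by apply: (gen [::]).
elim: s l => [|i s IH] l /=; first by rewrite big_nil mul1r.
by rewrite (altZ ha) -cat_rcons IH cat_rcons big_cons mulrA.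
Qed.

(** On the frame vectors of [J] the dilation acts by 2 to the power |J :&: S1|; two different powers
    of 2 leave only the value 0. *)
Lemma dil_coef0 k p b (J : {set 'I_6}) : altform k b ->
  (forall xs, b [seq x *m dil | x <- xs] = 2 ^+ p * b xs) -> #|J :&: S1| != p ->
  b [seq row i (invmx M) | i <- enum J] = 0.
Proof.
move=> hb h hJ; pose d (i : 'I_6) : R := if i \in S1 then 2 else 1.
have rd i : row i (invmx M) *m dil = d i *: row i (invmx M).
  apply/eqP; rewrite -subr_eq0; apply/eqP; apply: (cf_eq0 Mu) => m hm.
  have -> : row i (invmx M) = fr M i by rewrite /fr inord_val.
  rewrite cfD cfN cfZ mul_dil cfD cf_projU // !cf_fr // /d inE.
  by case: eqP => [->|_]; case: ifP => _; rewrite /=; ring.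
have := h [seq row i (invmx M) | i <- enum J].
rewrite -map_comp (eq_map rd) (alt_scale _ _ _ hb).
have -> : \prod_(i <- enum J) d i = 2 ^+ #|J :&: S1|.
  rewrite big_enum /= -prodr_const -big_mkcondr.
  by apply: eq_bigl => i; rewrite in_setI.
move=> /eqP; rewrite -subr_eq0 -mulrBl mulf_eq0 subr_eq0 => /orP [|/eqP //].
by move/eqP/(@ieexprIn R 2 (ltr0n _ 2) _) => e; rewrite e ?eqxx // ?pnatr_eq1 in hJ.
Qed.

Lemma dil_inLam p q b : altform (p + q) b ->
  (forall xs, b [seq x *m dil | x <- xs] = 2 ^+ p * b xs) -> inLam M p q b.
Proof.
move=> hb h; exists (fun I : {set 'I_6} => b [seq row i (invmx M) | i <- enum I]).
rewrite {1}(alt_expand Mu hb); apply/funext => xs.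
rewrite (bigID (fun I : {set 'I_6} => #|I :&: S1| == p)) /= [X in _ + X]big1 ?addr0.
  apply: eq_bigl => I; rewrite -(cardsID S1 I) andbC.
  by case: eqP => //= ->; rewrite eqn_add2l.
by move=> I /andP [_ hI]; rewrite (dil_coef0 hb h hI) mul0r.
Qed.

(** The weights occurring in degree k are at most k. *)
Lemma dil_eq0 k p b : altform k b -> (k < p)%N ->
  (forall xs, b [seq x *m dil | x <- xs] = 2 ^+ p * b xs) -> b = @fzero R.
Proof.
move=> hb kp h; rewrite (alt_expand Mu hb); apply/funext => xs.
apply: big1 => I /eqP hI; rewrite (dil_coef0 hb h) ?mul0r //.
by rewrite ltn_eqF // (leq_ltn_trans _ kp) // -hI subset_leq_card // subsetIl.
Qed.

(** A bracket with values fixed by the dilation, and multiplied by [s] when its arguments are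
    dilated, has a differential multiplying weights by [s]. *)
Lemma dCE_dil k br a (s c : R) xs : altform k a ->
  (forall x y, br (x *m dil) (y *m dil) = s *: br x y) ->
  (forall x y, br x y *m dil = br x y) ->
  (forall ys, a [seq x *m dil | x <- ys] = c * a ys) ->
  dCE br a [seq x *m dil | x <- xs] = s * c * dCE br a xs.
Proof.
move=> ha h1 h2 h3.
have e := @dCE_pull (fun x y => s *: br x y) br dil a.
have {}e : pull dil (dCE br a) = dCE (fun x y => s *: br x y) (pull dil a).
  by apply: e => x y; rewrite h1 -scalemxAl h2.
have := congr1 (fun f => f xs) e; rewrite {1}/pull => ->.
rewrite !dCE_nat mulr_sumr; apply: eq_bigr => i _; rewrite mulr_sumr; apply: eq_bigr => j _.
by rewrite /dterm /pull h3 (altZ ha _ [::]) /=; ring.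
Qed.

(** As W is abelian, the bracket is the sum of [b1], with one argument projected to W, and [b2],
    with none. Both take values in W, so their differentials raise the weight exponent by 1 and by
    2, which are the two summands in the definition of coherence. *)
Lemma adapted_coherent br : altbr br -> adapted br M -> coherent br M.
Proof.
move=> hl [_ hg hW]; split=> // p q a ha; have aa := inLam_altform ha.
pose b1 (x y : vec) := br (x *m projU) (y - y *m projU) + br (x - x *m projU) (y *m projU).
pose b2 (x y : vec) := br (x *m projU) (y *m projU).
have brE x y : br x y = b1 x y + b2 x y.
  have -> : br x y = br (x *m projU + (x - x *m projU)) (y *m projU + (y - y *m projU)).
    by rewrite ![_ *m projU + _]addrC !subrK.
  have := hW _ _ (inW_sub_projU x) (inW_sub_projU y); rewrite /b1 /b2.
  move: (x - _) (y - _) => wx wy w0; rewrite (lieDl hl) !(lieDr hl) w0 addr0.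
  by rewrite [in RHS]addrC addrA.
have h1 : altbr b1.
  have [l1 l2 _] := hl.
  have pD c (x y : vec) : (c *: x + y) *m projU = c *: (x *m projU) + y *m projU.
    by rewrite mulmxDl -scalemxAl.
  have wD c (x y : vec) : c *: x + y - (c *: x + y) *m projU =
      c *: (x - x *m projU) + (y - y *m projU).
    by rewrite pD opprD addrACA scalerBr.
  rewrite /b1; split=> [c x y z|c x y z|x].
  - by rewrite wD pD !l1 scalerDr addrACA.
  - by rewrite wD pD !l2 scalerDr addrACA.
  - by rewrite [X in _ + X](lieC hl) subrr.
have h2 : altbr b2.
  rewrite /b2; split=> [c x y z|c x y z|x]; last exact: liexx hl _.
  - by rewrite !mulmxDl -!scalemxAl (lieDl hl) (lieZl hl).
  - by rewrite !mulmxDl -!scalemxAl (lieDr hl) (lieZr hl).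
have Wd x : inW M x -> x *m dil = x by move=> /inW_projU e; rewrite mul_dil e addr0.
have Ud (x : vec) : x *m dil *m projU = 2 *: (x *m projU).
  by rewrite mul_dil mulmxDl projU_id scaler_nat mulr2n.
have Wd' (x : vec) : x *m dil - x *m dil *m projU = x - x *m projU.
  by rewrite Ud mul_dil scaler_nat mulr2n opprD addrA addrK.
have b1W x y : b1 x y *m dil = b1 x y by rewrite mulmxDl !Wd.
have b2W x y : b2 x y *m dil = b2 x y by rewrite Wd //; apply: hg.
have d1 xs : dCE b1 a [seq x *m dil | x <- xs] = 2 ^+ p.+1 * dCE b1 a xs.
  rewrite (@dCE_dil _ b1 a 2 (2 ^+ p) xs aa) ?exprS // => [x y|ys]; last exact: inLam_dil ha.
  by rewrite /b1 !Wd' !Ud (lieZl hl) (lieZr hl) scalerDr.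
have d2 xs : dCE b2 a [seq x *m dil | x <- xs] = 2 ^+ p.+2 * dCE b2 a xs.
  rewrite (@dCE_dil _ b2 a (2 * 2) (2 ^+ p) xs aa) ?exprS ?mulrA // => [x y|ys].
    by rewrite /b2 !Ud (lieZl hl) (lieZr hl) scalerA.
  exact: inLam_dil ha.
have a1 := dCE_altform h1 aa; have a2 := dCE_altform h2 aa.
have dE : dCE br a = fadd (dCE b1 a) (dCE b2 a).
  apply/funext => xs; rewrite /fadd !dCE_nat -big_split; apply: eq_bigr => i _ /=.
  rewrite -big_split; apply: eq_bigr => j _ /=.
  by rewrite /dterm brE (altD aa [::]) mulrDr.
exists (dCE b1 a), (dCE b2 a); split=> //.
- by apply: dil_inLam => //; rewrite addSn.
(* For q = 0 the truncated q.-1 is 0 again, so the target has degree p + 2 while the form has degree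
   p + 1 and weight p + 2; such a form is zero. *)
- case: q ha aa a1 a2 d2 {d1 dE} => [|q] ha aa a1 a2 d2; last first.
    by apply: dil_inLam => //; rewrite !addSn -addnS.
  rewrite (dil_eq0 a2 _ d2); last by rewrite addn0.
  by exists (fun=> 0); apply/funext => xs; rewrite big1 // => I _; rewrite mul0r.
- move=> q0; apply: (dil_eq0 a2 _ d2).
  by rewrite q0 addn0.
Qed.

End Scaling.

Lemma eta1E M (k : nat) x : (k < 6)%N -> etaI M [set (inord k : 'I_6)] [:: x] = cf M x k.
Proof.
move=> hk; have -> : [set (inord k : 'I_6)] = [set i : 'I_6 | val i == k].
  by apply/setP => i; rewrite !inE -val_eqE /= inordK.
rewrite (@etaI_list _ _ (fun t => t == k) [:: k]).
  by rewrite /= det_mx11 mxE.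
by case: k hk => [|[|[|[|[|[|k]]]]]].
Qed.

Lemma inLam_eta1 M (k : nat) : (k < 6)%N ->
  inLam M (k < 2)%N (~~ (k < 2)%N) (etaI M [set (inord k : 'I_6)]).
Proof.
move=> hk; exists (fun I => (I == [set (inord k : 'I_6)])%:R); apply/funext => xs.
have kS : ((inord k : 'I_6) \in S1) = (k < 2)%N by rewrite inE inordK.
rewrite (bigD1 [set (inord k : 'I_6)]) /=; last first.
  case: (boolP (k < 2)%N) kS => /= _ kS.
    have sub : [set (inord k : 'I_6)] \subset S1 by rewrite sub1set.
    by rewrite (setIidPl sub) cards1 cards_eq0 setD_eq0.
  have dis : [disjoint [set (inord k : 'I_6)] & S1] by rewrite disjoints1 kS.
  by rewrite (disjoint_setI0 dis) cards0 (setDidPl dis) cards1.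
rewrite eqxx mul1r big1 ?addr0 // => I /andP [_ /negPf ->]; by rewrite mul0r.
Qed.

(** Coherence is applied to the coframe. A form of V1 has its differential in Lambda^{2,0}, the
    others in Lambda^{1,1} + Lambda^{2,0}. Hence W is abelian, and a bracket can leave W only
    through a multiple of [v 0, v 1], which nilpotency excludes. *)
Lemma coherent_adapted br M : lie br -> nilp br -> coherent br M -> adapted br M.
Proof.
move=> hl [n hn] [Mu hc]; pose v := fr M.
have dE k i j : (k < 6)%N ->
    dCE br (etaI M [set (inord k : 'I_6)]) [:: v i; v j] = - cf M (br (v i) (v j)) k.
  by move=> hk; rewrite dCE2E eta1E.
have cv k j : (k < 6)%N -> (j < 6)%N -> k != j -> coform M (inord k) (v j) = 0.
  by move=> hk hj kj; rewrite -/(cf M (v j) k) cf_fr // eq_sym (negPf kj).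
have c01 k i j : (k < 2)%N -> (i < 6)%N -> (1 < j < 6)%N -> cf M (br (v i) (v j)) k = 0.
  move=> k2 i6 /andP [j1 j6]; have k6 : (k < 6)%N by lia.
  have [b [c [[d bE] _ c0 e]]] := hc _ _ _ (inLam_eta1 M k6).
  have := dE k i j k6; rewrite e c0 ?k2 // /fadd bE /fzero addr0 big1.
    by move/eqP; rewrite eq_sym oppr_eq0 => /eqP.
  rewrite k2 /= => I /andP [_]; rewrite cards_eq0 => /eqP I0.
  rewrite (@etaI_col0 _ _ (v j)) ?mulr0 //.
    by rewrite !inE eqxx orbT.
  move=> t tI; have tS : t \in S1.
    by apply: contraT => tS; have := in_set0 t; rewrite -I0 inE tI tS.
  by rewrite inE in tS; rewrite -[t]inord_val; apply: cv => //; lia.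
have c2 k i j : (1 < k < 6)%N -> (1 < i < 6)%N -> (1 < j < 6)%N -> cf M (br (v i) (v j)) k = 0.
  move=> /andP [k2 k6] /andP [i2 i6] /andP [j2 j6].
  have kn : (k < 2)%N = false by lia.
  have [b [c [[d bE] [d' cE] _ e]]] := hc _ _ _ (inLam_eta1 M k6).
  have := dE k i j k6; rewrite e /fadd bE cE kn /=.
  have van I : (0 < #|I :&: S1|)%N -> etaI M I [:: v i; v j] = 0.
    rewrite card_gt0 => /set0Pn [t]; rewrite inE => /andP [tI tS].
    rewrite (etaI_row0 tI) // => x; rewrite inE in tS.
    by rewrite !inE -[t]inord_val => /orP [] /eqP ->; apply: cv => //; lia.
  rewrite [X in X + _]big1 ?[X in _ + X]big1 ?addr0.
  - by move/eqP; rewrite eq_sym oppr_eq0 => /eqP.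
  - by move=> I /andP [/eqP hI _]; rewrite van ?mulr0 // hI.
  - by move=> I /andP [/eqP hI _]; rewrite van ?mulr0 // hI.
have vv i j : (1 < i < 6)%N -> (1 < j < 6)%N -> br (v i) (v j) = 0.
  move=> hi hj; apply: (cf_eq0 Mu) => k hk.
  case: (ltnP k 2) => k2; last by apply: c2 => //; rewrite k2.
  by apply: c01 => //; case/andP: hi.
have brm k x y : (k < 2)%N -> cf M (br x y) k =
    (cf M x 0 * cf M y 1 - cf M x 1 * cf M y 0) * cf M (br (v 0) (v 1)) k.
  move=> k2.
  have rest2 z : inW M (z - (cf M z 0 *: v 0 + cf M z 1 *: v 1)).
    by split; rewrite cfD cfN cfD !cfZ !cf_fr //=; ring.
  have W0 z w : inW M w -> cf M (br z w) k = 0.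
    move=> [w0 w1]; rewrite (frame_expand Mu z) (lie_suml hl).
    rewrite [w](frame_expand Mu) cf_sum.
    rewrite big1 // => i _; rewrite (lieZl hl) (lie_sumr hl) cfZ cf_sum.
    rewrite big1 ?mulr0 // => j _; rewrite (lieZr hl) cfZ.
    case: (ltnP j 2) => j2; last by rewrite c01 ?mulr0 // j2 ltn_ord.
    by case: j j2 => [[|[|j]] hj] //= _; rewrite ?w0 ?w1 mul0r.
  have E z : z = (cf M z 0 *: v 0 + cf M z 1 *: v 1) + (z - (cf M z 0 *: v 0 + cf M z 1 *: v 1)).
    by rewrite addrC subrK.
  rewrite {1}(E y) (lieDr hl) cfD (W0 _ _ (rest2 y)) addr0 {1}(E x) (lieDl hl) cfD.
  rewrite [X in _ + X](_ : _ = 0) ?addr0; last first.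
    by rewrite (lieC hl) cfN (W0 _ _ (rest2 x)) oppr0.
  rewrite !(lieDl hl) !(lieDr hl) !(lieZl hl) !(lieZr hl) !(liexx hl) (lieC hl (v 1)).
  by rewrite !(cfD, cfZ, cfN, cf0); ring.
(* Iterating ad(v 1) on v 0 multiplies component 0 by the same factor each time, so nilpotency makes
   this factor vanish; likewise below with v 0 and v 1 exchanged. *)
have z0 : cf M (br (v 0) (v 1)) 0 = 0.
  apply/eqP; apply: contraT => c0.
  have h m : cf M (foldr br (v 0) (nseq m (v 1))) 0 = (- cf M (br (v 0) (v 1)) 0) ^+ m.
    elim: m => [|m IH] /=; first by rewrite cf_fr.
    by rewrite brm // !cf_fr //= IH exprS; ring.
  have := h n; rewrite hn ?size_nseq // cf0 => /esym/eqP.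
  by rewrite expf_eq0 oppr_eq0 (negPf c0) andbF.
have z1 : cf M (br (v 0) (v 1)) 1 = 0.
  apply/eqP; apply: contraT => c0.
  have h m : cf M (foldr br (v 1) (nseq m (v 0))) 1 = (cf M (br (v 0) (v 1)) 1) ^+ m.
    elim: m => [|m IH] /=; first by rewrite cf_fr.
    by rewrite brm // !cf_fr //= IH exprS; ring.
  have := h n; rewrite hn ?size_nseq // cf0 => /esym/eqP.
  by rewrite expf_eq0 (negPf c0) andbF.
split=> // [x y|x y [x0 x1] [y0 y1]]; first by split; rewrite brm // ?z0 ?z1 mulr0.
rewrite (frame_expand Mu x) (lie_suml hl) big1 // => i _; rewrite (lieZl hl).
case: (ltnP i 2) => i2.
  by case: i i2 => [[|[|i]] hi] //= _; rewrite ?x0 ?x1 scale0r.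
rewrite (frame_expand Mu y) (lie_sumr hl) big1 ?scaler0 // => j _; rewrite (lieZr hl).
case: (ltnP j 2) => j2.
  by case: j j2 => [[|[|j]] hj] //= _; rewrite ?y0 ?y1 scale0r.
by rewrite -/v vv ?scaler0 // ?i2 ?j2 ltn_ord.
Qed.

End Splittings.

(** * Half-flat structures and coherent splittings *)

Section Obstruction.
Variable R : realType.
Local Notation vec := 'rV[R]_6.
Implicit Types (a b : form R) (M A : 'M[R]_6) (br : vec -> vec -> vec).

Lemma psi_frE M : M \in unitmx ->
  (psiM M [:: fr M 0; fr M 1; fr M 2] = 0) * (psiM M [:: fr M 0; fr M 1; fr M 3] = 0) *
  (psiM M [:: fr M 0; fr M 1; fr M 4] = 0) * (psiM M [:: fr M 0; fr M 1; fr M 5] = 0) *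
  (psiM M [:: fr M 0; fr M 2; fr M 3] = 0) * (psiM M [:: fr M 0; fr M 2; fr M 4] = 1) *
  (psiM M [:: fr M 0; fr M 2; fr M 5] = 0) * (psiM M [:: fr M 0; fr M 3; fr M 4] = 0) *
  (psiM M [:: fr M 0; fr M 3; fr M 5] = - 1) * (psiM M [:: fr M 0; fr M 4; fr M 5] = 0) *
  (psiM M [:: fr M 1; fr M 2; fr M 3] = 0) * (psiM M [:: fr M 1; fr M 2; fr M 4] = 0) *
  (psiM M [:: fr M 1; fr M 2; fr M 5] = - 1) * (psiM M [:: fr M 1; fr M 3; fr M 4] = - 1) *
  (psiM M [:: fr M 1; fr M 3; fr M 5] = 0) * (psiM M [:: fr M 1; fr M 4; fr M 5] = 0) *
  (psiM M [:: fr M 2; fr M 3; fr M 4] = 0) * (psiM M [:: fr M 2; fr M 3; fr M 5] = 0) *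
  (psiM M [:: fr M 2; fr M 4; fr M 5] = 0) * (psiM M [:: fr M 3; fr M 4; fr M 5] = 0).
Proof. by move=> Mu; do !split; rewrite psiME /psi0 /vol3 !cf_fr //=; ring. Qed.

(** Pluecker coordinates, in the frame of [M], of the 2-form spanning Lambda^2 V1 for the coframe
    [N]. *)
Definition plk M N (i j : nat) : R :=
  cf N (fr M i) 0 * cf N (fr M j) 1 - cf N (fr M i) 1 * cf N (fr M j) 0.

(* If psi vanishes on W then the 2-form e^1 /\ e^2 cutting out W is of type (1,1); its
   contraction with omega vanishes only if it does, by the Pluecker relations. *)
Lemma pluecker M N : M \in unitmx -> N \in unitmx ->
  (forall x y z, inW N x -> inW N y -> inW N z -> psiM M [:: x; y; z] = 0) ->
  plk M N 0 1 + plk M N 2 3 + plk M N 4 5 != 0.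
Proof.
move=> Mu Nu hW; pose p := plk M N; rewrite -!/(p _ _).
have e2 : altform 2 (eta2 N 0 1) by apply: eta2_altform.
have E2 x y : eta2 N 0 1 [:: x; y] = cf N x 0 * cf N y 1 - cf N x 1 * cf N y 0.
  by rewrite eta2E.
have pE i j : eta2 N 0 1 [:: fr M i; fr M j] = p i j by rewrite E2.
(* On five vectors of the frame of [N] the product is zero or, up to sign, a value of psi on three
   vectors of W. *)
have W0 : wedge 3 2 (psiM M) (eta2 N 0 1) = @fzero R.
  apply: (alt_eq0_frame Nu) (wedge32_altform (psiM_altform M) e2) _.
  have V i j k : (1 < i < 6)%N -> (1 < j < 6)%N -> (1 < k < 6)%N ->
      psiM M [:: fr N i; fr N j; fr N k] = 0.
    by move=> hi hj hk; apply: hW; apply: fr_inW.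
  have V234 := V 2%N 3%N 4%N isT isT isT; have V235 := V 2%N 3%N 5%N isT isT isT.
  have V245 := V 2%N 4%N 5%N isT isT isT; have V345 := V 3%N 4%N 5%N isT isT isT.
  by do 6 case=> //; rewrite /= => // _;
    rewrite wedge32E !E2 !cf_fr //= ?V234 ?V235 ?V245 ?V345; ring.
have w xs : wedge 3 2 (psiM M) (eta2 N 0 1) xs = 0 by rewrite W0.
pose v := fr M.
have e0 := w [:: v 1; v 2; v 3; v 4; v 5]; have e1 := w [:: v 0; v 2; v 3; v 4; v 5].
have e3 := w [:: v 0; v 1; v 3; v 4; v 5]; have e4 := w [:: v 0; v 1; v 2; v 4; v 5].
have e5 := w [:: v 0; v 1; v 2; v 3; v 5]; have e6 := w [:: v 0; v 1; v 2; v 3; v 4].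
move: e0 e1 e3 e4 e5 e6.
rewrite !wedge32E !(psi_frE Mu) !pE => e0 e1 e3 e4 e5 e6.
(* These six relations express invariance under the complex structure, that is type (1,1). *)
have r1 : p 1%N 3%N = p 0%N 2%N by clear -e6; lra.
have r2 : p 1%N 2%N = - p 0%N 3%N by clear -e5; lra.
have r3 : p 1%N 5%N = p 0%N 4%N by clear -e4; lra.
have r4 : p 1%N 4%N = - p 0%N 5%N by clear -e3; lra.
have r5 : p 3%N 5%N = p 2%N 4%N by clear -e1; lra.
have r6 : p 3%N 4%N = - p 2%N 5%N by clear -e0; lra.
(* The Pluecker relations for pairs of the planes 01, 23, 45. With type (1,1) each right-hand side
   becomes a sum of two squares, and so the squared contraction a sum of squares. *)
have q1 : p 0%N 1%N * p 2%N 3%N = p 0%N 2%N * p 1%N 3%N - p 0%N 3%N * p 1%N 2%N.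
  by rewrite /p /plk; ring.
have q2 : p 0%N 1%N * p 4%N 5%N = p 0%N 4%N * p 1%N 5%N - p 0%N 5%N * p 1%N 4%N.
  by rewrite /p /plk; ring.
have q3 : p 2%N 3%N * p 4%N 5%N = p 2%N 4%N * p 3%N 5%N - p 2%N 5%N * p 3%N 4%N.
  by rewrite /p /plk; ring.
rewrite r1 r2 in q1; rewrite r3 r4 in q2; rewrite r5 r6 in q3.
apply/eqP => c0.
have S0 : p 0%N 1%N ^+ 2 + p 2%N 3%N ^+ 2 + p 4%N 5%N ^+ 2 + 2 * (p 0%N 2%N ^+ 2 +
    p 0%N 3%N ^+ 2 + p 0%N 4%N ^+ 2 + p 0%N 5%N ^+ 2 + p 2%N 4%N ^+ 2 + p 2%N 5%N ^+ 2) = 0.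
  have c2 : (p 0%N 1%N + p 2%N 3%N + p 4%N 5%N) ^+ 2 = 0 by rewrite c0 expr0n.
  by clear -c2 q1 q2 q3; lra.
have sq (x : R) : 0 <= x ^+ 2 := sqr_ge0 x.
have z (x : R) : x ^+ 2 <= 0 -> x = 0.
  by move=> h; apply/eqP; rewrite -sqrf_eq0 eq_le h sq.
have := (sq (p 0%N 1%N), sq (p 2%N 3%N), sq (p 4%N 5%N), sq (p 0%N 2%N), sq (p 0%N 3%N),
  sq (p 0%N 4%N), sq (p 0%N 5%N), sq (p 2%N 4%N), sq (p 2%N 5%N)).
move=> [[[[[[[[s1 s2] s3] s4] s5] s6] s7] s8] s9].
clear e0 e1 e3 e4 e5 e6 q1 q2 q3 w W0.
have p01 : p 0%N 1%N = 0 by apply: z; clear -S0 s1 s2 s3 s4 s5 s6 s7 s8 s9; lra.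
have p23 : p 2%N 3%N = 0 by apply: z; clear -S0 s1 s2 s3 s4 s5 s6 s7 s8 s9; lra.
have p45 : p 4%N 5%N = 0 by apply: z; clear -S0 s1 s2 s3 s4 s5 s6 s7 s8 s9; lra.
have p02 : p 0%N 2%N = 0 by apply: z; clear -S0 s1 s2 s3 s4 s5 s6 s7 s8 s9; lra.
have p03 : p 0%N 3%N = 0 by apply: z; clear -S0 s1 s2 s3 s4 s5 s6 s7 s8 s9; lra.
have p04 : p 0%N 4%N = 0 by apply: z; clear -S0 s1 s2 s3 s4 s5 s6 s7 s8 s9; lra.
have p05 : p 0%N 5%N = 0 by apply: z; clear -S0 s1 s2 s3 s4 s5 s6 s7 s8 s9; lra.
have p24 : p 2%N 4%N = 0 by apply: z; clear -S0 s1 s2 s3 s4 s5 s6 s7 s8 s9; lra.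
have p25 : p 2%N 5%N = 0 by apply: z; clear -S0 s1 s2 s3 s4 s5 s6 s7 s8 s9; lra.
have eta0 : eta2 N 0 1 = @fzero R.
  apply: (alt_eq0_frame Mu e2).
  by do 6 case=> //; rewrite /= => // _; rewrite pE;
    rewrite ?p01 ?p23 ?p45 ?r1 ?r2 ?r3 ?r4 ?r5 ?r6 ?p02 ?p03 ?p04 ?p05 ?p24 ?p25 ?oppr0.
have := E2 (fr N 0) (fr N 1); rewrite eta0 /fzero !cf_fr //= => /eqP.
by rewrite mulr1 mulr0 subr0 eq_sym oner_eq0.
Qed.

Lemma unitmx_inj n (C : 'M[R]_n) : (forall x : 'rV[R]_n, x *m C = 0 -> x = 0) -> C \in unitmx.
Proof.
move=> h; rewrite -row_free_unit -kermx_eq0; apply/eqP/row_matrixP => i.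
by rewrite row0; apply: h; rewrite -row_mul mulmx_ker row0.
Qed.

(** On (v_a, v_2, v_3, v_4) with a = 0, 1 the value is, up to sign, the trace of ad v_a, whose
    diagonal entries at 0, 1 and 5 vanish. On other tuples each term contains a vanishing bracket or
    a vanishing value of the 3-form. *)
Lemma closed_eta3 br N : altbr br -> N \in unitmx -> unimodular br ->
  br (fr N 0) (fr N 1) = 0 -> (forall x, br x (fr N 5) = 0) ->
  (forall s t, (1 < s < 6)%N -> (1 < t < 6)%N -> br (fr N s) (fr N t) = 0) ->
  dCE br (eta3 N 2 3 4) = @fzero R.
Proof.
move=> hl Nu hu h01 h5 hW.
have tr x : cf N (br x (fr N 0)) 0 + cf N (br x (fr N 1)) 1 + cf N (br x (fr N 2)) 2 +
    cf N (br x (fr N 3)) 3 + cf N (br x (fr N 4)) 4 + cf N (br x (fr N 5)) 5 = 0.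
  by have := trace_frame hl Nu x hu; rewrite !big_ord_recl big_ord0 /= addr0 !addrA.
have h10 : br (fr N 1) (fr N 0) = 0 by rewrite (lieC hl) h01 oppr0.
have t0 := tr (fr N 0); have t1 := tr (fr N 1).
rewrite !(liexx hl) h01 h5 !cf0 in t0; rewrite !(liexx hl) h10 h5 !cf0 in t1.
have W23 := hW 2%N 3%N isT isT; have W24 := hW 2%N 4%N isT isT.
have W34 := hW 3%N 4%N isT isT.
have ha : altform 3 (eta3 N 2 3 4) by apply: eta3_altform.
apply: (alt_eq0_frame Nu (dCE_altform hl ha)).
by do 6 case=> //; rewrite /= => // _;
  rewrite dCE4E ?h01 ?h5 ?W23 ?W24 ?W34 ?(alt0 ha [::]) ?eta3E // ?cf_fr //= ?cf0;
  clear -t0 t1; lra.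
Qed.

End Obstruction.

(** * A half-flat structure gives a closed 3-form not vanishing on W *)

Section HalfFlatHpq.
Variable R : realType.
Local Notation vec := 'rV[R]_6.
Implicit Types (M : 'M[R]_6) (br : vec -> vec -> vec).

Lemma half_flat_hpq br N : lie br -> nilp br -> unimodular br -> has_half_flat br ->
  adapted br N -> hpq_nonzero br N 0 3.
Proof.
move=> hl hn hu [om [ps [[M [Mu [-> ->]]] h1 h2]]] hN; have [Nu hg hW] := hN.
rewrite -/(omegaM M) in h1; rewrite -/(psiM M) in h2.
have [hW0|] := pselect (forall x y z, inW N x -> inW N y -> inW N z ->
    psiM M [:: x; y; z] = 0); last first.
  move=> /existsNP [x /existsNP [y /existsNP [z]]].
  move=> /not_implyP [hx /not_implyP [hy /not_implyP [hz /eqP hp]]].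
  exact: (hpq_nonzeroI hl hN (psiM_altform M) h2 hx hy hz hp).
have := pluecker Mu Nu hW0; set c := (X in X != 0) => c0.
have {h1} := (domega_omegaP hl Mu hu).1 h1.
pose A0 := fr N 0; pose B0 := fr N 1.
have [w [wW xE]] : exists w : vec -> vec, (forall x, inW N (w x)) /\
    forall x, x = (cf N x 0 *: A0 + cf N x 1 *: B0) + w x.
  exists (fun x => x - (cf N x 0 *: A0 + cf N x 1 *: B0)); split=> x.
    by split; rewrite cfD cfN cfD !cfZ !cf_fr //=; ring.
  by rewrite addrC subrK.
have brE x y : br x y = (cf N x 0 * cf N y 1 - cf N x 1 * cf N y 0) *: br A0 B0
    + br A0 (cf N x 0 *: w y - cf N y 0 *: w x) + br B0 (cf N x 1 *: w y - cf N y 1 *: w x).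
  rewrite {1}(xE x) {1}(xE y) !(lieDl hl) !(lieDr hl) (hW _ _ (wW x) (wW y)).
  rewrite !(lieZl hl) !(lieZr hl) !(lieC hl (w x)) (lieC hl B0 A0) !(liexx hl).
  rewrite -!scaleNr !(lieZr hl).
  apply/rowP => k; rewrite !mxE; ring.
rewrite (brE (fr M 0) (fr M 1)) (brE (fr M 2) (fr M 3)) (brE (fr M 4) (fr M 5)).
set wa0 := cf N (fr M 0) 0 *: _ - _; set wb0 := cf N (fr M 0) 1 *: _ - _.
set wa2 := cf N (fr M 2) 0 *: _ - _; set wb2 := cf N (fr M 2) 1 *: _ - _.
set wa4 := cf N (fr M 4) 0 *: _ - _; set wb4 := cf N (fr M 4) 1 *: _ - _ => hsum.
pose wa := wa0 + wa2 + wa4; pose wb := wb0 + wb2 + wb4.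
have W_lin s t x y : inW N (s *: w x - t *: w y).
  have [x0 x1] := wW x; have [y0 y1] := wW y.
  by split; rewrite cfD cfN !cfZ ?x0 ?x1 ?y0 ?y1 !mulr0 subrr.
have WD x y : inW N x -> inW N y -> inW N (x + y).
  by move=> [x0 x1] [y0 y1]; split; rewrite cfD ?x0 ?x1 ?y0 ?y1 addr0.
have waW : inW N wa := WD _ _ (WD _ _ (W_lin _ _ _ _) (W_lin _ _ _ _)) (W_lin _ _ _ _).
have wbW : inW N wb := WD _ _ (WD _ _ (W_lin _ _ _ _) (W_lin _ _ _ _)) (W_lin _ _ _ _).
have {hsum} hsum : c *: br A0 B0 + br A0 wa + br B0 wb = 0.
  rewrite -[RHS]hsum /wa /wb /c /plk !(lieDr hl); apply/rowP => k; rewrite !mxE; ring.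
(* Since c [A0, B0] + [A0, wa] + [B0, wb] = 0 with c nonzero, these corrections by elements of W
   yield c [A, B] = 0. *)
pose A := A0 - c^-1 *: wb; pose B := B0 + c^-1 *: wa.
have AB : br A B = 0.
  rewrite (lieDl hl) !(lieDr hl) -scaleNr !(lieZl hl) !(lieZr hl) (hW _ _ wbW waW).
  rewrite (lieC hl wb) !scaler0 addr0.
  apply: (scalerI c0); rewrite scaler0 -[RHS]hsum.
  by apply/rowP => k; rewrite !mxE; field.
(* Iterated brackets starting from an element of W stay in W, so the last nonzero one is central and
   lies in W. *)
have [xs [u0 uc]] : exists xs, foldr br (fr N 2) xs != 0 /\
    forall x, br x (foldr br (fr N 2) xs) = 0.
  apply: nilp_central => //; apply/eqP => e.
  have := @cf_fr _ N Nu 2 2 isT isT; rewrite e cf0 => /eqP.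
  by rewrite eq_sym oner_eq0.
set u := foldr _ _ _ in u0 uc.
have uW : inW N u.
  by rewrite /u; case: xs {u u0 uc} => [|x xs] /=; [apply: fr_inW|apply: hg].
(* In the new frame [u] replaces the frame vector of an index where its coordinate is nonzero, and
   it is placed last, where [closed_eta3] expects the central vector. *)
have [k [hk uk]] : exists k, (1 < k < 6)%N /\ cf N u k != 0.
  apply: contra_notP (elimN eqP u0) => h; apply: (cf_eq0 Nu) => k k6.
  case: (ltnP k 2) => k2; first by case: uW; case: k k2 {k6} => [|[|k]].
  by apply/eqP; apply: contra_notT h => h; exists k; rewrite k2.
have [i [j [l hijl]]] : exists i j l,
    (k, i, j, l) \in [:: (2, 3, 4, 5); (3, 2, 4, 5); (4, 2, 3, 5); (5, 2, 3, 4)]%N.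
  move: hk; clear -k; case: k => [|[|[|[|[|[|k]]]]]] // _.
  - by exists 3%N, 4%N, 5%N.
  - by exists 2%N, 4%N, 5%N.
  - by exists 2%N, 3%N, 5%N.
  - by exists 2%N, 3%N, 4%N.
have [hi hj hll] : [/\ (1 < i < 6)%N, (1 < j < 6)%N & (1 < l < 6)%N].
  by move: hijl; rewrite !inE => /or4P [] /eqP [_ -> -> ->].
pose rw (m : nat) : vec := nth 0 [:: A; B; fr N i; fr N j; fr N l; u] m.
pose V : 'M[R]_6 := \matrix_(i < 6) rw i.
have frE m : (m < 6)%N -> fr (invmx V) m = rw m by move=> hm; rewrite /fr invmxK rowK inordK.
have [A0' A1] : cf N A 0 = 1 /\ cf N A 1 = 0.
  by case: wbW => b0 b1; split; rewrite cfD cfN cfZ ?b0 ?b1 !cf_fr //= mulr0 subr0.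
have [B0' B1] : cf N B 0 = 0 /\ cf N B 1 = 1.
  by case: waW => a0 a1; split; rewrite cfD cfZ ?a0 ?a1 !cf_fr //= mulr0 addr0.
have [u0' u1] := uW.
have rW m : (1 < m < 6)%N -> inW N (rw m).
  by case: m => [|[|[|[|[|[|m]]]]]] //= _; apply: fr_inW.
have Vu : V \in unitmx.
  apply: unitmx_inj => x; rewrite mulmx_sum_row => hx.
  have cfx m : \sum_(i < 6) crd x i * cf N (rw i) m = 0.
    transitivity (cf N (\sum_i x 0 i *: row i V) m); last by rewrite hx cf0.
    by rewrite cf_sum; apply: eq_bigr => t _; rewrite cfZ rowK crdE.
  have := (cfx 0, cfx 1, cfx 2, cfx 3, cfx 4, cfx 5)%N.
  rewrite !big_ord_recl !big_ord0 /= /bump /= !add1n => - [[[[[c0' c1] c2] c3] c4] c5].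
  have x0 : crd x 0 = 0.
    have [r2 _] := rW 2%N isT; have [r3 _] := rW 3%N isT; have [r4 _] := rW 4%N isT.
    by have [r5 _] := rW 5%N isT; rewrite /= r2 r3 r4 r5 A0' B0' in c0'; lra.
  have x1 : crd x 1 = 0.
    have [_ r2] := rW 2%N isT; have [_ r3] := rW 3%N isT; have [_ r4] := rW 4%N isT.
    by have [_ r5] := rW 5%N isT; rewrite /= r2 r3 r4 r5 A1 B1 in c1; lra.
  rewrite x0 x1 !mul0r !add0r in c2 c3 c4 c5.
  have [x2 x3 x4 x5] : [/\ crd x 2 = 0, crd x 3 = 0, crd x 4 = 0 & crd x 5 = 0].
    rewrite /rw /= in c2 c3 c4 c5; move: hijl uk c2 c3 c4 c5; clear -Nu.
    rewrite !inE => /or4P [] /eqP [-> -> -> ->] uk; rewrite /= !cf_fr //= => c2 c3 c4 c5;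
      (have x5 : crd x 5 = 0 by apply: (mulIf uk); lra);
      by rewrite x5 in c2 c3 c4 c5; split=> //; lra.
  apply: row_crd => m hm; rewrite [RHS]/crd.
  have -> : (if insub m is Some t then (0 : vec) ord0 t else 0) = 0.
    by case: insub => [t|]; rewrite ?mxE.
  by case: m hm => [|[|[|[|[|[|m]]]]]].
have Vu' : invmx V \in unitmx by rewrite unitmx_inv.
have dphi : dCE br (eta3 (invmx V) 2 3 4) = @fzero R.
  apply: (closed_eta3 hl Vu' hu); rewrite ?frE // => s t hs ht.
  by rewrite !frE ?(andP hs).2 ?(andP ht).2 //; apply: hW; apply: rW.
have inV t : (1 < t < 6)%N -> inW N (fr (invmx V) t).
  by move=> ht; rewrite frE ?(andP ht).2 //; apply: rW.
have ha : altform 3 (eta3 (invmx V) 2 3 4) by apply: eta3_altform.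
apply: (hpq_nonzeroI hl hN ha dphi (inV 2%N isT) (inV 3%N isT) (inV 4%N isT)).
rewrite eta3E // !cf_fr //=.
by rewrite !(mulr0, mul0r, subr0, addr0, mul1r, mulr1) oner_neq0.
Qed.

End HalfFlatHpq.

(** * The listed algebras *)

Section Listed.
Variable R : realType.
Implicit Types (D : lie_data).

Lemma crdD n (x y : 'rV[R]_n) k : crd (x + y) k = crd x k + crd y k.
Proof. by rewrite /crd; case: insub => [i|]; rewrite ?mxE ?addr0. Qed.

Lemma crdZ n c (x : 'rV[R]_n) k : crd (c *: x) k = c * crd x k.
Proof. by rewrite /crd; case: insub => [i|]; rewrite ?mxE ?mulr0. Qed.

Lemma crd0 n k : crd (0 : 'rV[R]_n) k = 0.
Proof. by rewrite /crd; case: insub => [i|]; rewrite ?mxE. Qed.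

Lemma altbr_brD n (D : sdata R) : altbr (brD n D).
Proof.
split=> [a x y z|a x y z|x]; apply/rowP => k; rewrite !mxE;
  by elim: (nth _ _ _) => [|t l IH] /=; rewrite ?crdD ?crdZ; lra.
Qed.

Lemma mem_foldr_and (T : eqType) (Q : T -> Prop) (L : seq T) :
  foldr (fun x p => Q x /\ p) True L -> forall x, x \in L -> Q x.
Proof.
elim: L => //= y L IH [hy hL] x; rewrite inE => /orP [/eqP -> //|]; exact: IH.
Qed.

Definition triangular n D := all (fun k =>
  all (fun t => (t.1.1.-1 < k)%N && (t.1.2.-1 < k)%N) (nth [::] D k)) (iota 0 n).

Lemma nth_castD D k : nth [::] (@castD R D) k = [seq (t.1, t.2%:~R) | t <- nth [::] D k].
Proof.
case: (ltnP k (size D)) => h; first by rewrite (nth_map [::]).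
by rewrite !nth_default ?size_map.
Qed.

Lemma form2_triangular n D k (u v : nat -> R) : triangular n D -> (k < n)%N ->
  (forall i, (i < k)%N -> v i = 0) -> form2 (nth [::] (castD D) k) u v = 0.
Proof.
move=> /allP h hk hv; rewrite form2E nth_castD big_map big_seq big1 // => t ht.
have := h k; rewrite mem_iota hk => /(_ isT)/allP/(_ t ht)/andP [h1 h2].
by rewrite /= !hv //; ring.
Qed.

(** After m brackets the coordinates below m vanish. *)
Lemma nilp_triangular n D : size D = n -> triangular n D -> nilp (brD n (@castD R D)).
Proof.
move=> sD h; exists n => xs y hs; apply: row_crd => k hk; rewrite crd0.
have sD' : (size (@castD R D) <= n)%N by rewrite size_map sD.
have gen : forall k, (k < n)%N -> (k < size xs)%N ->
    crd (foldr (brD n (castD D)) y xs) k = 0.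
  elim: xs {hs} => //= x xs IH l ln hl; rewrite crd_brD // (form2_triangular _ h) ?oppr0 //.
  by move=> i il; apply: IH; lia.
by apply: gen => //; rewrite hs.
Qed.

Lemma unimodular_triangular D : size D = 6 -> triangular 6 D ->
  unimodular (brD 6 (@castD R D)).
Proof.
move=> sD h x; apply: big1 => k _; rewrite -crdE crd_brD ?size_map ?sD //.
rewrite (form2_triangular _ h) ?oppr0 // => i ik.
have hi : (i < 6)%N by apply: ltn_trans ik (ltn_ord k).
have /negPf ne : Ordinal hi != k by rewrite -val_eqE /= (ltn_eqF ik).
by rewrite -[i]/(val (Ordinal hi)) crdE mxE ne andbF.
Qed.

Lemma unimodular_iso (br1 br2 : bracket R 6) : altbr br1 -> iso br1 br2 ->
  unimodular br1 -> unimodular br2.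
Proof.
move=> hl [A [Au h]] hu x; rewrite -[RHS](trace_frame hl Au (x *m invmx A) hu).
apply: eq_bigr => i _; rewrite /cf /coform -h mulmxKV // /fr inord_val -row_mul.
by rewrite mulVmx // rowE mulmx1.
Qed.

Lemma jacobi_brD n (D : sdata R) : (size D <= n)%N ->
  (forall k u v w, (k < n)%N -> let B a b l := - form2 (nth [::] D l) a b in
     B u (B v w) k + B v (B w u) k + B w (B u v) k = 0) -> lie (brD n D).
Proof.
move=> sD h; have [h1 h2 h3] := altbr_brD n D; split=> // x y z; apply: row_crd => k hk.
by rewrite !crdD crd0 !crd_brD //; apply: h.
Qed.

Lemma nil6P D : D \in nil6 -> wf 6 D && triangular 6 D.
Proof. by move: D; apply/allP. Qed.

Lemma nilp_nil6 D : D \in nil6 -> nilp (brD 6 (@castD R D)).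
Proof. by move=> /nil6P /andP [/andP [/eqP sD _]]; apply: nilp_triangular. Qed.

Lemma unimodular_nil6 D : D \in nil6 -> unimodular (brD 6 (@castD R D)).
Proof. by move=> /nil6P /andP [/andP [/eqP sD _]]; apply: unimodular_triangular. Qed.

Lemma lie_nil6 D : D \in nil6 -> lie (brD 6 (@castD R D)).
Proof.
move: D; apply: mem_foldr_and; rewrite /=; repeat (apply: conj => //); apply: jacobi_brD => //;
  do 6 (case=> [|k u v w hk]; [by move=> u v w _ /=; rewrite /form2 /=; ring|move: k u v w hk]);
  done.
Qed.

End Listed.

(** * Existence of half-flat structures *)

Section Existence.
Variable R : realType.
Local Notation vec := 'rV[R]_6.
Local Notation E c i := (c%R : R, i%N) (only parsing).
Local Notation X i := (1%R : R, i%N) (only parsing).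
Local Notation Y i := [:: (1%R : R, i%N)] (only parsing).
Local Notation T i j c := (i%N, j%N, c%Z) (only parsing).

Definition kdelta (i k : nat) : R := (i == k)%:R.

Lemma cf1E (x : vec) k : (k < 6)%N -> cf 1%:M x k = crd x k.
Proof.
by move=> hk; rewrite /cf /coform mulmx1 -crdE inordK.
Qed.

Lemma crd_fr1 i : (i < 6)%N -> crd (fr (1%:M : 'M[R]_6) i) = kdelta i.
Proof.
move=> hi; apply/funext => k; rewrite /kdelta; case: (ltnP k 6) => hk.
  by rewrite -cf1E // cf_fr ?unitmx1.
by rewrite crd_out // ltn_eqF // (leq_trans hi).
Qed.

Definition scD (D : sdata R) (i j k : nat) : R :=
  - form2 (nth [::] D k) (kdelta i) (kdelta j).

Lemma crd_brD_fr1 (D : sdata R) i j : size D = 6 -> (i < 6)%N -> (j < 6)%N ->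
  crd (brD 6 D (fr 1%:M i) (fr 1%:M j)) = scD D i j.
Proof. by move=> sD hi hj; rewrite crd_brD ?sD // !crd_fr1. Qed.

(* The coefficients of the contraction of the bracket with omega and of d(psi), in terms of
   the structure constants [e_i, e_j] = sum_k (c i j k) e_k. *)
Definition half_flat_eqs (V : zmodType) (c : nat -> nat -> nat -> V) : seq V := [::
    c 0 1 0 + c 2 3 0 + c 4 5 0; c 0 1 1 + c 2 3 1 + c 4 5 1; c 0 1 2 + c 2 3 2 + c 4 5 2;
    c 0 1 3 + c 2 3 3 + c 4 5 3; c 0 1 4 + c 2 3 4 + c 4 5 4; c 0 1 5 + c 2 3 5 + c 4 5 5;
    c 0 3 5 + c 1 2 5 + c 1 3 4 - c 0 2 4; c 0 2 3 + c 0 4 5 + c 1 2 2 + c 1 4 4 - c 0 1 0;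
    c 0 1 1 + c 0 2 2 + c 0 5 5 + c 1 5 4 - c 1 2 3;
    c 0 1 1 + c 0 3 3 + c 0 4 4 + c 1 3 2 - c 1 4 5;
    c 0 1 0 + c 0 3 2 + c 0 5 4 - c 1 3 3 - c 1 5 5; c 0 4 2 - c 0 5 3 - c 1 4 3 - c 1 5 2;
    c 0 2 1 + c 0 3 0 + c 2 3 2 - c 2 4 5 - c 3 4 4;
    c 0 2 0 - c 0 3 1 - c 2 3 3 - c 2 5 5 - c 3 5 4;
    - c 0 4 1 - c 0 5 0 - c 2 4 3 - c 2 5 2 - c 4 5 4;
    c 0 5 1 + c 4 5 5 - c 0 4 0 - c 3 4 3 - c 3 5 2;
    c 1 2 1 + c 1 3 0 + c 3 4 5 - c 2 3 3 - c 2 4 4;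
    c 1 2 0 + c 3 5 5 - c 1 3 1 - c 2 3 2 - c 2 5 4;
    c 2 5 3 + c 4 5 5 - c 1 4 1 - c 1 5 0 - c 2 4 2;
    c 1 5 1 + c 3 5 3 + c 4 5 4 - c 1 4 0 - c 3 4 2; c 2 5 1 + c 3 4 1 + c 3 5 0 - c 2 4 0].

Lemma psi0_kdelta (u : nat -> R) :
  (psi0 u (kdelta 0) (kdelta 1) = 0) * (psi0 u (kdelta 0) (kdelta 2) = u 4%N) *
  (psi0 u (kdelta 0) (kdelta 3) = - u 5%N) * (psi0 u (kdelta 0) (kdelta 4) = - u 2%N) *
  (psi0 u (kdelta 0) (kdelta 5) = u 3%N) * (psi0 u (kdelta 1) (kdelta 2) = - u 5%N) *
  (psi0 u (kdelta 1) (kdelta 3) = - u 4%N) * (psi0 u (kdelta 1) (kdelta 4) = u 3%N) *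
  (psi0 u (kdelta 1) (kdelta 5) = u 2%N) * (psi0 u (kdelta 2) (kdelta 3) = 0) *
  (psi0 u (kdelta 2) (kdelta 4) = u 0%N) * (psi0 u (kdelta 2) (kdelta 5) = - u 1%N) *
  (psi0 u (kdelta 3) (kdelta 4) = - u 1%N) * (psi0 u (kdelta 3) (kdelta 5) = - u 0%N) *
  (psi0 u (kdelta 4) (kdelta 5) = 0).
Proof. by do !split; rewrite /psi0 /vol3 /kdelta /=; ring. Qed.

Lemma half_flat_brD (D : sdata R) : size D = 6 -> unimodular (brD 6 D) ->
  half_flat_eqs (scD D) = nseq 21 0 -> has_half_flat (brD 6 D).
Proof.
move=> sD hu; have hl := altbr_brD 6 D; have Iu := unitmx1 R 6.
move=> [z0 z1 z2 z3 z4 z5 z6 z7 z8 z9 z10 z11 z12 z13 z14 z15 z16 z17 z18 z19 z20].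
have p0 u v w u' v' w' : (forall k, (k < 6)%N -> u k = u' k) ->
    (forall k, (k < 6)%N -> v k = v' k) -> (forall k, (k < 6)%N -> w k = w' k) ->
    psi0 u v w = psi0 u' v' w'.
  by move=> e1 e2 e3; rewrite /psi0 /vol3 !e1 // !e2 // !e3.
exists (omegaM 1%:M), (psiM 1%:M); split.
- by exists 1%:M; split.
- apply/(domega_omegaP hl Iu hu); apply: row_crd => k hk.
  rewrite !crdD !crd_brD_fr1 // crd0.
  by case: k hk => [|[|[|[|[|[|k]]]]]].
- have e i : (i < 6)%N -> forall k, (k < 6)%N -> cf 1%:M (fr (1%:M : 'M[R]_6) i) k = kdelta i k.
    by move=> hi k hk; rewrite cf_fr.
  have c i j : (i < 6)%N -> (j < 6)%N -> forall k, (k < 6)%N ->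
      cf 1%:M (brD 6 D (fr 1%:M i) (fr 1%:M j)) k = scD D i j k.
    by move=> hi hj k hk; rewrite cf1E // crd_brD_fr1.
  have q i j k l : (i < 6)%N -> (j < 6)%N -> (k < 6)%N -> (l < 6)%N ->
      psi0 (cf 1%:M (brD 6 D (fr 1%:M i) (fr 1%:M j))) (cf 1%:M (fr (1%:M : 'M[R]_6) k))
        (cf 1%:M (fr (1%:M : 'M[R]_6) l)) = psi0 (scD D i j) (kdelta k) (kdelta l).
    by move=> hi hj hk hl'; apply: p0; auto.
  have dE w x y z : (w < 6)%N -> (x < 6)%N -> (y < 6)%N -> (z < 6)%N ->
      let f := fr (1%:M : 'M[R]_6) in let p i j k l := psi0 (scD D i j) (kdelta k) (kdelta l) in
      dCE (brD 6 D) (psiM 1%:M) [:: f w; f x; f y; f z] =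
      - p w x y z + p w y x z - p w z x y - p x y w z + p x z w y - p y z w x.
    by move=> hw hx hy hz /=; rewrite dCE4E !psiME !q.
  apply: (alt_eq0_frame Iu (dCE_altform hl (psiM_altform _))).
  move: dE; clear -z6 z7 z8 z9 z10 z11 z12 z13 z14 z15 z16 z17 z18 z19 z20 => dE.
  (* [case] puts [true] first, so the tuples appear in lexicographic order, which is the order of
     the last fifteen equations. *)
  do 6 case; rewrite /= => // _; rewrite dE // !psi0_kdelta;
    [move: z6|move: z7|move: z8|move: z9|move: z10|move: z11|move: z12|move: z13|move: z14
    |move: z15|move: z16|move: z17|move: z18|move: z19|move: z20]; clear; lra.
Qed.

(** Structure constants over the integers, where the half-flat equations are decided by
    computation. *)
Definition scZ (D : lie_data) (i j k : nat) : int :=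
  - foldr (fun t s => t.2 *+ ((i == t.1.1.-1) && (j == t.1.2.-1))
                    - t.2 *+ ((i == t.1.2.-1) && (j == t.1.1.-1)) + s) 0 (nth [::] D k).

Lemma scD_castD (D : lie_data) : scD (castD D) = fun i j k => (scZ D i j k)%:~R.
Proof.
apply/funext => i; apply/funext => j; apply/funext => k; rewrite /scD /scZ nth_castD rmorphN /=.
congr (- _); elim: (nth _ _ _) => [|t l IH] //=.
rewrite IH rmorphD rmorphB /= !rmorphMn /= /kdelta.
by do 4 case: (_ == _); rewrite /= ?mulr1n ?mulr0n; ring.
Qed.

Lemma half_flat_castD (D : lie_data) : size D = 6 -> unimodular (brD 6 (@castD R D)) ->
  half_flat_eqs (scZ D) == nseq 21 0 -> has_half_flat (brD 6 (@castD R D)).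
Proof.
move=> sD hu /eqP h; apply: half_flat_brD; rewrite ?size_map //.
transitivity (map intr (half_flat_eqs (scZ D)) : seq R); last by rewrite h.
rewrite scD_castD /half_flat_eqs /=.
by do 21 (congr (_ :: _); first by rewrite !intrD ?mulrNz).
Qed.

Ltac half_flat_by D' C Ci :=
  let h := fresh in let hu := fresh in move=> hu;
  match goal with |- has_half_flat (brD 6 ?D) => have h : iso (brD 6 D) (brD 6 (castD D')) end;
  [iso_by C Ci
  |apply: (has_half_flat_iso h); apply: half_flat_castD => //;
    exact: unimodular_iso (altbr_brD _ _) h hu].

(** Each item gives the structure equations in a coframe for which the standard omega and psi are
    half-flat, then that coframe and its inverse. These equations need not be triangular, so
    unimodularity is transported from the listed form. *)
Lemma half_flat_listP D : D \in half_flat_list -> has_half_flat (brD 6 (@castD R D)).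
Proof.
move=> hD; have : D \in nil6 by rewrite mem_cat hD.
move=> /(@unimodular_nil6 R); move: D hD; apply: mem_foldr_and; rewrite /=.
repeat (apply: conj => //).
- half_flat_by [:: [:: T 3 5 (-1)]; [:: T 3 6 (-1)]; [::]; [:: T 1 5 2]; [::]; [:: T 1 3 (-1)]]
  [:: Y 3; [:: E (-1) 6]; [:: E (-1) 1]; [:: E (-2) 5]; Y 2; [:: E (-1) 4]]
  [:: [:: E (-1) 3]; Y 5; Y 1; [:: E (-1) 6]; [:: E (- (1 / 2)) 4]; [:: E (-1) 2]].
- half_flat_by [:: [:: T 3 5 (-2); T 4 6 (-4)]; [:: T 4 5 2]; [:: T 2 5 (-2)]; [::]; [::];
    [:: T 2 4 1]]
  [:: [:: E (1 / 2) 6]; [:: E (1 / 2) 3]; [:: E (- (1 / 2)) 5]; [:: E (- (1 / 2)) 1];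
    [:: E (- (1 / 2)) 2]; [:: E (1 / 4) 4]]
  [:: [:: E (-2) 4]; [:: E (-2) 5]; [:: E 2 2]; [:: E 4 6]; [:: E (-2) 3]; [:: E 2 1]].
- half_flat_by [:: [::]; [:: T 3 5 2]; [::]; [:: T 1 5 (-1)]; [:: T 1 3 2]; [:: T 1 4 4;
    T 2 3 (-2)]]
  [:: [:: E (1 / 2) 1]; [:: E (1 / 2) 5]; [:: E (1 / 2) 2]; [:: E (- (1 / 4)) 4];
    [:: E (1 / 2) 3]; [:: E (- (1 / 2)) 6]]
  [:: [:: E 2 1]; [:: E 2 3]; [:: E 2 5]; [:: E (-4) 4]; [:: E 2 2]; [:: E (-2) 6]].
- half_flat_by [:: [:: T 1 3 (-1); T 1 4 (-2); T 1 6 1; T 2 3 (-2); T 2 4 1; T 2 5 1;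
    T 3 5 (-1); T 4 6 1]; [:: T 1 2 2; T 1 3 2; T 1 4 (-2); T 1 5 (-2); T 2 4 (-2); T 3 4 (-2);
    T 4 5 (-2)]; [:: T 1 2 5; T 1 3 1; T 1 4 (-1); T 1 5 (-1); T 2 3 (-1); T 2 4 (-7); T 2 6 1;
    T 3 4 (-4); T 3 5 (-1); T 3 6 1; T 4 5 (-3); T 4 6 (-1); T 5 6 (-1)]; [:: T 1 3 1; T 1 4 2;
    T 1 6 (-1); T 2 3 2; T 2 4 (-1); T 2 5 (-1); T 3 5 1; T 4 6 (-1)]; [:: T 1 2 7; T 1 3 2;
    T 1 4 (-5); T 1 5 (-3); T 1 6 1; T 2 3 (-3); T 2 4 (-8); T 2 5 1; T 2 6 1; T 3 4 (-6);
    T 3 5 (-2); T 3 6 1; T 4 5 (-5); T 5 6 (-1)]; [:: T 1 2 5; T 1 3 3; T 1 4 3; T 1 5 (-1);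
    T 1 6 (-2); T 2 3 7; T 2 4 (-13); T 2 5 (-6); T 2 6 1; T 3 4 (-4); T 3 5 1; T 3 6 1;
    T 4 5 (-3); T 4 6 (-3); T 5 6 (-1)]]
  [:: [:: E (1 / 8) 6]; [:: E (1 / 4) 3]; [:: E (1 / 4) 3; E (- (1 / 4)) 5];
    [:: E (- (1 / 4)) 2; E (- (1 / 8)) 6]; [:: E (- (1 / 2)) 1; E (1 / 4) 2; E (1 / 2) 3;
    E (- (1 / 4)) 5; E (1 / 8) 6]; [:: E (- (1 / 4)) 2; E (1 / 4) 3; E (- (1 / 2)) 4;
    E (- (1 / 4)) 5; E (- (1 / 4)) 6]]
  [:: [:: E 2 2; E 2 3; E (-2) 4; E (-2) 5]; [:: E (-4) 1; E (-4) 4]; [:: E 4 2]; [:: E (-2) 1;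
    E 2 3; E 2 4; E (-2) 6]; [:: E 4 2; E (-4) 3]; [:: E 8 1]].
- half_flat_by [:: [::]; [::]; [::]; [:: T 1 5 (-2)]; [:: T 1 3 1]; [:: T 1 4 2; T 2 3 (-1)]]
  [:: [:: E (1 / 2) 1]; [:: E (- (1 / 2)) 3]; Y 2; [:: E (- (1 / 2)) 5]; [:: E (1 / 2) 4];
    [:: E (- (1 / 2)) 6]]
  [:: [:: E 2 1]; Y 3; [:: E (-2) 2]; [:: E 2 5]; [:: E (-2) 4]; [:: E (-2) 6]].
- half_flat_by [:: [:: T 3 6 (-2); T 4 5 1]; [:: T 1 5 1; T 4 6 2]; [::]; [:: T 3 5 (-1)]; [::];
    [::]]
  [:: [:: E (-1) 5]; Y 6; Y 2; Y 4; Y 1; [:: E (- (1 / 2)) 3]]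
  [:: Y 5; Y 3; [:: E (-2) 6]; Y 4; [:: E (-1) 1]; Y 2].
- half_flat_by [:: [::]; [::]; [:: T 1 5 (-1)]; [:: T 1 6 (-1)]; [::]; [:: T 1 3 1]]
  [:: Y 1; [:: E (1 / 2) 3]; [:: E (- (1 / 2)) 4]; [:: E (1 / 2) 6]; [:: E (1 / 2) 2];
    [:: E (- (1 / 2)) 5]]
  [:: Y 1; [:: E 2 5]; [:: E 2 2]; [:: E (-2) 3]; [:: E (-2) 6]; [:: E 2 4]].
- half_flat_by [:: [:: T 3 5 (-4); T 4 6 (-4)]; [::]; [::]; [:: T 2 6 (-1)]; [:: T 2 3 (-4)];
    [::]]
  [:: [:: E (1 / 4) 6]; [:: E (- (1 / 4)) 2]; [:: E (1 / 4) 1]; [:: E (- (1 / 8)) 5];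
    [:: E (- (1 / 4)) 4]; [:: E (- (1 / 2)) 3]]
  [:: [:: E 4 3]; [:: E (-4) 2]; [:: E (-2) 6]; [:: E (-4) 5]; [:: E (-8) 4]; [:: E 4 1]].
- half_flat_by [:: [::]; [:: T 3 4 1; T 5 6 (-1)]; [::]; [:: T 1 3 (-1)]; [::]; [:: T 1 5 1]]
  [:: Y 2; Y 6; Y 3; [:: E (-1) 5]; Y 1; [:: E (-1) 4]]
  [:: Y 5; Y 1; Y 3; [:: E (-1) 6]; [:: E (-1) 4]; Y 2].
- half_flat_by [:: [::]; [:: T 1 6 (-1); T 3 6 1; T 4 5 (-1)]; [:: T 4 6 (-1)]; [::];
    [:: T 1 4 (-1)]; [::]]
  [:: Y 2; [:: E (-1) 6]; [:: X 2; E (-1) 5]; [:: E (-1) 1]; [:: E (-1) 4]; [:: E (-1) 3]]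
  [:: [:: E (-1) 4]; Y 1; [:: E (-1) 6]; [:: E (-1) 5]; [:: X 1; E (-1) 3]; [:: E (-1) 2]].
- half_flat_by [:: [:: T 2 5 4]; [::]; [:: T 1 2 (-2); T 4 5 (-4); T 5 6 2]; [:: T 2 4 (-2);
    T 2 6 (-1)]; [::]; [:: T 2 4 4; T 2 6 2]]
  [:: [:: E (- (1 / 2)) 4]; [:: E (1 / 2) 1]; [:: E (- (1 / 2)) 6]; [:: E (1 / 2) 3;
    E (- (1 / 2)) 5]; [:: E (- (1 / 4)) 2]; Y 5]
  [:: [:: E 2 2]; [:: E (-4) 5]; [:: E 2 4; X 6]; [:: E (-2) 1]; Y 6; [:: E (-2) 3]].
- half_flat_by [:: [::]; [::]; [:: T 1 5 2]; [:: T 2 5 2]; [::]; [:: T 1 3 1]]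
  [:: Y 2; Y 3; Y 4; Y 5; [:: E (- (1 / 2)) 1]; Y 6]
  [:: [:: E (-2) 5]; Y 1; Y 2; Y 3; Y 4; Y 6].
- half_flat_by [:: [::]; [:: T 3 5 1]; [::]; [:: T 1 3 (-1)]; [::]; [:: T 1 5 1]]
  [:: [:: E (-1) 1]; [:: E (1 / 4) 6]; [:: E (- (1 / 2)) 3]; [:: E (- (1 / 2)) 5];
    [:: E (1 / 2) 2]; [:: E (- (1 / 2)) 4]]
  [:: [:: E (-1) 1]; [:: E 2 5]; [:: E (-2) 3]; [:: E (-2) 6]; [:: E (-2) 4]; [:: E 4 2]].
- half_flat_by [:: [:: T 2 5 (-1)]; [::]; [:: T 1 2 (-1); T 4 5 1; T 5 6 1]; [:: T 1 5 1]; [::];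
    [::]]
  [:: [:: E (-1) 4]; Y 2; [:: E (-1) 6]; [:: X 3; E (-1) 5]; [:: E (-1) 1]; Y 3]
  [:: [:: E (-1) 5]; Y 2; Y 6; [:: E (-1) 1]; [:: E (-1) 4; X 6]; [:: E (-1) 3]].
- half_flat_by [:: [:: T 2 5 (-1); T 3 5 (-2); T 4 6 (-1)]; [:: T 4 5 (-1)]; [:: T 4 5 1]; [::];
    [::]; [:: T 2 4 (-1)]]
  [:: Y 6; [:: E (-1) 4]; [:: E (1 / 2) 3; X 4]; Y 1; Y 2; [:: E (-1) 5]]
  [:: Y 4; Y 5; [:: E 2 2; E 2 3]; [:: E (-1) 2]; [:: E (-1) 6]; Y 1].
- half_flat_by [:: [:: T 2 4 1]; [::]; [::]; [::]; [:: T 2 4 (-1)]; [:: T 2 3 1; T 4 5 (-1)]]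
  [:: [:: E (-1) 3; X 5]; Y 1; Y 4; Y 2; [:: E (-1) 5]; Y 6]
  [:: Y 2; Y 4; [:: E (-1) 1; E (-1) 5]; Y 3; [:: E (-1) 5]; Y 6].
- half_flat_by [:: [:: T 3 5 (-1); T 4 6 (-1)]; [::]; [::]; [::]; [::]; [:: T 2 4 (-2)]]
  [:: [:: E (-1) 6]; [:: E (1 / 2) 2]; [:: E (-1) 3]; Y 1; [:: E (-1) 4]; Y 5]
  [:: Y 4; [:: E 2 2]; [:: E (-1) 3]; [:: E (-1) 5]; Y 6; [:: E (-1) 1]].
- half_flat_by [:: [::]; [::]; [::]; [::]; [:: T 1 2 (-1); T 3 4 1]; [:: T 1 3 (-1);
    T 2 4 (-1)]]
  [:: Y 2; [:: E (-1) 3]; [:: E (-1) 4]; Y 1; Y 6; [:: E (-1) 5]]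
  [:: Y 4; Y 1; [:: E (-1) 2]; [:: E (-1) 3]; [:: E (-1) 6]; Y 5].
- half_flat_by [:: [:: T 3 6 (-1); T 4 5 (-2)]; [:: T 3 5 (-2)]; [::]; [::]; [::]; [::]]
  [:: [:: E (1 / 8) 6]; [:: E (1 / 4) 5]; [:: E (1 / 2) 1]; [:: E (- (1 / 4)) 3];
    [:: E (- (1 / 4)) 2]; [:: E (- (1 / 4)) 4]]
  [:: [:: E 2 3]; [:: E (-4) 5]; [:: E (-4) 4]; [:: E (-4) 6]; [:: E 4 2]; [:: E 8 1]].
- half_flat_by [:: [::]; [::]; [:: T 2 4 (-1)]; [::]; [::]; [:: T 2 5 (-1)]]
  [:: [:: E (-1) 4]; Y 1; [:: E (-1) 5]; Y 2; Y 3; [:: E (-1) 6]]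
  [:: Y 2; Y 4; Y 5; [:: E (-1) 1]; [:: E (-1) 3]; [:: E (-1) 6]].
- half_flat_by [:: [::]; [::]; [::]; [::]; [:: T 1 3 1; T 2 3 (-1)]; [:: T 1 4 1]]
  [:: Y 3; [:: E (-1) 2; X 3]; Y 1; Y 4; [:: E (-1) 5]; Y 6]
  [:: Y 3; [:: X 1; E (-1) 2]; Y 1; Y 4; [:: E (-1) 5]; Y 6].
- half_flat_by [:: [::]; [::]; [::]; [:: T 1 2 1; T 5 6 (-1)]; [::]; [::]]
  [:: [:: E (-2) 2]; [:: E (- (1 / 2)) 1]; [:: E (-1) 5]; [:: E (-1) 6]; [:: E (-1) 3];
    [:: E (-1) 4]]
  [:: [:: E (-2) 2]; [:: E (- (1 / 2)) 1]; [:: E (-1) 5]; [:: E (-1) 6]; [:: E (-1) 3];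
    [:: E (-1) 4]].
- half_flat_by [:: [::]; [::]; [::]; [:: T 1 5 1]; [::]; [::]]
  [:: Y 2; Y 5; [:: E 2 4]; [:: E (-1) 6]; Y 1; [:: E (- (1 / 2)) 3]]
  [:: Y 5; Y 1; [:: E (-2) 6]; [:: E (1 / 2) 3]; Y 2; [:: E (-1) 4]].
- half_flat_by ([:: [::]; [::]; [::]; [::]; [::]; [::]] : lie_data)
  [:: [:: E (1 / 2) 6]; Y 5; [:: E (-1) 2]; [:: E (-1) 4]; Y 1; [:: E (-1) 3]]
  [:: Y 5; [:: E (-1) 3]; [:: E (-1) 6]; [:: E (-1) 4]; Y 2; [:: E 2 1]].
Qed.

End Existence.

(** * Splittings along coordinates *)

Section CoordinateSplittings.
Variable R : realType.
Local Notation vec := 'rV[R]_6.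
Implicit Types (D : lie_data) (M : 'M[R]_6).

(** A decidable sufficient condition for e^p and e^q to span V1: closedness of both puts [g, g] into
    W, and a factor e^p or e^q in every term makes W abelian. *)
Definition splits D p q := [&& (p < 6)%N, (q < 6)%N, p != q, nth [::] D p == [::],
  nth [::] D q == [::] &
  all (all (fun t => (t.1.1.-1 \in [:: p; q]) || (t.1.2.-1 \in [:: p; q]))) D].

Lemma splits_adapted D p q M : size D = 6 -> splits D p q -> M \in unitmx ->
  (forall x, cf M x 0 = crd x p) -> (forall x, cf M x 1 = crd x q) ->
  adapted (brD 6 (@castD R D)) M.
Proof.
move=> sD /and5P [hp hq pq /eqP Dp /andP [/eqP Dq /allP hD]] Mu m0 m1.
have sD' : (size (@castD R D) <= 6)%N by rewrite size_map sD.
split=> // [x y|x y [x0 x1] [y0 y1]].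
  by split; rewrite ?m0 ?m1 crd_brD // nth_castD ?Dp ?Dq /= oppr0.
rewrite m0 in x0; rewrite m0 in y0; rewrite m1 in x1; rewrite m1 in y1.
apply: row_crd => k hk; rewrite crd_brD // crd0 nth_castD form2E big_map big_seq big1 ?oppr0 //.
move=> t ht; have kD : (k < size D)%N by rewrite sD.
have := allP (hD _ (mem_nth [::] kD)) t ht; rewrite !inE /=.
by case/orP => /orP [] /eqP ->; rewrite ?x0 ?y0 ?x1 ?y1 !(mul0r, mulr0) subrr mulr0.
Qed.

Lemma coord_frame p q : (p < 6)%N -> (q < 6)%N -> p != q ->
  exists M, [/\ M \in unitmx, forall x, cf M x 0 = crd x p & forall x, cf M x 1 = crd x q].
Proof.
move=> hp hq pq; pose i0 : 'I_6 := inord 0; pose i1 : 'I_6 := inord 1.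
pose p' := Ordinal hp; pose q' := Ordinal hq; pose r := tperm i0 p' i1.
have pr : r != p' by rewrite -[p'](tpermL i0) (inj_eq perm_inj) -val_eqE /= !inordK.
(* The first transposition moves 1 to [r]; the second sends [r] to [q'] and fixes [p'], which
   differs from both. *)
pose s := (tperm i0 p' * tperm r q')%g.
have s0 : s i0 = p'.
  by rewrite permM tpermL tpermD // -val_eqE /= eq_sym.
have s1 : s i1 = q' by rewrite permM tpermL.
have colE x j : (x *m perm_mx (s^-1)%g : vec) 0 j = x 0 (s j).
  rewrite mxE (bigD1 (s j)) //= big1 ?addr0 => [|i ij].
    by rewrite !mxE permK eqxx mulr1.
  by rewrite !mxE -(inj_eq (@perm_inj _ s)) permKV (negPf ij) mulr0.
exists (perm_mx (s^-1)%g); rewrite unitmx_perm; split=> // x; rewrite /cf /coform colE.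
  by rewrite s0 -crdE.
by rewrite s1 -crdE.
Qed.

Lemma half_flat_list_adapted D : D \in half_flat_list ->
  exists M, adapted (brD 6 (@castD R D)) M.
Proof.
move=> hD; have /nil6P /andP [/andP [/eqP sD _] _] : D \in nil6 by rewrite mem_cat hD.
have /hasP [[p q] _ /= h] : has (fun pq => splits D pq.1 pq.2)
    [seq (p, q) | p <- iota 0 6, q <- iota 0 6].
  by move: D hD {sD}; apply/allP.
have /and4P [hp hq pq _] := h.
have [M [Mu m0 m1]] := coord_frame hp hq pq.
by exists M; apply: splits_adapted h Mu m0 m1.
Qed.

Lemma adapted_iso (br1 br2 : bracket R 6) A M : A \in unitmx ->
  (forall x y, br2 (x *m A) (y *m A) = br1 x y *m A) -> adapted br2 M ->
  adapted br1 (A *m M).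
Proof.
move=> Au h [Mu hg hW].
have cfA x k : cf (A *m M) x k = cf M (x *m A) k by rewrite /cf /coform mulmxA.
have inWA x : inW (A *m M) x <-> inW M (x *m A) by rewrite /inW !cfA.
split=> [|x y|x y /inWA hx /inWA hy]; first by rewrite unitmx_mul Au.
  by apply/inWA; rewrite -h.
by rewrite -[LHS](mulmxK Au) -h hW // mul0mx.
Qed.

End CoordinateSplittings.

(** * Closed 3-forms on the listed algebras *)

Section ClosedForms.
Variable R : realType.
Local Notation vec := 'rV[R]_6.
Local Notation e := (fr (1%:M : 'M[R]_6)).
Implicit Types (D : lie_data) (a : form R).

(* The value of the alternating [A] at (m, k, l), for k < l, by its values at increasing
   triples. *)
Definition sort3 (A : nat -> nat -> nat -> R) (m k l : nat) : R :=
  if Nat.ltb m k then A m k l else if Nat.eqb m k then 0 else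
  if Nat.ltb m l then - A k m l else if Nat.eqb m l then 0 else A k l m.

Definition contr (A : nat -> nat -> nat -> R) (u : nat -> R) k l : R :=
  u 0 * sort3 A 0 k l + u 1 * sort3 A 1 k l + u 2 * sort3 A 2 k l +
  u 3 * sort3 A 3 k l + u 4 * sort3 A 4 k l + u 5 * sort3 A 5 k l.

Lemma alt3_contr a x k l : altform 3 a ->
  a [:: x; e k; e l] = contr (fun i j k => a [:: e i; e j; e k]) (crd x) k l.
Proof.
move=> ha; have [_ _ a0] := ha.
have sE m : a [:: e m; e k; e l] = sort3 (fun i j k => a [:: e i; e j; e k]) m k l.
  rewrite /sort3; case: Nat.ltb => //; case: PeanoNat.Nat.eqb_spec => [->|_].
    exact: (a0 [::]).
  have sw := alt_swap ha [::] [:: e l] (e m) (e k); rewrite /= in sw.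
  case: Nat.ltb => //; case: PeanoNat.Nat.eqb_spec => [e1|_].
    by rewrite sw e1 (a0 [:: e k] [::]) oppr0.
  by rewrite sw; have := alt_swap ha [:: e k] [::] (e m) (e l); rewrite /= => ->; rewrite opprK.
rewrite {1}(frame_expand (unitmx1 R 6) x) (alt_sum ha _ _ [::]) !big_ord_recl big_ord0.
by rewrite !(altZ ha _ [::]) /= !cf1E //= !sE /bump /= !add1n addr0 !addrA.
Qed.

Definition dalt (c : nat -> nat -> nat -> R) A (w x y z : nat) : R :=
  - contr A (c w x) y z + contr A (c w y) x z - contr A (c w z) x y
  - contr A (c x y) w z + contr A (c x z) w y - contr A (c y z) w x.

Lemma dalt_closed (D : sdata R) a : altform 3 a -> size D = 6 ->
  dCE (brD 6 D) a = @fzero R -> forall w x y z, (w < 6)%N -> (x < 6)%N -> (y < 6)%N ->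
  (z < 6)%N -> dalt (scD D) (fun i j k => a [:: e i; e j; e k]) w x y z = 0.
Proof.
move=> ha sD da w x y z hw hx hy hz.
have : dCE (brD 6 D) a [:: e w; e x; e y; e z] = 0 by rewrite da.
by rewrite dCE4E !(alt3_contr _ _ _ ha) !crd_brD_fr1.
Qed.

(** Precomposition with the projection [Q] onto W kills e 0 and e 1, leaving a form determined by
    the four given values. *)
Lemma alt3_inW a : altform 3 a -> a [:: e 2; e 3; e 4] = 0 -> a [:: e 2; e 3; e 5] = 0 ->
  a [:: e 2; e 4; e 5] = 0 -> a [:: e 3; e 4; e 5] = 0 ->
  forall x y z, inW 1%:M x -> inW 1%:M y -> inW 1%:M z -> a [:: x; y; z] = 0.
Proof.
move=> ha a1 a2 a3 a4; have Iu := unitmx1 R 6.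
pose Q := 1%:M - projU (1%:M : 'M[R]_6).
have QE x : inW 1%:M x -> x *m Q = x.
  by move=> /(inW_projU Iu) h; rewrite mulmxBr mulmx1 h subr0.
have Q0 k : (k < 2)%N -> e k *m Q = 0.
  move=> hk; apply: (cf_eq0 Iu) => j hj; rewrite mulmxBr mulmx1 cfD cfN cf_projU //.
  rewrite cf_fr //; last by lia.
  by case: ifP => h; rewrite ?subrr // subr0 ltn_eqF //; lia.
have b0 : pull Q a = @fzero R.
  apply: (alt_eq0_frame Iu (altform_pull _ ha)).
  have q k : (1 < k < 6)%N -> e k *m Q = e k by move=> hk; apply: QE; apply: fr_inW.
  have := (q 2 isT, q 3 isT, q 4 isT, q 5 isT, Q0 0 isT, Q0 1 isT)%N.
  move=> [[[[[q2 q3] q4] q5] q0] q1].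
  do 6 case; rewrite /= => // _; rewrite /pull /= ?q0 ?q1 ?q2 ?q3 ?q4 ?q5 //;
    exact: (alt0 ha [::]) || exact: (alt0 ha [:: _]).
move=> x y z hx hy hz.
have : pull Q a [:: x; y; z] = 0 by rewrite b0.
by rewrite /pull /= !QE.
Qed.

Definition closed_vanish D := forall a, altform 3 a ->
  dCE (brD 6 (@castD R D)) a = @fzero R ->
  forall x y z, inW 1%:M x -> inW 1%:M y -> inW 1%:M z -> a [:: x; y; z] = 0.

End ClosedForms.

Ltac dalt_at H := have := H isT isT isT isT;
  rewrite /dalt /contr /sort3 /scD /form2 /kdelta /=.

(** * The algebras whose closed 3-forms vanish on W *)

Section Vanishing.
Variable R : realType.
Implicit Types (D : lie_data).

(** W is spanned by e 2, ..., e 5, so four values must vanish for each algebra; each follows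
    linearly from the components of da named in its line. *)
Lemma non_half_flat_vanish D : D \in drop 2 non_half_flat_list -> closed_vanish R D.
Proof.
move: D; apply: mem_foldr_and; rewrite /=; repeat (apply: conj => //);
  move=> a ha da; have H := (fun s => dalt_closed ha s da) erefl; apply: (alt3_inW ha).
- by dalt_at (H 0 1 2 5)%N; dalt_at (H 0 1 3 4)%N; clear; lra.
- by dalt_at (H 0 2 3 4)%N; clear; lra.
- by dalt_at (H 0 1 4 5)%N; clear; lra.
- by dalt_at (H 0 2 4 5)%N; clear; lra.
- by dalt_at (H 0 1 2 5)%N; dalt_at (H 0 1 3 4)%N; clear; lra.
- by dalt_at (H 0 2 3 4)%N; clear; lra.
- by dalt_at (H 0 1 4 5)%N; clear; lra.
- by dalt_at (H 0 2 4 5)%N; clear; lra.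
- by dalt_at (H 0 1 2 4)%N; clear; lra.
- by dalt_at (H 0 1 2 5)%N; clear; lra.
- by dalt_at (H 0 2 3 5)%N; clear; lra.
- by dalt_at (H 0 1 4 5)%N; clear; lra.
- by dalt_at (H 0 1 2 4)%N; dalt_at (H 0 1 3 5)%N; clear; lra.
- by dalt_at (H 0 1 2 5)%N; dalt_at (H 0 1 3 4)%N; clear; lra.
- by dalt_at (H 0 2 3 4)%N; clear; lra.
- by dalt_at (H 0 1 4 5)%N; clear; lra.
- by dalt_at (H 0 1 2 4)%N; dalt_at (H 0 1 3 5)%N; clear; lra.
- by dalt_at (H 0 1 2 5)%N; clear; lra.
- by dalt_at (H 0 2 3 5)%N; clear; lra.
- by dalt_at (H 0 1 4 5)%N; clear; lra.
- by dalt_at (H 0 1 2 4)%N; clear; lra.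
- by dalt_at (H 0 1 2 5)%N; dalt_at (H 0 1 3 5)%N; clear; lra.
- by dalt_at (H 1 2 3 4)%N; clear; lra.
- by dalt_at (H 0 1 4 5)%N; clear; lra.
- by dalt_at (H 0 1 2 4)%N; clear; lra.
- by dalt_at (H 0 1 2 5)%N; dalt_at (H 0 1 3 4)%N; clear; lra.
- by dalt_at (H 0 2 3 4)%N; clear; lra.
- by dalt_at (H 0 1 4 5)%N; clear; lra.
- by dalt_at (H 0 1 2 3)%N; clear; lra.
- by dalt_at (H 0 2 3 4)%N; clear; lra.
- by dalt_at (H 0 1 2 5)%N; clear; lra.
- by dalt_at (H 0 1 3 5)%N; clear; lra.
Qed.

(** As d e^{k+1} = 12, the coordinate [k] of the bracket sum is, up to sign, the contraction of 12
    with omega, which the Pluecker argument shows to be nonzero. *)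
Lemma no_half_flat_vanish D k : D \in nil6 -> (k < 6)%N -> nth [::] D k = [:: P 1 2] ->
  closed_vanish R D -> ~ has_half_flat (brD 6 (@castD R D)).
Proof.
move=> hD hk Dk hv [om [ps [[M [Mu [-> ->]]] h1 h2]]].
have /andP [/andP [/eqP sD _] _] := nil6P hD.
have hl := altbr_brD 6 (@castD R D).
have hs := (domega_omegaP hl Mu (@unimodular_nil6 R D hD)).1 h1.
have /eqP [] := pluecker Mu (unitmx1 R 6) (hv _ (psiM_altform M) h2).
have := congr1 (fun x => crd x k) hs.
rewrite !crdD crd0 !crd_brD ?size_map ?sD // nth_castD Dk /= /plk !cf1E //.
by clear; lra.
Qed.

Lemma non_half_flat_12 D : D \in non_half_flat_list ->
  exists2 k, (k < 6)%N & nth [::] D k = [:: P 1 2].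
Proof.
move=> hD; have /hasP [k] : has (fun k => nth [::] D k == [:: P 1 2]) (iota 0 6).
  by move: D hD; apply/allP.
by rewrite mem_iota => hk /eqP e1; exists k.
Qed.

Lemma no_half_flat_abelian D : D \in drop 2 non_half_flat_list ->
  ~ has_half_flat (brD 6 (@castD R D)).
Proof.
move=> hD; have hD' := mem_drop hD.
have [k hk Dk] := non_half_flat_12 hD'.
by apply: (no_half_flat_vanish _ hk Dk (non_half_flat_vanish hD)); rewrite mem_cat hD' orbT.
Qed.

Lemma non_half_flat_adapted D : D \in drop 2 non_half_flat_list ->
  adapted (brD 6 (@castD R D)) 1%:M.
Proof.
move=> hD; have /nil6P /andP [/andP [/eqP sD _] _] : D \in nil6.
  by rewrite mem_cat (mem_drop hD) orbT.
have h : splits D 0 1 by move: D hD {sD}; apply/allP.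
by apply: splits_adapted sD h (unitmx1 _ _) _ _ => x; rewrite cf1E.
Qed.

End Vanishing.

(** * The two algebras without coherent splitting *)

Section NoSplitting.
Variable R : realType.
Local Notation vec := 'rV[R]_6.
Local Notation e := (fr (1%:M : 'M[R]_6)).
Implicit Types (D : lie_data) (M : 'M[R]_6).

(** An adapted splitting makes [g, g] abelian, whereas the term 34 of d e^6 does not vanish on the
    commutators [x, y] and [x, [x, y]] of the first two basis vectors. *)
Lemma not_adapted D M : D \in take 2 non_half_flat_list ->
  ~ adapted (brD 6 (@castD R D)) M.
Proof.
have bE br : adapted br M -> forall x y : vec, br (br x y) (br x (br x y)) = 0.
  by case=> _ hg hW x y; apply: hW; apply: hg.
move: D; apply: mem_foldr_and; rewrite /=; repeat (apply: conj => //);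
  move=> /bE/(_ (e 0) (e 1))/(congr1 (fun x => crd x 5));
  rewrite !crd_brD // !crd_fr1 // crd0 /form2 /kdelta /=; lra.
Qed.

(* The almost complex structure J v_0 = v_1, J v_2 = v_3, J v_4 = v_5; locked, so that
   rewriting with linearity of [cf] does not see through it. *)
Definition cstr M (x : vec) : vec := locked (
  - cf M x 1 *: fr M 0 + cf M x 0 *: fr M 1 - cf M x 3 *: fr M 2 + cf M x 2 *: fr M 3
  - cf M x 5 *: fr M 4 + cf M x 4 *: fr M 5).

Lemma cstrE M x : cstr M x =
  - cf M x 1 *: fr M 0 + cf M x 0 *: fr M 1 - cf M x 3 *: fr M 2 + cf M x 2 *: fr M 3
  - cf M x 5 *: fr M 4 + cf M x 4 *: fr M 5.
Proof. by rewrite /cstr -lock. Qed.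

Section Cstr.
Variable M : 'M[R]_6.
Hypothesis Mu : M \in unitmx.

Lemma cf_cstr x :
  (cf M (cstr M x) 0 = - cf M x 1) * (cf M (cstr M x) 1 = cf M x 0) *
  (cf M (cstr M x) 2 = - cf M x 3) * (cf M (cstr M x) 3 = cf M x 2) *
  (cf M (cstr M x) 4 = - cf M x 5) * (cf M (cstr M x) 5 = cf M x 4).
Proof.
by do !split; rewrite cstrE !(cfD, cfN, cfZ) !cf_fr //=; ring.
Qed.

Lemma cf_inj (x y : vec) : (forall k, (k < 6)%N -> cf M x k = cf M y k) -> x = y.
Proof.
move=> h; apply/eqP; rewrite -subr_eq0; apply/eqP; apply: (cf_eq0 Mu) => k hk.
by rewrite cfD cfN h // subrr.
Qed.

Lemma cstr_lin a b x y : cstr M (a *: x + b *: y) = a *: cstr M x + b *: cstr M y.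
Proof.
apply: cf_inj; do 6 (case=> [_|]; [rewrite !(cfD, cfZ) !cf_cstr !(cfD, cfZ); ring|]).
by [].
Qed.

Lemma cstrK x : cstr M (cstr M x) = - x.
Proof.
by apply: cf_inj; do 6 (case=> [_|]; [rewrite cfN !cf_cstr ?opprK //|]).
Qed.

Lemma psi_cstr x y : psiM M [:: x; cstr M x; y] = 0.
Proof. by rewrite psiME /psi0 /vol3 !cf_cstr; ring. Qed.

(* [psi(., u, y) = 0] says that u and y are complex proportional. *)
Lemma psi_proportional u y : (forall z, psiM M [:: z; u; y] = 0) ->
  exists a b, (\sum_(i < 6) cf M y i ^+ 2) *: u = a *: y + b *: cstr M y.
Proof.
move=> h; pose U i := cf M u i; pose Y i := cf M y i.
(* Real and imaginary parts of the hermitian product of [u] with [y]. *)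
exists (Y 0%N * U 0%N + Y 1%N * U 1%N + Y 2%N * U 2%N + Y 3%N * U 3%N + Y 4%N * U 4%N
  + Y 5%N * U 5%N), (Y 0%N * U 1%N - Y 1%N * U 0%N + Y 2%N * U 3%N - Y 3%N * U 2%N
  + Y 4%N * U 5%N - Y 5%N * U 4%N).
have := (h (fr M 0), h (fr M 1), h (fr M 2), h (fr M 3), h (fr M 4), h (fr M 5)).
rewrite !psiME /psi0 /vol3 !cf_fr //= -!/(U _) -!/(Y _) => - [[[[[h0 h1] h2] h3] h4] h5].
have m c x : x = 0 -> c * x = 0 :> R by move=> ->; rewrite mulr0.
apply: cf_inj => k hk.
rewrite !(cfD, cfZ) !big_ord_recl big_ord0 /= -?/(Y _) /bump /= !add1n -!/(Y _).
case: k hk => [|[|[|[|[|[|k]]]]]] // _; rewrite ?cf_cstr -?/(U _) -?/(Y _).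
- move: (m (Y 2%N) _ h4) (m (Y 3%N) _ h5) (m (Y 4%N) _ h2) (m (Y 5%N) _ h3); clear; lra.
- move: (m (Y 3%N) _ h4) (m (Y 2%N) _ h5) (m (Y 5%N) _ h2) (m (Y 4%N) _ h3); clear; lra.
- move: (m (Y 0%N) _ h4) (m (Y 1%N) _ h5) (m (Y 4%N) _ h0) (m (Y 5%N) _ h1); clear; lra.
- move: (m (Y 1%N) _ h4) (m (Y 0%N) _ h5) (m (Y 5%N) _ h0) (m (Y 4%N) _ h1); clear; lra.
- move: (m (Y 0%N) _ h2) (m (Y 1%N) _ h3) (m (Y 2%N) _ h0) (m (Y 3%N) _ h1); clear; lra.
- move: (m (Y 1%N) _ h2) (m (Y 0%N) _ h3) (m (Y 3%N) _ h0) (m (Y 2%N) _ h1); clear; lra.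
Qed.

Lemma sqnorm_neq0 x : x != 0 -> \sum_(i < 6) cf M x i ^+ 2 != 0.
Proof.
move=> x0; apply: contraNneq x0 => s0; apply/eqP; apply: (cf_eq0 Mu) => k hk.
have := @psumr_eq0P _ _ predT (fun i : 'I_6 => cf M x i ^+ 2) (fun i _ => sqr_ge0 _) s0.
by move=> /(_ (Ordinal hk) isT)/eqP; rewrite sqrf_eq0 => /eqP.
Qed.

End Cstr.

(** These values give a(., e 4, e 5) = 0 and make a(., e 3, e 5) a multiple of the coordinate 0. *)
Lemma closed_special D a : D \in take 2 non_half_flat_list -> altform 3 a ->
  dCE (brD 6 (@castD R D)) a = @fzero R ->
  [/\ a [:: e 0; e 4; e 5] = 0, a [:: e 1; e 4; e 5] = 0, a [:: e 2; e 4; e 5] = 0 &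
      [/\ a [:: e 3; e 4; e 5] = 0, a [:: e 1; e 3; e 5] = 0 & a [:: e 2; e 3; e 5] = 0]].
Proof.
move=> hD ha; move: D hD; apply: mem_foldr_and; rewrite /=; repeat (apply: conj => //);
  move=> da; have H := (fun s => dalt_closed ha s da) erefl;
  (split; [| | |split]).
- by dalt_at (H 0 2 3 4)%N; clear; lra.
- by dalt_at (H 0 1 3 5)%N; dalt_at (H 1 2 3 4)%N; clear; lra.
- by dalt_at (H 0 1 4 5)%N; clear; lra.
- by dalt_at (H 0 2 4 5)%N; clear; lra.
- by dalt_at (H 0 1 2 5)%N; dalt_at (H 0 2 3 4)%N; clear; lra.
- by dalt_at (H 0 1 3 5)%N; dalt_at (H 1 2 3 4)%N; clear; lra.
- by dalt_at (H 0 2 3 4)%N; clear; lra.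
- by dalt_at (H 0 1 3 5)%N; dalt_at (H 1 2 3 4)%N; clear; lra.
- by dalt_at (H 0 1 4 5)%N; clear; lra.
- by dalt_at (H 0 2 4 5)%N; clear; lra.
- by dalt_at (H 0 1 2 5)%N; clear; lra.
- by dalt_at (H 0 1 3 5)%N; dalt_at (H 1 2 3 4)%N; clear; lra.
Qed.

Lemma no_half_flat_special D : D \in take 2 non_half_flat_list ->
  ~ has_half_flat (brD 6 (@castD R D)).
Proof.
move=> hD [om [ps [[M [Mu [-> ->]]] h1 h2]]].
rewrite -/(omegaM M) in h1; rewrite -/(psiM M) in h2.
have hD' : D \in nil6 by rewrite mem_cat (mem_take hD) orbT.
have /andP [/andP [/eqP sD _] _] := nil6P hD'.
have ha := psiM_altform M.
have [a045 a145 a245 [a345 a135 a235]] := closed_special hD ha h2.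
have {h1} hs := (domega_omegaP (altbr_brD 6 (@castD R D)) Mu (@unimodular_nil6 R D hD')).1 h1.
have [D2 D3] : nth [::] D 2 = [:: P 1 2] /\ nth [::] D 3 = [:: P 1 3].
  by move: (D) hD; apply: mem_foldr_and.
pose v := fr M; pose al i := crd (v i) 0.
have p1 : al 0 * crd (v 1) 1 - al 1 * crd (v 0) 1 + al 2 * crd (v 3) 1 - al 3 * crd (v 2) 1
    + al 4 * crd (v 5) 1 - al 5 * crd (v 4) 1 = 0.
  have := congr1 (fun x => crd x 2) hs.
  rewrite !crdD crd0 !crd_brD ?size_map ?sD // nth_castD D2 /= /al /v.
  by clear; lra.
have p2 : al 0 * crd (v 1) 2 - al 1 * crd (v 0) 2 + al 2 * crd (v 3) 2 - al 3 * crd (v 2) 2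
    + al 4 * crd (v 5) 2 - al 5 * crd (v 4) 2 = 0.
  have := congr1 (fun x => crd x 3) hs.
  rewrite !crdD crd0 !crd_brD ?size_map ?sD // nth_castD D3 /= /al /v.
  by clear; lra.
have crd_sum I (s : seq I) (F : I -> vec) k :
    crd (\sum_(i <- s) F i) k = \sum_(i <- s) crd (F i) k.
  by elim: s => [|i s IH]; rewrite ?big_nil ?crd0 // !big_cons crdD IH.
have crdN x k : crd (- x : vec) k = - crd x k by rewrite -scaleN1r crdZ mulN1r.
(* [w'] is dual to the coordinate 0 for the metric in which the frame [v] is orthonormal, and [w] =
   J w' is dual to it through omega. The coordinate p of [w] is thus the contraction with omega of
   the product of the coordinate forms 0 and p, and [p1], [p2] make the coordinates 1 and 2
   vanish. *)
pose w' := \sum_(i < 6) al i *: v i; pose w := cstr M w'.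
have cw' i : (i < 6)%N -> cf M w' i = al i.
  move=> hi; rewrite /w' cf_sum (bigD1 (Ordinal hi)) //= cfZ cf_fr // eqxx mulr1 big1 ?addr0 //.
  move=> j; rewrite -val_eqE /= => /negPf ji; by rewrite cfZ cf_fr // ji mulr0.
pose n0 := crd w' 0.
have n0E : n0 = \sum_(i < 6) al i ^+ 2.
  by rewrite /n0 crd_sum; apply: eq_bigr => i _; rewrite crdZ expr2.
have crd0E x : crd x 0 = \sum_(i < 6) cf M x i * al i.
  rewrite {1}(frame_expand Mu x) crd_sum; apply: eq_bigr => i _; by rewrite crdZ.
have n00 : n0 != 0.
  rewrite n0E; apply/eqP => s0.
  have := @psumr_eq0P _ _ predT (fun i : 'I_6 => al i ^+ 2) (fun i _ => sqr_ge0 _) s0 => z.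
  have := crd0E (e 0); rewrite crd_fr1 // big1 => [/eqP|i _]; first by rewrite oner_eq0.
  by have /eqP := z i isT; rewrite sqrf_eq0 => /eqP ->; rewrite mulr0.
have wE p : crd w p = al 0 * crd (v 1) p - al 1 * crd (v 0) p + al 2 * crd (v 3) p
    - al 3 * crd (v 2) p + al 4 * crd (v 5) p - al 5 * crd (v 4) p.
  rewrite /w cstrE !cw' // !crdD !crdN !crdZ -/v; ring.
have [w0 w1 w2] : [/\ crd w 0 = 0, crd w 1 = 0 & crd w 2 = 0].
  by split; rewrite wE //; rewrite /al; ring.
have wS : w = crd w 3 *: e 3 + crd w 4 *: e 4 + crd w 5 *: e 5.
  apply: row_crd => k hk; rewrite !crdD !crdZ !crd_fr1 //.
  case: k hk => [|[|[|[|[|[|k]]]]]] // _; rewrite /kdelta /= ?w0 ?w1 ?w2; ring.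
have aC z k l : psiM M [:: z; e k; e l] =
    contr (fun i j k => psiM M [:: e i; e j; e k]) (crd z) k l by apply: alt3_contr.
have z45 z : psiM M [:: z; e 4; e 5] = 0.
  by rewrite aC /contr /sort3 /= a045 a145 a245 a345; ring.
have z35 z : psiM M [:: z; e 3; e 5] = crd z 0 * psiM M [:: e 0; e 3; e 5].
  by rewrite aC /contr /sort3 /= a135 a235 a345; ring.
have z55 z : psiM M [:: z; e 5; e 5] = 0 by case: ha => _ _ h; apply: (h [:: z] [::]).
(* Evaluation of psi(x, Jx, .) = 0 at x = w' and e 5. *)
have key : crd w 3 * n0 * psiM M [:: e 0; e 3; e 5] = 0.
  transitivity (psiM M [:: w'; w; e 5]); last exact: psi_cstr.
  rewrite [in RHS]wS (altD ha [:: w']) (altD ha [:: w']) !(altZ ha _ [:: w']) /= z45 z55 (z35 w').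
  by rewrite /n0; ring.
pose n5 := \sum_(i < 6) cf M (e 5) i ^+ 2.
have n50 : n5 != 0.
  apply: (sqnorm_neq0 Mu); apply/eqP => e50; have := @crd_fr1 R 5 isT.
  rewrite e50 => /(congr1 (fun f => f 5%N)); rewrite crd0 /kdelta /= => /eqP.
  by rewrite eq_sym oner_eq0.
(* Thus e 4 lies in the complex line of e 5; being independent they span it, so J e 5 has zero
   coordinates 0 and 3. *)
have [c [d E4]] := psi_proportional Mu z45; rewrite -/n5 in E4.
pose j := cstr M (e 5).
have C4 k : n5 * kdelta R 4 k = c * kdelta R 5 k + d * crd j k.
  by have := congr1 (fun x => crd x k) E4; rewrite crdD !crdZ !crd_fr1.
have d0 : d != 0.
  apply/eqP => d0; move: (C4 4%N); rewrite d0 /kdelta /= mulr1 mulr0 mul0r addr0 => /eqP.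
  by rewrite (negPf n50).
have j3 : crd j 3 = 0.
  apply: (mulfI d0); move: (C4 3%N); rewrite /kdelta /= !mulr0 add0r => <-; by [].
have j0 : crd j 0 = 0.
  apply: (mulfI d0); move: (C4 0%N); rewrite /kdelta /= !mulr0 add0r => <-; by [].
(* If this value also vanished, e 3 would be a third independent vector in that complex line. *)
have [a035|a035] := eqVneq (psiM M [:: e 0; e 3; e 5]) 0.
  have z35' z : psiM M [:: z; e 3; e 5] = 0 by rewrite z35 a035 mulr0.
  have [c' [d' E3]] := psi_proportional Mu z35'.
  have := congr1 (fun x => crd x 3) E3; rewrite -/n5 crdD !crdZ !crd_fr1 // -/j j3 /kdelta /=.
  by rewrite mulr1 !mulr0 addr0 => /eqP; rewrite (negPf n50).
have w3 : crd w 3 = 0.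
  apply: (mulIf n00); apply: (mulIf a035); by rewrite key !mul0r.
have J4 : n5 *: cstr M (e 4) = c *: j - d *: e 5.
  have := congr1 (cstr M) E4; rewrite cstr_lin // -/j {2}/j cstrK // scalerN => <-.
  have := cstr_lin Mu n5 0 (e 4) 0; by rewrite !scale0r !addr0.
have j4 : crd (cstr M (e 4)) 0 = 0.
  apply: (mulfI n50); rewrite -crdZ J4 crdD crdN !crdZ crd_fr1 // j0 /kdelta /=; ring.
(* Now [w] lies in the complex line spanned by e 4 and e 5, hence so does J w = -w', although the
   coordinate 0 of [w'] is not zero. *)
have : crd (cstr M w) 0 = 0.
  by rewrite wS w3 scale0r add0r cstr_lin // crdD !crdZ j4 -/j j0; ring.
by rewrite cstrK // crdN => /eqP; rewrite oppr_eq0 (negPf n00).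
Qed.

End NoSplitting.

(** * The criterion on the two lists *)

Section Criterion.
Variable R : realType.
Implicit Types (D : lie_data) (br : bracket R 6).

Lemma half_flat_criterion br D : lie br -> nilp br -> D \in half_flat_list ->
  iso br (brD 6 (@castD R D)) ->
  (exists M, coherent br M) /\ (forall M, coherent br M -> hpq_nonzero br M 0 3).
Proof.
move=> hl hn hD hi; have hD' : D \in nil6 by rewrite mem_cat hD.
have hf := has_half_flat_iso hi (half_flat_listP R hD).
have hu : unimodular br.
  exact: (unimodular_iso (altbr_brD _ _) (iso_sym hi) (@unimodular_nil6 R D hD')).
split=> [|M /(coherent_adapted hl hn)]; last exact: half_flat_hpq.
have [A [Au hA]] := hi; have [M hM] := half_flat_list_adapted R hD.
have hM' := adapted_iso Au hA hM; have [Mu _ _] := hM'.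
by exists (A *m M); apply: (adapted_coherent Mu hl hM').
Qed.

Lemma non_half_flat_criterion br D : lie br -> nilp br -> D \in non_half_flat_list ->
  iso br (brD 6 (@castD R D)) ->
  ~ has_half_flat br /\
  ~ ((exists M, coherent br M) /\ (forall M, coherent br M -> hpq_nonzero br M 0 3)).
Proof.
move=> hl hn; rewrite -{1}(cat_take_drop 2 non_half_flat_list) mem_cat => hD hi.
have [A [Au hA]] := hi; have [B [Bu hB]] := iso_sym hi.
split=> [hf|[[M hM] h]].
  by case/orP: hD => hD; [apply: (no_half_flat_special hD)|apply: (no_half_flat_abelian hD)];
    apply: has_half_flat_iso (iso_sym hi) hf.
case/orP: hD => hD.
  exact: (not_adapted hD (adapted_iso Bu hB (coherent_adapted hl hn hM))).
have hN := adapted_iso Au hA (non_half_flat_adapted R hD).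
have [Nu _ _] := hN.
apply: (hpq_zero Nu _ (h _ (adapted_coherent Nu hl hN))) => a ha da x y z hx hy hz.
have BA : forall x : 'rV[R]_6, x *m A *m invmx A = x by move=> u; rewrite mulmxK.
have hAi : forall x y, br (x *m invmx A) (y *m invmx A) = brD 6 (castD D) x y *m invmx A.
  by move=> u v; rewrite -[u in RHS](mulmxKV Au) -[v in RHS](mulmxKV Au) hA mulmxK.
have dp : dCE (brD 6 (castD D)) (pull (invmx A) a) = @fzero R.
  by rewrite -(dCE_pull _ hAi) da.
have inWA u : inW (A *m 1%:M) u -> inW 1%:M (u *m A).
  by rewrite /inW /cf /coform !mulmxA.
have := non_half_flat_vanish hD (altform_pull _ ha) dp (inWA _ hx) (inWA _ hy) (inWA _ hz).
by rewrite /pull /= !BA.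
Qed.

End Criterion.

Theorem theorem5 (R : realType) :
  (* the listed Lie algebras are 6-dimensional nilpotent Lie algebras *)
  (forall D, D \in half_flat_list ++ non_half_flat_list ->
     is_lie (bracket_of (R:=R) D) /\ nilpotent (bracket_of (R:=R) D)) /\
  forall br : 'rV[R]_6 -> 'rV[R]_6 -> 'rV[R]_6,
    is_lie br -> nilpotent br ->
    [/\ has_half_flat br <->
          ((exists M, coherent br M) /\
           (forall M, coherent br M -> hpq_nonzero br M 0 3)),
        has_half_flat br <->
          (exists2 D, D \in half_flat_list & lie_iso br (bracket_of D)) &
        ~ has_half_flat br <->
          (exists2 D, D \in non_half_flat_list & lie_iso br (bracket_of D))].
Proof.
have bE D : D \in nil6 -> bracket_of (R:=R) D = brD 6 (castD D).
  by move=> /nil6P /andP [w _]; apply: bracket_ofE.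
split=> [D hD|br hl hn].
  by rewrite bE //; split; [apply: lie_nil6|apply: nilp_nil6].
have hf D : D \in half_flat_list -> lie_iso br (bracket_of D) -> has_half_flat br.
  move=> hD; rewrite bE; last by rewrite mem_cat hD.
  by move=> hi; apply: has_half_flat_iso hi (half_flat_listP R hD).
have nhf D : D \in non_half_flat_list -> lie_iso br (bracket_of D) -> ~ has_half_flat br.
  move=> hD; rewrite bE; last by rewrite mem_cat hD orbT.
  by move=> hi; case: (non_half_flat_criterion hl hn hD hi).
(* Each list decides both the existence of a half-flat structure and the criterion, so the
   equivalences, and with them the disjointness of the lists, follow from the list on which [br] is
   found. *)
have [D hD hi] := classified6 hl hn; have hi' := hi; rewrite -bE // in hi'.
move: hD; rewrite mem_cat => /orP [] hD.
  have H := hf _ hD hi'; have [c1 c2] := half_flat_criterion hl hn hD hi.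
  split; first by split.
    by split=> // _; exists D.
  by split=> [/(_ H) //|[D' hD' hi2]]; apply: nhf hi2.
have [H1 H2] := non_half_flat_criterion hl hn hD hi.
split; first by split=> [/H1|/H2].
  by split=> [/H1 //|[D' hD' hi2]]; apply: hf hi2.
by split=> // _; exists D.
Qed.
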